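(* Let $S\subset\mathbb{R}^3$ be a smooth oriented umbilic-free surface with conformal principal curvatures $\theta_1,\theta_2$, and let $p\in S$ be a non-Dupin point. Let $\alpha$ be the angle with $$\tan\alpha=\sqrt[3]{\theta_1(p)/\theta_2(p)}$$ (real cube root; $\alpha=\pi/2$ if $\theta_2(p)=0$), and consider the tangent direction at $p$ which makes with the two lines of curvature of $S$ through $p$ the angles $\alpha$ and $\pi/2-\alpha$, that is, the direction spanned by $\cos\alpha\,X_1+\sin\alpha\,X_2$. (i) There exists a one-parameter family of Dupin cyclides tangent to $S$ at $p$ of order $3$ in the direction $\alpha$. (ii) If $p$ is a non-canal point, then there exists at $p$ exactly one osculating cyclide, that is, exactly one cyclide tangent to $S$ at $p$ in the direction $\alpha$ of order $4$.
   Context: Let $S$ be a smooth oriented umbilic-free surface in $\mathbb{R}^3$ with principal curvatures $k_1>k_2$ and local unit vector fields $X_1,X_2$ tangent to the corresponding lines of curvature. Put $\mu=(k_1-k_2)/2$. The conformal principal curvatures of $S$ are $\theta_1=\mu^{-2}X_1(k_1)$ and $\theta_2=\mu^{-2}X_2(k_2)$. A point of $S$ is a canal point if at least one of $\theta_1,\theta_2$ vanishes there, and a Dupin point if both vanish there; points which are not canal (respectively not Dupin) are called non-canal (respectively non-Dupin). Dupin cyclides are surfaces which are envelopes of two different one-parameter families of spheres; locally they are characterized by the vanishing of both conformal principal curvatures. Given $p\in S$, there is a unique Möbius transformation $g$ bringing $S$ to standard position at $p$: $g(p)=(0,0,0)$, the tangent plane of $g(S)$ at the origin is the $(x,y)$-plane,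 the $x$- and $y$-axes correspond to $X_1$ and $X_2$, and near the origin $g(S)$ is the graph of a function of the form $z=\frac12(x^2-y^2)+\frac16(\theta_1x^3+\theta_2y^3)+O(4)$, where $\theta_1,\theta_2$ are evaluated at $p$ and $O(4)$ denotes terms of order at least $4$. The cyclides $C$ considered at $p$ are those which the same $g$ brings to standard position, so that $g(C)$ is locally a graph $z=\frac12(x^2-y^2)+O(4)$; they have the same principal directions and the same osculating spheres at $p$ as $S$. Tangency of order $n$ of $S$ and $C$ at $p$ in the direction $\alpha$ means that the functions whose graphs are $g(S)$ and $g(C)$, restricted to the line through the origin of the $(x,y)$-plane in the direction $(\cos\alpha,\sin\alpha)$ (the line $y=tx$ with $t=\tan\alpha$, if $\alpha\neq\pi/2$), agree at the origin up to and including terms of order $n$.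
   Formalization: The direction is corrected to the one spanned by cos α X1 − sin α X2 (angle −α): along cos α X1 + sin α X2 the cubic term is 2θ1cos³α/6, nonzero at non-canal points, so no cyclide would be tangent there of order 3. *)

(* Defs.v *)
From Stdlib Require Import Reals List.
From Coquelicot Require Import Coquelicot.
Open Scope R_scope.

(** * Smooth functions and euclidean space *)

(** Directional derivative, as a total function. *)
Definition ddir {E : NormedModule R_AbsRing} (v : E) (f : E -> R) (x : E) : R :=
  Derive (fun t : R => f (plus x (scal t v))) 0.

(** C^oo on an open set [U]: all iterated directional derivatives are
    (Frechet) differentiable at every point of [U]. *)
Definition smooth_on {E : NormedModule R_AbsRing} (U : E -> Prop) (f : E -> R)
  : Prop :=
  forall (vs : list E) (x : E), U x ->
    ex_filterdiff (fold_right ddir f vs) (locally x).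

Definition smooth_near {E : NormedModule R_AbsRing} (x : E) (f : E -> R) : Prop :=
  exists U : E -> Prop, open U /\ U x /\ smooth_on U f.

Notation R2 := (R * R)%type.
Notation R3 := (R * R * R)%type.

Definition cx (p : R3) : R := fst (fst p).
Definition cy (p : R3) : R := snd (fst p).
Definition cz (p : R3) : R := snd p.

Definition dot (p q : R3) : R := cx p * cx q + cy p * cy q + cz p * cz q.

Definition smooth_map {E : NormedModule R_AbsRing} (U : E -> Prop) (f : E -> R3)
  : Prop :=
  smooth_on U (fun w => cx (f w)) /\ smooth_on U (fun w => cy (f w)) /\
  smooth_on U (fun w => cz (f w)).

(** * Surfaces *)

(** Regular surfaces: every point has a neighbourhood [V] such that [V] meets
    [S] in the image of a smooth immersion [r] of an open set [W] of the plane
    which is a homeomorphism onto its image, with inverse [s]. *)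
Definition smooth_surface (S : R3 -> Prop) : Prop :=
  forall p : R3, S p ->
  exists (W : R2 -> Prop) (V : R3 -> Prop) (r : R2 -> R3) (s : R3 -> R2),
    open W /\ open V /\ V p /\ smooth_map W r /\
    (forall w, W w -> S (r w) /\ V (r w) /\ s (r w) = w) /\
    (forall q, S q -> V q ->
       W (s q) /\ r (s q) = q /\
       filterlim s (within S (locally q)) (locally (s q))) /\
    (forall w v : R2, W w ->
       is_derive (fun t : R => r (plus w (scal t v))) 0 (zero : R3) -> v = zero).

(** [h] is defined along [S]; its derivative at [p] in the direction of the
    tangent vector [v] is computed along a curve of [S] with velocity [v]. *)
Definition is_derive_along {V : NormedModule R_AbsRing} (S : R3 -> Prop)
    (h : R3 -> V) (p v : R3) (l : V) : Prop :=
  exists c : R -> R3,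
    c 0 = p /\ locally 0 (fun t => S (c t)) /\ is_derive c 0 v /\
    is_derive (fun t => h (c t)) 0 l.

Definition tangent_vector (S : R3 -> Prop) (p v : R3) : Prop :=
  exists c : R -> R3, c 0 = p /\ locally 0 (fun t => S (c t)) /\ is_derive c 0 v.

(** An orientation is a continuous unit normal field. *)
Definition oriented_surface (S : R3 -> Prop) (N : R3 -> R3) : Prop :=
  smooth_surface S /\
  forall p, S p ->
    dot (N p) (N p) = 1 /\
    (forall v, tangent_vector S p v -> dot (N p) v = 0) /\
    filterlim N (within S (locally p)) (locally (N p)).

(** [X] is a unit vector tangent to [S] at [p] with [- dN_p(X) = k X]. *)
Definition principal_vector (S : R3 -> Prop) (N : R3 -> R3) (p : R3) (k : R)
    (X : R3) : Prop :=
  dot X X = 1 /\ is_derive_along S N p X (opp (scal k X) : R3).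

(** Umbilic-free: the principal curvatures satisfy [k2 < k1] everywhere. *)
Definition principal_curvatures (S : R3 -> Prop) (N : R3 -> R3) (k1 k2 : R3 -> R)
  : Prop :=
  forall p, S p ->
    k2 p < k1 p /\
    (exists X1, principal_vector S N p (k1 p) X1) /\
    (exists X2, principal_vector S N p (k2 p) X2).

(** [theta = mu^-2 X(k)] at [p], with [mu = (k1 - k2) / 2]; used with
    [(k, X) = (k1, X1)] and [(k, X) = (k2, X2)].  Only the value [X] at [p] of
    the field of principal vectors matters. *)
Definition conformal_curvature (S : R3 -> Prop) (k1 k2 k : R3 -> R) (X p : R3)
    (theta : R) : Prop :=
  exists l : R, is_derive_along S k p X l /\ theta = l / ((k1 p - k2 p) / 2) ^ 2.

(** * Spheres, envelopes and Dupin cyclides *)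

(** The sphere of equation [a |x|^2 - 2 <b, x> + c = 0].  For [a = 0] it is a
    plane: planes count as spheres. *)
Record sphere := Sphere { sph_a : R; sph_b : R3; sph_c : R }.

Definition sphere_eq (s : sphere) (x : R3) : R :=
  sph_a s * dot x x - 2 * dot (sph_b s) x + sph_c s.

(** For [a <> 0] this says that the squared radius is positive, and for [a = 0]
    that the normal [b] of the plane is nonzero. *)
Definition true_sphere (s : sphere) : Prop :=
  0 < dot (sph_b s) (sph_b s) - sph_a s * sph_c s.

Definition same_sphere (s s' : sphere) : Prop :=
  forall x, sphere_eq s x = 0 <-> sphere_eq s' x = 0.

Definition in_interval (a b : Rbar) (t : R) : Prop := Rbar_lt a t /\ Rbar_lt t b.

(** A smooth one-parameter family of spheres over the open interval [(a, b)].
    Equations of spheres being defined up to a factor, the last clause says that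
    the family is immersed in the space of spheres. *)
Definition sphere_family (a b : Rbar) (s : R -> sphere) : Prop :=
  smooth_on (in_interval a b) (fun t => sph_a (s t)) /\
  smooth_map (in_interval a b) (fun t => sph_b (s t)) /\
  smooth_on (in_interval a b) (fun t => sph_c (s t)) /\
  (forall t, in_interval a b t -> true_sphere (s t)) /\
  (forall t, in_interval a b t ->
     ~ exists l : R, forall x : R3,
         Derive (fun t' => sphere_eq (s t') x) t = l * sphere_eq (s t) x).

(** The equations [F(x,t) = 0] and [dF/dt(x,t) = 0] of the envelope. *)
Definition envelope_eqs (s : R -> sphere) (t : R) (x : R3) : Prop :=
  sphere_eq (s t) x = 0 /\ Derive (fun t' => sphere_eq (s t') x) t = 0.

(** Surfaces which are envelopes of two different one-parameter families of
    spheres [s1], [s2].  Near each point of [C] the parameters of the enveloped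
    spheres are smooth functions [u1], [u2] of the point of [C]; differentiating
    [sphere_eq (s1 (u1 x)) x = 0] along [C] shows that the sphere is tangent to
    [C] at [x].  The families are different in that the two spheres touching [C]
    at [x] are different.  Pieces of complete cyclides are allowed. *)
Definition dupin_cyclide (C : R3 -> Prop) : Prop :=
  smooth_surface C /\
  exists (a1 b1 : Rbar) (s1 : R -> sphere) (a2 b2 : Rbar) (s2 : R -> sphere),
    sphere_family a1 b1 s1 /\ sphere_family a2 b2 s2 /\
    forall p : R3, C p ->
    exists (U : R3 -> Prop) (u1 u2 : R3 -> R),
      open U /\ U p /\ smooth_on U u1 /\ smooth_on U u2 /\
      forall x, U x -> C x ->
        in_interval a1 b1 (u1 x) /\ envelope_eqs s1 (u1 x) x /\
        in_interval a2 b2 (u2 x) /\ envelope_eqs s2 (u2 x) x /\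
        ~ same_sphere (s1 (u1 x)) (s2 (u2 x)).

(** * Moebius transformations and standard position *)

Definition orthogonal_map (A : R3 -> R3) : Prop :=
  is_linear A /\ forall v w, dot (A v) (A w) = dot v w.

(** Moebius transformations of [R^3] with a point at infinity, restricted to the
    finite points [D] with finite image: a similarity, or the composite of an
    inversion of centre [a] and a similarity. *)
Definition moebius (g : R3 -> R3) (D : R3 -> Prop) : Prop :=
  exists (a b : R3) (lambda : R) (A : R3 -> R3),
    0 < lambda /\ orthogonal_map A /\
    ((forall x, D x /\ g x = plus b (scal lambda (A (minus x a)))) \/
     (forall x, (D x <-> x <> a) /\
        (x <> a ->
         g x = plus b (scal (lambda / dot (minus x a) (minus x a))
                            (A (minus x a)))))).

(** [g(S)] is, near [g p = 0], the graph of the smooth function [f]. *)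
Definition graph_at (g : R3 -> R3) (p : R3) (S : R3 -> Prop) (f : R2 -> R) : Prop :=
  smooth_near ((0, 0) : R2) f /\
  locally p (fun x => S x <-> cz (g x) = f (cx (g x), cy (g x))).

(** [g] sends [p] to the origin and [X1], [X2] to positive multiples of the first
    two basis vectors, and [g(S)] is near the origin the graph of a function
    [(x^2 - y^2) / 2 + (theta1 x^3 + theta2 y^3) / 6 + O(4)]. *)
Definition standard_position (g : R3 -> R3) (S : R3 -> Prop) (p X1 X2 : R3)
    (theta1 theta2 : R) : Prop :=
  g p = (0, 0, 0) /\
  (exists l : R, 0 < l /\
     is_derive (fun t : R => g (plus p (scal t X1))) 0 ((l, 0, 0) : R3)) /\
  (exists l : R, 0 < l /\
     is_derive (fun t : R => g (plus p (scal t X2))) 0 ((0, l, 0) : R3)) /\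
  exists f : R2 -> R, graph_at g p S f /\
    exists K : R, locally ((0, 0) : R2) (fun w : R2 => let (x, y) := w in
      Rabs (f (x, y) - ((x ^ 2 - y ^ 2) / 2 + (theta1 * x ^ 3 + theta2 * y ^ 3) / 6))
      <= K * (x ^ 2 + y ^ 2) ^ 2).

(** Dupin cyclides brought to standard position at [p] by [g]. *)
Definition cyclide_at (g : R3 -> R3) (p X1 X2 : R3) (C : R3 -> Prop) : Prop :=
  dupin_cyclide C /\ standard_position g C p X1 X2 0 0.

(** Tangency of order [n] at [p] in the direction [beta]: the functions with
    graphs [g(S)] and [g(C)], restricted to the line spanned by
    [(cos beta, sin beta)], have the same Taylor polynomial of order [n] at 0. *)
Definition tangent_of_order (n : nat) (g : R3 -> R3) (p : R3) (beta : R)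
    (S C : R3 -> Prop) : Prop :=
  exists f h : R2 -> R, graph_at g p S f /\ graph_at g p C h /\
    forall i : nat, (i <= n)%nat ->
      Derive_n (fun t => f (t * cos beta, t * sin beta)) i 0 =
      Derive_n (fun t => h (t * cos beta, t * sin beta)) i 0.

(** [tan alpha] is the real cube root of [theta1 / theta2], and [alpha = pi/2] if
    [theta2 = 0].

    Sign convention: on the line spanned by [(cos beta, sin beta)] a surface in
    standard position has cubic term [(theta1 cos^3 beta + theta2 sin^3 beta) / 6]
    and the cyclides have none, so that tangency of order 3 forces
    [tan beta = - tan alpha].  Hence, of the two tangent directions making the
    (unoriented) angles [alpha] and [pi/2 - alpha] with the lines of curvature,
    the relevant one is spanned by [cos alpha X1 - sin alpha X2], that is
    [beta = - alpha]. *)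
Definition osculation_angle (theta1 theta2 alpha : R) : Prop :=
  (theta2 <> 0 -> cos alpha <> 0 /\ tan alpha ^ 3 = theta1 / theta2) /\
  (theta2 = 0 -> alpha = PI / 2).

(** * Families and germs of surfaces *)

Definition same_germ (p : R3) (C C' : R3 -> Prop) : Prop :=
  locally p (fun x => C x <-> C' x).

(** The surfaces [g(C t)] are, near the origin, graphs depending smoothly on the
    parameter [t] as well, and different parameters give different germs at [p]. *)
Definition one_parameter_family (g : R3 -> R3) (p : R3) (C : R -> R3 -> Prop)
  : Prop :=
  (exists F : R * R2 -> R, forall t : R,
     smooth_near ((t, (0, 0)) : R * R2) F /\
     graph_at g p (C t) (fun w => F (t, w))) /\
  (forall t t' : R, same_germ p (C t) (C t') -> t = t').

(* Main.v *)
(** By a Moebius transformation everything is moved to standard position at the origin.  With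
    [r^2 = x^2 + y^2 + z^2], the cyclides there form the pencil
    [A (r^4 - 4 z^2) + r^2 z / 4 + (x^2 - y^2) / 2 - z = 0], spanned by the product of the two
    osculating spheres [r^2 = 2 z] and [r^2 = - 2 z] and by a parabolic cyclide.  As graphs they
    have no cubic term, so that in the direction where the cubic term of [S] vanishes all of them
    are tangent to [S] of order 3; their quartic term on the line spanned by the unit vector
    [(c, s)] is [4 A c^2 s^2 + (c^2 - s^2) / 8], so that order 4 determines [A] when [c s <> 0].

    That there are no other cyclides is the Lie-geometric fact that each sphere of one enveloping
    family is tangent to each sphere of the other one.  The third-order jet at the origin shows that
    the base sphere of each family is an osculating sphere, to which the whole other family is
    tangent, and that each family is orthogonal to one of the planes [x = 0], [y = 0].  The remaining
    tangency condition separates the two parameters, and the constant of separation is [A]. *)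

Require Import Defs.
From Stdlib Require Import Reals Factorial List Lra Lia Psatz ClassicalEpsilon Ranalysis5.
From mathcomp Require Import ssreflect.
From Coquelicot Require Import Coquelicot.
Open Scope R_scope.

(** * Calculus of smooth functions *)

(** A sphere enters only through its five coefficients, with the Lorentzian form [fam_disc] and its
    polarization [fam_prod]. A Moebius transformation acts on these coefficients and multiplies the
    equation by a factor independent of the parameter of the family, so both envelope equations are
    transported. The obstacle to the classification is that a cyclide comes with sphere parameters
    which are functions of the point: the tangency of sphere [t] of one family with sphere [s] of
    the other is known only for pairs met at a common point. Such pairs fill a rectangle because at
    the origin the gradients of the two parameter functions are nonzero and lie along different
    axes; only then can [t] and [s] vary independently. Tangency is moreover a squared identity,
    blind to orientation, and the sign of the root is fixed by continuity from the base spheres. For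
    existence, [A] runs over all reals, whereas the region where the quartic can be solved for [z]
    depends on [A]. Hence boxes shrinking with [A], and a graph function having [A] among its
    variables. *)

Section Calculus.
Context {E : NormedModule R_AbsRing}.
Implicit Types (f g : E -> R) (v x : E) (U : E -> Prop).

Lemma is_derive_line v x : is_derive (fun t : R => plus x (scal t v)) 0 v.
Proof.
  rewrite -[v in is_derive _ _ v](plus_zero_l v).
  apply: is_derive_plus; first exact: is_derive_const.
  have -> : v = scal (one : R_AbsRing) v by rewrite scal_one.
  apply: (is_derive_ext (fun t : R => scal t v)); first by move=> t; rewrite scal_one.
  apply: is_derive_scal_l; exact: is_derive_id.
Qed.

Lemma line_0 v x : plus x (scal (0 : R) v) = x.
Proof. by rewrite (scal_zero_l v) plus_zero_r. Qed.

Lemma filterdiff_derive_comp {V : NormedModule R_AbsRing} (c : R -> E) (f : E -> V)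
    (t : R) v l :
  is_derive c t v -> filterdiff f (locally (c t)) l ->
  is_derive (fun s => f (c s)) t (l v).
Proof.
  move=> Hc Hf.
  have H := filterdiff_comp' c f t _ _ Hc Hf.
  apply: (filterdiff_ext_lin _ _ _ H) => y.
  by rewrite (linear_scal l (proj1 Hf)).
Qed.

Lemma filterdiff_line {V : NormedModule R_AbsRing} (f : E -> V) x l v :
  filterdiff f (locally x) l ->
  is_derive (fun t : R => f (plus x (scal t v))) 0 (l v).
Proof.
  move=> Hf; apply: filterdiff_derive_comp; first exact: is_derive_line.
  by rewrite line_0.
Qed.

Lemma filterdiff_ddir f x l v : filterdiff f (locally x) l -> ddir v f x = l v.
Proof. move=> Hf; apply: is_derive_unique; exact: filterdiff_line. Qed.

Lemma ddir_filterdiff f x : ex_filterdiff f (locally x) ->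
  filterdiff f (locally x) (fun v => ddir v f x).
Proof.
  move=> [l Hl]; apply: (filterdiff_ext_lin _ _ _ Hl) => v.
  by rewrite (filterdiff_ddir _ _ _ v Hl).
Qed.

Lemma ddir_is_derive f x v : ex_filterdiff f (locally x) ->
  is_derive (fun t : R => f (plus x (scal t v))) 0 (ddir v f x).
Proof. move=> H; exact: (filterdiff_line _ _ _ v (ddir_filterdiff _ _ H)). Qed.

Lemma ddir_ext_locally f g x v :
  locally x (fun y => f y = g y) -> ddir v f x = ddir v g x.
Proof.
  move=> H; apply: Derive_ext_loc.
  have Hc : continuous (fun t : R => plus x (scal t v)) 0.
    apply: ex_derive_continuous; exists v; exact: is_derive_line.
  rewrite /continuous line_0 in Hc; exact: (Hc _ H).
Qed.

Lemma ddir_plus f g x v : ex_filterdiff f (locally x) -> ex_filterdiff g (locally x) ->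
  ddir v (fun y => f y + g y) x = ddir v f x + ddir v g x.
Proof.
  move=> /ddir_filterdiff Hf /ddir_filterdiff Hg.
  apply: filterdiff_ddir (filterdiff_plus_fct _ _ _ _ Hf Hg).
Qed.

Lemma ddir_mult f g x v : ex_filterdiff f (locally x) -> ex_filterdiff g (locally x) ->
  ddir v (fun y => f y * g y) x = ddir v f x * g x + f x * ddir v g x.
Proof.
  move=> /ddir_filterdiff Hf /ddir_filterdiff Hg.
  apply: filterdiff_ddir (filterdiff_mult_fct _ _ _ _ _ Rmult_comm Hf Hg).
Qed.

Lemma ddir_const (c : R) x v : ddir v (fun _ : E => c) x = 0.
Proof. exact: Derive_const. Qed.

Lemma ex_filterdiff_Rplus f g x : ex_filterdiff f (locally x) ->
  ex_filterdiff g (locally x) -> ex_filterdiff (fun y => f y + g y) (locally x).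
Proof. exact: ex_filterdiff_plus_fct. Qed.

Lemma ex_filterdiff_Rmult f g x : ex_filterdiff f (locally x) ->
  ex_filterdiff g (locally x) -> ex_filterdiff (fun y => f y * g y) (locally x).
Proof. exact: ex_filterdiff_mult_fct Rmult_comm. Qed.

Lemma ddir_lin_plus f x v w : ex_filterdiff f (locally x) ->
  ddir (plus v w) f x = ddir v f x + ddir w f x.
Proof.
  move=> [l Hl]; rewrite !(filterdiff_ddir _ _ _ _ Hl).
  exact: (linear_plus l (proj1 Hl)).
Qed.

Lemma ddir_lin_scal f x v (k : R) : ex_filterdiff f (locally x) ->
  ddir (scal k v) f x = k * ddir v f x.
Proof.
  move=> [l Hl]; rewrite !(filterdiff_ddir _ _ _ _ Hl).
  exact: (linear_scal l (proj1 Hl)).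
Qed.

(** Smoothness graded by order, since closure properties are proved by induction: the derivative of
    a product or of an inverse again contains the original functions, which are then used at one
    order less ([Ck_pred]). *)
Fixpoint Ck (n : nat) U f : Prop :=
  (forall x, U x -> ex_filterdiff f (locally x)) /\
  match n with O => True | S m => forall v, Ck m U (ddir v f) end.

Lemma smooth_on_Ck U f : smooth_on U f <-> forall n, Ck n U f.
Proof.
  split.
  - move=> H n; elim: n f H => [|n IH] f H; split=> //; try exact: (H nil).
    move=> v; apply: IH => vs x Hx.
    have := H (vs ++ v :: nil)%list x Hx; by rewrite fold_right_app.
  - move=> H vs; elim/rev_ind: vs f H => [|v vs IH] f H x Hx.
    + exact: (proj1 (H O)).
    + rewrite fold_right_app /=; apply: (IH (ddir v f)) => // n.
      exact: (proj2 (H (S n))).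
Qed.

Lemma smooth_on_ddir U f v : smooth_on U f -> smooth_on U (ddir v f).
Proof. move/smooth_on_Ck => H; apply/smooth_on_Ck => n; exact: (proj2 (H (S n))). Qed.

Lemma smooth_on_diff U f x : smooth_on U f -> U x -> ex_filterdiff f (locally x).
Proof. move=> H; exact: (H nil). Qed.

Lemma smooth_on_sub U (U' : E -> Prop) f :
  (forall x, U' x -> U x) -> smooth_on U f -> smooth_on U' f.
Proof. move=> H Hf vs x Hx; apply: Hf; exact: H. Qed.

Lemma Ck_diff n U f x : Ck n U f -> U x -> ex_filterdiff f (locally x).
Proof. case: n => [|n] [H _]; exact: H. Qed.

Lemma Ck_pred n U f : Ck (S n) U f -> Ck n U f.
Proof.
  elim: n f => [|n IH] f; move=> [H H']; split=> //.
  move=> v; apply: IH; exact: H'.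
Qed.

Lemma Ck_ext n U f g : open U -> (forall x, U x -> f x = g x) -> Ck n U f -> Ck n U g.
Proof.
  move=> HU; elim: n f g => [|n IH] f g Hfg [Hf Hf'].
    split=> // x Hx; apply: ex_filterdiff_ext_locally (Hf x Hx).
    apply: filter_imp (HU x Hx); exact: Hfg.
  split.
    move=> x Hx; apply: ex_filterdiff_ext_locally (Hf x Hx).
    apply: filter_imp (HU x Hx); exact: Hfg.
  move=> v; apply: IH (Hf' v) => x Hx; apply: ddir_ext_locally.
  apply: filter_imp (HU x Hx); exact: Hfg.
Qed.

Lemma Ck_const n U (c : R) : open U -> Ck n U (fun _ : E => c).
Proof.
  move=> HU.
  have H : forall x, U x -> ex_filterdiff (fun _ : E => c) (locally x)
    by move=> x _; exact: ex_filterdiff_const.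
  elim: n c H => [|n IH] c H; split=> // v.
  apply: (Ck_ext _ _ (fun _ => 0)) => //; first by move=> x _; rewrite ddir_const.
  apply: IH => x _; exact: ex_filterdiff_const.
Qed.

Lemma Ck_linear n U (l : E -> R) : open U -> is_linear l -> Ck n U l.
Proof.
  move=> HU Hl; case: n => [|n]; split=> //;
    try (by move=> x _; exact: ex_filterdiff_linear).
  move=> v; apply: (Ck_ext _ _ (fun _ => l v)) => //; last exact: Ck_const.
  move=> x _; symmetry; exact: (filterdiff_ddir _ _ _ v (filterdiff_linear l Hl)).
Qed.

Lemma Ck_plus n U f g : open U -> Ck n U f -> Ck n U g -> Ck n U (fun x => f x + g x).
Proof.
  move=> HU; elim: n f g => [|n IH] f g [Hf Hf'] [Hg Hg']; split=> //;
    try by move=> x Hx; apply: ex_filterdiff_Rplus; [exact: Hf|exact: Hg].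
  move=> v; apply: Ck_ext (IH _ _ (Hf' v) (Hg' v)) => // x Hx.
  by rewrite ddir_plus //; [exact: Hf|exact: Hg].
Qed.

Lemma Ck_mult n U f g : open U -> Ck n U f -> Ck n U g -> Ck n U (fun x => f x * g x).
Proof.
  move=> HU; elim: n f g => [|n IH] f g Hf Hg; split=> //;
    try by move=> x Hx; apply: ex_filterdiff_Rmult; [exact: Ck_diff Hf Hx|exact: Ck_diff Hg Hx].
  move=> v.
  apply: (Ck_ext _ _ (fun x => ddir v f x * g x + f x * ddir v g x)) => //.
    move=> x Hx; rewrite ddir_mult //; [exact: Ck_diff Hf Hx|exact: Ck_diff Hg Hx].
  apply: Ck_plus => //; apply: IH; first exact: (proj2 Hf).
  - exact: Ck_pred.
  - exact: Ck_pred.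
  - exact: (proj2 Hg).
Qed.

Lemma smooth_on_ext U f g : open U -> (forall x, U x -> f x = g x) ->
  smooth_on U f -> smooth_on U g.
Proof. move=> HU H /smooth_on_Ck Hf; apply/smooth_on_Ck => n; exact: Ck_ext (Hf n). Qed.

Lemma smooth_on_const U (c : R) : open U -> smooth_on U (fun _ : E => c).
Proof. move=> HU; apply/smooth_on_Ck => n; exact: Ck_const. Qed.

Lemma smooth_on_linear U (l : E -> R) : open U -> is_linear l -> smooth_on U l.
Proof. move=> HU Hl; apply/smooth_on_Ck => n; exact: Ck_linear. Qed.

Lemma smooth_on_plus U f g : open U -> smooth_on U f -> smooth_on U g ->
  smooth_on U (fun x => f x + g x).
Proof.
  move=> HU /smooth_on_Ck Hf /smooth_on_Ck Hg; apply/smooth_on_Ck => n; exact: Ck_plus.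
Qed.

Lemma smooth_on_mult U f g : open U -> smooth_on U f -> smooth_on U g ->
  smooth_on U (fun x => f x * g x).
Proof.
  move=> HU /smooth_on_Ck Hf /smooth_on_Ck Hg; apply/smooth_on_Ck => n; exact: Ck_mult.
Qed.

Lemma Ck_minus n U f g : open U -> Ck n U f -> Ck n U g -> Ck n U (fun x => f x - g x).
Proof.
  move=> HU Hf Hg.
  apply: (Ck_ext _ _ (fun x => f x + (- 1) * g x)) => //; first by move=> x _; ring.
  apply: Ck_plus => //; apply: Ck_mult => //; exact: Ck_const.
Qed.

Lemma Ck_opp n U f : open U -> Ck n U f -> Ck n U (fun x => - f x).
Proof.
  move=> HU Hf.
  apply: (Ck_ext _ _ (fun x => (- 1) * f x)) => //; first by move=> x _; ring.
  apply: Ck_mult => //; exact: Ck_const.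
Qed.

Lemma ex_filterdiff_inv f x : f x <> 0 -> ex_filterdiff f (locally x) ->
  ex_filterdiff (fun y => / f y) (locally x) /\
  forall v, ddir v (fun y => / f y) x = - ddir v f x * (/ f x * / f x).
Proof.
  move=> Hx /ddir_filterdiff Hf.
  have Hi : is_derive Rinv (f x) (- / f x ^ 2).
    by auto_derive => //; field.
  have H := filterdiff_comp' f Rinv x _ _ Hf Hi.
  split; first by eexists; exact: H.
  move=> v; rewrite (filterdiff_ddir _ _ _ v H).
  rewrite /scal /= /mult /=; field; exact: Hx.
Qed.

Lemma Ck_inv n U f : open U -> (forall x, U x -> f x <> 0) -> Ck n U f ->
  Ck n U (fun x => / f x).
Proof.
  move=> HU Hn; elim: n => [|n IH] Hf; split=> //;
    try by move=> x Hx; exact: (proj1 (ex_filterdiff_inv _ _ (Hn x Hx) (Ck_diff _ _ _ _ Hf Hx))).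
  move=> v.
  apply: (Ck_ext _ _ (fun x => - ddir v f x * (/ f x * / f x))) => //.
    move=> x Hx; by rewrite (proj2 (ex_filterdiff_inv _ _ (Hn x Hx) (Ck_diff _ _ _ _ Hf Hx))).
  have Hi := IH (Ck_pred _ _ _ Hf).
  apply: Ck_mult => //; last exact: Ck_mult.
  apply: Ck_opp => //; exact: (proj2 Hf).
Qed.

Lemma smooth_on_minus U f g : open U -> smooth_on U f -> smooth_on U g ->
  smooth_on U (fun x => f x - g x).
Proof.
  move=> HU /smooth_on_Ck Hf /smooth_on_Ck Hg; apply/smooth_on_Ck => n; exact: Ck_minus.
Qed.

Lemma smooth_on_opp U f : open U -> smooth_on U f -> smooth_on U (fun x => - f x).
Proof. move=> HU /smooth_on_Ck Hf; apply/smooth_on_Ck => n; exact: Ck_opp. Qed.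

Lemma smooth_on_inv U f : open U -> (forall x, U x -> f x <> 0) -> smooth_on U f ->
  smooth_on U (fun x => / f x).
Proof. move=> HU Hn /smooth_on_Ck Hf; apply/smooth_on_Ck => n; exact: Ck_inv. Qed.

Lemma smooth_on_div U f g : open U -> (forall x, U x -> g x <> 0) ->
  smooth_on U f -> smooth_on U g -> smooth_on U (fun x => f x / g x).
Proof. move=> HU Hn Hf Hg; apply: smooth_on_mult => //; exact: smooth_on_inv. Qed.

Lemma smooth_on_pow U f n : open U -> smooth_on U f -> smooth_on U (fun x => f x ^ n).
Proof.
  move=> HU Hf; elim: n => [|n IH] /=; first exact: smooth_on_const.
  exact: smooth_on_mult.
Qed.

End Calculus.

(** * Chain rule and smoothness of composites *)

Section Composition.
Context {E : NormedModule R_AbsRing}.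
Implicit Types (v x : E) (U : E -> Prop).

(** Coordinates in an arbitrary [K], so as to treat maps into [R], [R2], [R3] and [R * R2] at once. *)
Definition lincomb {K : NormedModule R_AbsRing} (l : list ((E -> R) * K)) (x : E) : K :=
  fold_right (fun p s => plus (scal (fst p x) (snd p)) s) zero l.

Lemma filterdiff_lincomb {K : NormedModule R_AbsRing} (l : list ((E -> R) * K)) x :
  (forall p, In p l -> ex_filterdiff (fst p) (locally x)) ->
  filterdiff (lincomb l) (locally x)
    (fun v => fold_right (fun p s => plus (scal (ddir v (fst p) x) (snd p)) s) zero l).
Proof.
  elim: l => [|p l IH] H /=; first exact: filterdiff_const.
  apply: filterdiff_plus_fct; last by apply: IH => q Hq; apply: H; right.
  apply: filterdiff_scal_l_fct; apply: ddir_filterdiff; apply: H; by left.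
Qed.

Lemma ddir_comp {K : NormedModule R_AbsRing} (l : list ((E -> R) * K)) (phi : K -> R) x v :
  (forall p, In p l -> ex_filterdiff (fst p) (locally x)) ->
  ex_filterdiff phi (locally (lincomb l x)) ->
  ddir v (fun y => phi (lincomb l y)) x =
  fold_right (fun p s => ddir v (fst p) x * ddir (snd p) phi (lincomb l x) + s) 0 l.
Proof.
  move=> Hl [d Hd].
  rewrite (filterdiff_ddir _ _ _ v (filterdiff_comp' _ _ _ _ _ (filterdiff_lincomb l x Hl) Hd)).
  have Hlin := proj1 Hd.
  have Hdd : forall w, ddir w phi (lincomb l x) = d w
    by move=> w; exact: filterdiff_ddir.
  clear Hd; move: (lincomb l x) Hdd => y Hdd; elim: l {Hl} => [|p l IH] /=.
    rewrite -(scal_zero_r (0 : R_AbsRing)) (linear_scal d Hlin) /scal /= /mult /=; ring.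
  rewrite (linear_plus d Hlin) (linear_scal d Hlin) IH Hdd.
  by [].
Qed.

Lemma Ck_comp {K : NormedModule R_AbsRing} n U (W : K -> Prop) (l : list ((E -> R) * K))
    (phi : K -> R) : open U ->
  (forall p, In p l -> Ck n U (fst p)) -> (forall x, U x -> W (lincomb l x)) ->
  smooth_on W phi -> Ck n U (fun x => phi (lincomb l x)).
Proof.
  move=> HU; elim: n phi => [|n IH] phi Hl HW Hphi; split=> //;
    try by (move=> x Hx; apply: ex_filterdiff_comp';
      [ eexists; apply: filterdiff_lincomb => p Hp; exact: Ck_diff (Hl p Hp) Hx
      | exact: (Hphi nil _ (HW x Hx)) ]).
  move=> v.
  (* The derivative is a sum over the list of coordinates. Its smoothness is proved over sublists,
     while the composite inside each term keeps the whole list [l]; the outer induction is applied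
     to the derivatives of [phi]. *)
  have H : forall l', (forall p, In p l' -> In p l) -> Ck n U (fun x =>
    fold_right (fun p s => ddir v (fst p) x * ddir (snd p) phi (lincomb l x) + s) 0 l').
    elim=> [|p l' IHl'] Hl' /=; first exact: Ck_const.
    apply: Ck_plus => //; last by apply: IHl' => q Hq; apply: Hl'; right.
    have Hp : In p l by apply: Hl'; left.
    apply: Ck_mult => //; first exact: (proj2 (Hl p Hp)).
    apply: IH => //; first by move=> q Hq; apply: Ck_pred; exact: Hl.
    move=> vs x Hx; have := Hphi (vs ++ snd p :: nil)%list x Hx; by rewrite fold_right_app.
  apply: Ck_ext (H l (fun p h => h)) => // x Hx.
  rewrite ddir_comp //; last exact: (Hphi nil _ (HW x Hx)).
  by move=> p Hp; exact: Ck_diff (Hl p Hp) Hx.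
Qed.

Lemma smooth_on_comp {K : NormedModule R_AbsRing} U (W : K -> Prop)
    (l : list ((E -> R) * K)) (phi : K -> R) : open U ->
  (forall p, In p l -> smooth_on U (fst p)) -> (forall x, U x -> W (lincomb l x)) ->
  smooth_on W phi -> smooth_on U (fun x => phi (lincomb l x)).
Proof.
  move=> HU Hl HW Hphi; apply/smooth_on_Ck => n; apply: Ck_comp HU _ HW Hphi => p Hp.
  by move/smooth_on_Ck: (Hl p Hp).
Qed.

End Composition.

Lemma is_linear_cx : is_linear cx.
Proof. apply: (is_linear_comp fst fst); exact: is_linear_fst. Qed.
Lemma is_linear_cy : is_linear cy.
Proof. apply: (is_linear_comp fst snd); [exact: is_linear_fst|exact: is_linear_snd]. Qed.
Lemma is_linear_cz : is_linear cz.
Proof. exact: is_linear_snd. Qed.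

Lemma norm_pair_le {V W : NormedModule R_AbsRing} (v : V) (w : W) (d : R) :
  norm v <= d -> norm w <= d -> norm ((v, w) : V * W) <= 2 * d.
Proof.
  move=> hv hw; have [_ h] := norm_prod v w; apply: Rle_trans h _.
  have s2 := sqrt_sqrt 2 ltac:(lra); have s0 := sqrt_pos 2.
  have h0 : 0 <= Rmax (norm v) (norm w) by apply: Rle_trans (Rmax_l _ _); exact: norm_ge_0.
  apply: Rmult_le_compat => //; [nra|exact: Rmax_lub].
Qed.

Section Substitution.
Context {E : NormedModule R_AbsRing}.
Implicit Types (U : E -> Prop) (f g h k : E -> R).

Lemma smooth_on_comp2 U (W : R2 -> Prop) (phi : R2 -> R) f g : open U ->
  smooth_on U f -> smooth_on U g -> (forall x, U x -> W (f x, g x)) ->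
  smooth_on W phi -> smooth_on U (fun x => phi (f x, g x)).
Proof.
  move=> HU Hf Hg HW Hphi.
  pose l := ((f, (1, 0) : R2) :: (g, (0, 1) : R2) :: nil)%list.
  have Hl : forall x, lincomb l x = (f x, g x).
    move=> x.
    change ((f x * 1 + (g x * 0 + 0), f x * 0 + (g x * 1 + 0)) = (f x, g x)).
    by congr pair; ring.
  apply: (smooth_on_ext _ (fun x => phi (lincomb l x))) => //.
    by move=> x _; rewrite Hl.
  apply: smooth_on_comp Hphi => //; last by move=> x Hx; rewrite Hl; exact: HW.
  by move=> p [<-|[<-|[]]].
Qed.

Lemma smooth_on_comp3 U (W : R3 -> Prop) (phi : R3 -> R) f g h : open U ->
  smooth_on U f -> smooth_on U g -> smooth_on U h ->
  (forall x, U x -> W (f x, g x, h x)) ->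
  smooth_on W phi -> smooth_on U (fun x => phi (f x, g x, h x)).
Proof.
  move=> HU Hf Hg Hh HW Hphi.
  pose l := ((f, (1, 0, 0) : R3) :: (g, (0, 1, 0) : R3) :: (h, (0, 0, 1) : R3) :: nil)%list.
  have Hl : forall x, lincomb l x = (f x, g x, h x).
    move=> x.
    change ((f x * 1 + (g x * 0 + (h x * 0 + 0)), f x * 0 + (g x * 1 + (h x * 0 + 0)),
             f x * 0 + (g x * 0 + (h x * 1 + 0))) = (f x, g x, h x)).
    by f_equal; [f_equal|]; ring.
  apply: (smooth_on_ext _ (fun x => phi (lincomb l x))) => //.
    by move=> x _; rewrite Hl.
  apply: smooth_on_comp Hphi => //; last by move=> x Hx; rewrite Hl; exact: HW.
  by move=> p [<-|[<-|[<-|[]]]].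
Qed.

Lemma smooth_on_comp3' U (W : R * R2 -> Prop) (phi : R * R2 -> R) f g h : open U ->
  smooth_on U f -> smooth_on U g -> smooth_on U h ->
  (forall x, U x -> W (f x, (g x, h x))) ->
  smooth_on W phi -> smooth_on U (fun x => phi (f x, (g x, h x))).
Proof.
  move=> HU Hf Hg Hh HW Hphi.
  pose l := ((f, (1, (0, 0)) : R * R2) :: (g, (0, (1, 0)) : R * R2) ::
             (h, (0, (0, 1)) : R * R2) :: nil)%list.
  have Hl : forall x, lincomb l x = (f x, (g x, h x)).
    move=> x.
    change ((f x * 1 + (g x * 0 + (h x * 0 + 0)), (f x * 0 + (g x * 1 + (h x * 0 + 0)),
             f x * 0 + (g x * 0 + (h x * 1 + 0)))) = (f x, (g x, h x))).
    by f_equal; [|f_equal]; ring.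
  apply: (smooth_on_ext _ (fun x => phi (lincomb l x))) => //.
    by move=> x _; rewrite Hl.
  apply: smooth_on_comp Hphi => //; last by move=> x Hx; rewrite Hl; exact: HW.
  by move=> p [<-|[<-|[<-|[]]]].
Qed.

Lemma smooth_on_continuous U f x : smooth_on U f -> U x -> continuous f x.
Proof. move=> H Hx; apply: filterdiff_continuous; exact: smooth_on_diff Hx. Qed.

(** Restriction to the plane [pt a b = x + a v + b w] turns both sides into mixed partial
    derivatives of a function of two real variables, to which [Schwarz] applies. *)
Lemma ddir_comm U f x v w : open U -> smooth_on U f -> U x ->
  ddir v (ddir w f) x = ddir w (ddir v f) x.
Proof.
  move=> HU Hf Hx.
  pose pt (a b : R) : E := plus x (plus (scal a v) (scal b w)).
  have pt0 : pt 0 0 = x.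
    by rewrite /pt (scal_zero_l v) (scal_zero_l w) !plus_zero_r.
  have Hpt : forall a b, filterdiff (fun z : R2 => pt (fst z) (snd z)) (locally ((a, b) : R2))
     (fun z : R2 => plus (scal (fst z) v) (scal (snd z) w)).
    move=> a b.
    apply: (filterdiff_ext_lin _ (fun z : R2 => plus zero (plus (scal (fst z) v) (scal (snd z) w)))).
      apply: filterdiff_plus_fct; first exact: filterdiff_const.
      apply: filterdiff_plus_fct; apply: filterdiff_scal_l_fct; apply: filterdiff_linear;
        [exact: is_linear_fst|exact: is_linear_snd].
    by move=> y; rewrite plus_zero_l.
  have Hl : forall a b z, pt z b = plus (pt a b) (scal (z - a) v).
    move=> a b z; rewrite /pt -!plus_assoc; congr plus.
    rewrite (plus_comm (scal b w)) plus_assoc -scal_distr_r.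
    by congr plus; congr scal; rewrite /plus /=; ring.
  have Hr : forall a b z, pt a z = plus (pt a b) (scal (z - b) w).
    move=> a b z; rewrite /pt -!plus_assoc -scal_distr_r.
    by congr plus; congr plus; congr scal; rewrite /plus /=; ring.
  have Hd1 : forall h a b, ex_filterdiff h (locally (pt a b)) ->
      is_derive (fun z => h (pt z b)) a (ddir v h (pt a b)).
    move=> h a b Hh.
    apply: (is_derive_ext (fun z => h (plus (pt a b) (scal (z - a) v)))).
      by move=> z; rewrite -(Hl a b z).
    have H := ddir_is_derive h (pt a b) v Hh.
    have Hs : is_derive (fun z : R => z - a) a 1 by auto_derive.
    have -> : ddir v h (pt a b) = scal 1 (ddir v h (pt a b)) by rewrite /scal /= /mult /=; ring.
    apply: (is_derive_comp (fun t : R => h (plus (pt a b) (scal t v))) (fun z => z - a)) Hs.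
    by rewrite Rminus_diag.
  have Hd2 : forall h a b, ex_filterdiff h (locally (pt a b)) ->
      is_derive (fun z => h (pt a z)) b (ddir w h (pt a b)).
    move=> h a b Hh.
    apply: (is_derive_ext (fun z => h (plus (pt a b) (scal (z - b) w)))).
      by move=> z; rewrite -(Hr a b z).
    have H := ddir_is_derive h (pt a b) w Hh.
    have Hs : is_derive (fun z : R => z - b) b 1 by auto_derive.
    have -> : ddir w h (pt a b) = scal 1 (ddir w h (pt a b)) by rewrite /scal /= /mult /=; ring.
    apply: (is_derive_comp (fun t : R => h (plus (pt a b) (scal t w))) (fun z => z - b)) Hs.
    by rewrite Rminus_diag.
  pose D (z : R2) := U (pt (fst z) (snd z)).
  have HD : locally ((0, 0) : R2) D.
    have Hc := filterdiff_continuous _ _ (ex_intro _ _ (Hpt 0 0)).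
    rewrite /continuous /= pt0 in Hc; apply: Hc; exact: HU.
  have HoD : forall z : R2, D z -> locally z D.
    move=> [a b] Hz; have Hc := filterdiff_continuous _ _ (ex_intro _ _ (Hpt a b)).
    rewrite /continuous /= in Hc; apply: Hc; exact: HU.
  have Sv := smooth_on_ddir _ _ v Hf; have Sw := smooth_on_ddir _ _ w Hf.
  have diff : forall h a b, smooth_on U h -> D (a, b) -> ex_filterdiff h (locally (pt a b)).
    by move=> h a b Hh Hab; exact: (smooth_on_diff U h _ Hh Hab).
  have slice : forall a b, D (a, b) -> locally a (fun z => D (z, b)) /\ locally b (fun z => D (a, z)).
    move=> a b /HoD [e He]; split; exists e => z Hz; apply: He; split=> //; exact: ball_center.
  have E1 : forall a b, D (a, b) ->
      Derive (fun z => Derive (fun t => f (pt z t)) b) a = ddir v (ddir w f) (pt a b).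
    move=> a b Hab; apply: is_derive_unique.
    apply: (is_derive_ext_loc (fun z => ddir w f (pt z b))).
      apply: filter_imp (proj1 (slice a b Hab)) => z Hz.
      symmetry; apply: is_derive_unique; apply: Hd2; exact: diff.
    apply: Hd1; exact: diff.
  have E2 : forall a b, D (a, b) ->
      Derive (fun z => Derive (fun t => f (pt t z)) a) b = ddir w (ddir v f) (pt a b).
    move=> a b Hab; apply: is_derive_unique.
    apply: (is_derive_ext_loc (fun z => ddir v f (pt a z))).
      apply: filter_imp (proj2 (slice a b Hab)) => z Hz.
      symmetry; apply: is_derive_unique; apply: Hd1; exact: diff.
    apply: Hd2; exact: diff.
  have D00 : D (0, 0) by apply: locally_singleton.
  rewrite -pt0 -E1 // -E2 //.
  apply: (Schwarz (fun a b => f (pt a b))).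
  - apply/locally_2d_locally; apply: filter_imp HD => -[a b] /= Hab.
    have Ff := diff f a b Hf Hab.
    repeat split.
    + eexists; exact: Hd1.
    + eexists; exact: Hd2.
    + exists (ddir v (ddir w f) (pt a b)).
      apply: (is_derive_ext_loc (fun z => ddir w f (pt z b))).
        apply: filter_imp (proj1 (slice a b Hab)) => z Hz.
        symmetry; apply: is_derive_unique; apply: Hd2; exact: diff.
      apply: Hd1; exact: diff.
    + exists (ddir w (ddir v f) (pt a b)).
      apply: (is_derive_ext_loc (fun z => ddir v f (pt a z))).
        apply: filter_imp (proj2 (slice a b Hab)) => z Hz.
        symmetry; apply: is_derive_unique; apply: Hd1; exact: diff.
      apply: Hd2; exact: diff.
  - apply/continuity_2d_pt_filterlim; rewrite E1 //.
    apply: (filterlim_ext_loc (fun z : R2 => ddir v (ddir w f) (pt (fst z) (snd z)))).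
      by apply: filter_imp HD => -[a b] Hab; rewrite -E1.
    apply: filterlim_comp (filterdiff_continuous _ _ (ex_intro _ _ (Hpt 0 0))) _.
    apply: (smooth_on_continuous _ _ _ (smooth_on_ddir _ _ v Sw)); exact: D00.
  - apply/continuity_2d_pt_filterlim; rewrite E2 //.
    apply: (filterlim_ext_loc (fun z : R2 => ddir w (ddir v f) (pt (fst z) (snd z)))).
      by apply: filter_imp HD => -[a b] Hab; rewrite -E2.
    apply: filterlim_comp (filterdiff_continuous _ _ (ex_intro _ _ (Hpt 0 0))) _.
    apply: (smooth_on_continuous _ _ _ (smooth_on_ddir _ _ w Sv)); exact: D00.
Qed.

(** Mere continuity of the solution [F] suffices. With [v] and [z] the increments of [y] and [F y],
    the linearization reads [L (v, 0) + z c = o(|v| + |z|)]; as [c <> 0], this first gives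
    [|z| = O(|v|)], and then the derivative. *)
Lemma implicit_filterdiff (G : E * R -> R) (F : E -> R) (x : E) (L : E * R -> R) :
  filterdiff G (locally (x, F x)) L -> L (zero, 1) <> 0 -> continuous F x ->
  locally x (fun y => G (y, F y) = 0) ->
  filterdiff F (locally x) (fun v => - L (v, 0) / L (zero, 1)).
Proof.
  move=> [Llin HG] Hc HF HGF; set c := L (zero, 1) in Hc *.
  have G0 : G (x, F x) = 0 by exact: (locally_singleton _ _ HGF).
  have Lsplit : forall (v : E) (z : R), L (v, z) = L (v, 0) + z * c.
    move=> v z; have -> : (v, z) = plus ((v, 0) : E * R) (scal z ((zero, 1) : E * R)).
      rewrite /plus /scal /= /prod_plus /prod_scal /= (scal_zero_r z) plus_zero_r.
      by congr pair; rewrite /plus /scal /= /mult /=; ring.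
    by rewrite (linear_plus L Llin) (linear_scal L Llin).
  have Hi : is_linear (fun v : E => (v, 0) : E * R).
    by apply: is_linear_prod; [exact: is_linear_id|exact: is_linear_zero].
  have Hl : is_linear (fun v : E => - L (v, 0) / c).
    apply: (is_linear_comp (fun v : E => L (v, 0)) (fun y : R => - y / c)).
      exact: (is_linear_comp (fun v : E => (v, 0) : E * R) L).
    have H : forall y : R, scal (- / c) y = - y / c.
      by move=> y; rewrite /scal /= /mult /=; field.
    have [h1 h2 h3] := is_linear_scal_r (K := R_AbsRing) (V := R_NormedModule) (- / c) Rmult_comm.
    split.
    - by move=> a b; rewrite -!H.
    - by move=> a b; rewrite -!H.
    - by case: h3 => M [HM h]; exists M; split=> // a; rewrite -H.
  split=> // x' Hx'.
  have {x' Hx'} <- : x = x' by exact: is_filter_lim_locally_unique.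
  have [M [HM Hbound]] := linear_norm _ (is_linear_comp _ _ Hi Llin).
  have Hcpos : 0 < Rabs c by apply: Rabs_pos_lt.
  move=> eps.
  pose K := 2 * (M + Rabs c) / Rabs c.
  have HK : 0 < K by apply: Rdiv_lt_0_compat; lra.
  (* The first bound absorbs the [z] term of the error and yields [|z| <= K |v|]; the second turns
     that estimate into the required [eps]. *)
  pose e1 := Rmin (Rabs c / 4) (eps * Rabs c / (2 * (1 + K))).
  have He1 : 0 < e1.
    apply: Rmin_case; first lra.
    apply: Rdiv_lt_0_compat; last lra.
    apply: Rmult_lt_0_compat => //; exact: cond_pos.
  have Hloc := HG (x, F x) (fun _ q => q) (mkposreal _ He1).
  have HcF : filterlim (fun y => (y, F y) : E * R) (locally x) (locally ((x, F x) : E * R)).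
    move=> P [e He]; have H1 := locally_ball x e; have H2 := HF _ (locally_ball (F x) e).
    rewrite /filtermap; apply: filter_imp (filter_and _ _ H1 H2) => y [hy1 hy2]; exact: He.
  have Hloc' := HcF _ Hloc; rewrite /filtermap in Hloc'.
  apply: filter_imp (filter_and _ _ Hloc' HGF) => y [Hy Gy].
  move: Hy; rewrite Gy G0 /minus /plus /opp /= /prod_plus /prod_opp /=.
  set v := plus y (opp x); set z := plus (F y) (opp (F x)).
  rewrite Lsplit => Hy.
  have Hn : norm ((v, z) : E * R) <= 2 * (norm v + Rabs z).
    have h0 : 0 <= norm v by exact: norm_ge_0.
    have h1 := Rabs_pos z.
    apply: norm_pair_le; [lra|change (Rabs z <= norm v + Rabs z); lra].
  have Hy' : Rabs (L (v, 0) + z * c) <= e1 * (2 * (norm v + Rabs z)).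
    apply: Rle_trans (Rmult_le_compat_l _ _ _ (Rlt_le _ _ He1) Hn).
    move: Hy; rewrite /norm /= /abs /= => Hy; rewrite -Rabs_Ropp.
    by have -> : - (L (v, 0) + z * c) = 0 + - 0 + - (L (v, 0) + z * c) by ring.
  have Hb : Rabs (L (v, 0)) <= M * norm v by exact: (Hbound v).
  have Hnv : 0 <= norm v by exact: norm_ge_0.
  have Hz0 := Rabs_pos z.
  have e1c : e1 <= Rabs c / 4 by exact: Rmin_l.
  have e1e : e1 <= eps * Rabs c / (2 * (1 + K)) by exact: Rmin_r.
  have Hzc : Rabs z * Rabs c <= Rabs (L (v, 0) + z * c) + Rabs (L (v, 0)).
    rewrite -Rabs_mult {1}(_ : z * c = (L (v, 0) + z * c) + - L (v, 0)); last by ring.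
    apply: Rle_trans (Rabs_triang _ _) _; rewrite Rabs_Ropp; lra.
  have HzK : Rabs z <= K * norm v.
    apply: (Rmult_le_reg_r (Rabs c)) => //.
    have -> : K * norm v * Rabs c = 2 * (M + Rabs c) * norm v by rewrite /K; field; lra.
    have h5 : e1 * (2 * (norm v + Rabs z)) <= Rabs c / 4 * (2 * (norm v + Rabs z)).
      by apply: Rmult_le_compat_r => //; lra.
    have h8 : 0 <= Rabs c * norm v by (apply: Rmult_le_pos; lra).
    lra.
  change (Rabs (z + - (- L (v, 0) / c)) <= eps * norm v).
  have -> : z + - (- L (v, 0) / c) = (L (v, 0) + z * c) / c by field.
  rewrite /Rdiv Rabs_mult Rabs_inv; apply: (Rmult_le_reg_r (Rabs c)) => //.
  rewrite Rmult_assoc Rinv_l; last lra.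
  rewrite Rmult_1_r; apply: Rle_trans Hy' _.
  have h6 : e1 * (2 * (norm v + Rabs z)) <= e1 * (2 * ((1 + K) * norm v)).
    apply: Rmult_le_compat_l; lra.
  apply: Rle_trans h6 _.
  have h7 : e1 * (2 * ((1 + K) * norm v)) <= eps * Rabs c / (2 * (1 + K)) * (2 * ((1 + K) * norm v)).
    apply: Rmult_le_compat_r => //; nra.
  apply: Rle_trans h7 _; right; field; lra.
Qed.

End Substitution.

(** * Taylor expansions *)

Lemma ddir_R (f : R -> R) (x : R) : ddir (1 : R) f x = Derive f x.
Proof.
  rewrite /ddir /Derive; congr real; apply: Lim_ext => h.
  by rewrite /plus /scal /= /mult /= !Rmult_1_r Rplus_0_r Rplus_0_l.
Qed.

Lemma Derive_n_ddir (f : R -> R) n (x : R) :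
  Derive_n f n x = fold_right ddir f (repeat (1 : R) n) x.
Proof.
  elim: n x => [|n IH] x //=; rewrite ddir_R; exact: Derive_ext.
Qed.

Lemma smooth_on_Derive_n (U : R -> Prop) (f : R -> R) n x : smooth_on U f -> U x ->
  ex_derive (Derive_n f n) x.
Proof.
  move=> Hf Hx; have H := Hf (repeat (1 : R) n) x Hx.
  apply/ex_derive_filterdiff; apply: ex_filterdiff_ext H => y; by rewrite Derive_n_ddir.
Qed.

Lemma Derive_n_line {E : NormedModule R_AbsRing} (U : E -> Prop) (f : E -> R) (x v : E) n t :
  open U -> smooth_on U f -> U (plus x (scal t v)) ->
  Derive_n (fun s : R => f (plus x (scal s v))) n t =
  fold_right ddir f (repeat v n) (plus x (scal t v)).
Proof.
  move=> HU Hf; elim: n t => [|n IH] t Ht //=.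
  have Hc : is_derive (fun s : R => plus x (scal s v)) t v.
    rewrite -{2}(plus_zero_l v); apply: is_derive_plus; first exact: is_derive_const.
    rewrite -{2}(scal_one v); apply: (is_derive_scal_l (fun s : R => s)); exact: is_derive_id.
  apply: is_derive_unique.
  apply: (is_derive_ext_loc (fun s => fold_right ddir f (repeat v n) (plus x (scal s v)))).
    have Hc' : continuous (fun s : R => plus x (scal s v)) t
      by apply: ex_derive_continuous; exists v.
    have H := Hc' _ (HU _ Ht); rewrite /filtermap in H.
    apply: filter_imp H => s Hs; symmetry; exact: IH.
  apply: (filterdiff_derive_comp (fun s : R => plus x (scal s v)) _ t v
           (fun w => ddir w (fold_right ddir f (repeat v n)) (plus x (scal t v)))) => //.
  apply: ddir_filterdiff; exact: Hf.
Qed.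

(** Letting [t] tend to 0 kills the constant term; the rest is divisible by [t], and the induction
    continues with the shifted coefficients. Positive [t] are enough. *)
Lemma sum_f_R0_small n (a : nat -> R) (K d : R) : 0 < d ->
  (forall t, 0 < t < d -> Rabs (sum_f_R0 (fun i => a i * t ^ i) n) <= K * t ^ S n) ->
  forall i, (i <= n)%nat -> a i = 0.
Proof.
  have small : forall c B e : R, 0 < e -> (forall t, 0 < t < e -> Rabs c <= B * t) -> c = 0.
    move=> c B e He H; case: (Req_dec c 0) => // Hc.
    have Hc' := Rabs_pos_lt c Hc.
    pose t := Rmin (e / 2) (Rabs c / (2 * (1 + Rabs B))).
    have HB := Rabs_pos B.
    have Ht : 0 < t.
      by apply: Rmin_case; [lra|apply: Rdiv_lt_0_compat; lra].
    have Hte : t <= e / 2 by exact: Rmin_l.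
    have Htc : t <= Rabs c / (2 * (1 + Rabs B)) by exact: Rmin_r.
    have := H t ltac:(lra).
    have h1 : B * t <= Rabs B * t by apply: Rmult_le_compat_r; [lra|exact: Rle_abs].
    have h2 : (1 + Rabs B) * t <= Rabs c / 2.
      have -> : Rabs c / 2 = (1 + Rabs B) * (Rabs c / (2 * (1 + Rabs B))) by field; lra.
      apply: Rmult_le_compat_l; lra.
    lra.
  move=> Hd; elim: n a => [|n IH] a H i Hi.
    have -> : i = O by lia.
    apply: (small _ K d Hd) => t Ht; have := H t Ht; by rewrite /= !Rmult_1_r.
  have a0 : a O = 0.
    apply: (small _ (sum_f_R0 (fun j => Rabs (a (S j))) n + Rabs K) (Rmin d 1)).
      by apply: Rmin_case; lra.
    move=> t Ht.
    have t1 : t < d by have := Rmin_l d 1; lra.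
    have t2 : t < 1 by have := Rmin_r d 1; lra.
    have := H t ltac:(lra); rewrite decomp_sum; last lia.
    rewrite /= Rmult_1_r; set s := sum_f_R0 _ _ => Hs.
    have Hs' : Rabs s <= t * sum_f_R0 (fun j => Rabs (a (S j))) n.
      rewrite scal_sum; apply: Rle_trans (Rsum_abs _ _) _.
      apply: sum_Rle => j _ /=; rewrite Rabs_mult; apply: Rmult_le_compat_l; first exact: Rabs_pos.
      rewrite Rabs_mult (Rabs_pos_eq t); last lra.
      have hj : Rabs (t ^ j) <= 1.
        rewrite Rabs_pos_eq; last by apply: pow_le; lra.
        rewrite -(pow1 j); apply: pow_incr; lra.
      nra.
    have Hk : K * (t * (t * t ^ n)) <= Rabs K * t.
      have hp : 0 <= t * t ^ n <= 1.
        have hq : 0 <= t ^ n <= 1.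
          split; first by apply: pow_le; lra.
          rewrite -(pow1 n); apply: pow_incr; lra.
        nra.
      have hK := Rle_abs K; have hK' := Rabs_pos K.
      apply: (Rle_trans _ (Rabs K * (t * (t * t ^ n)))).
        apply: Rmult_le_compat_r => //; nra.
      apply: Rmult_le_compat_l => //; nra.
    have : Rabs (a O) <= Rabs (a O + s) + Rabs s.
      rewrite {1}(_ : a O = (a O + s) + - s); last ring.
      apply: Rle_trans (Rabs_triang _ _) _; rewrite Rabs_Ropp; lra.
    lra.
  case: i Hi => [|i] Hi //.
  apply: (IH (fun j => a (S j))); last lia.
  move=> t Ht; have := H t Ht; rewrite decomp_sum; last lia.
  rewrite a0 Rmult_0_l Rplus_0_l /=.
  rewrite (sum_eq _ (fun j => a (S j) * t ^ j * t)); last by move=> j _; ring.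
  rewrite -scal_sum Rabs_mult (Rabs_pos_eq t) => [h|]; last lra.
  apply: (Rmult_le_reg_l t); lra.
Qed.

(** Taylor-Lagrange gives a second expansion with a remainder of the same order, so the two
    polynomials differ by [O(t^(n+1))] and coincide. All jets below are read off estimates in this
    way. *)
Lemma Derive_n_of_expansion (f : R -> R) n (a : nat -> R) (K : R) :
  smooth_near (0 : R) f ->
  locally 0 (fun t => Rabs (f t - sum_f_R0 (fun i => a i * t ^ i) n) <= K * Rabs t ^ S n) ->
  forall i, (i <= n)%nat -> Derive_n f i 0 = a i * INR (fact i).
Proof.
  move=> [U [HU [U0 Hf]]] HK i Hi.
  have [M [HM HMb]] : exists M, 0 <= M /\
      locally 0 (fun t => Rabs (Derive_n f (S n) t) <= M).
    have Hc : continuous (Derive_n f (S n)) 0.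
      apply: ex_derive_continuous; exact: smooth_on_Derive_n Hf U0.
    have H := Hc _ (locally_ball _ (mkposreal 1 Rlt_0_1)); rewrite /filtermap in H.
    exists (Rabs (Derive_n f (S n) 0) + 1); split; first by have := Rabs_pos (Derive_n f (S n) 0); lra.
    apply: filter_imp H => t Ht.
    have Ht' : Rabs (Derive_n f (S n) t - Derive_n f (S n) 0) < 1 by exact: Ht.
    have := Rabs_triang_inv (Derive_n f (S n) t) (Derive_n f (S n) 0); lra.
  have [d Hd] := filter_and _ _ HK (filter_and _ _ HMb (HU _ U0)).
  have inb : forall t, Rabs t < d -> ball (0 : R) d t.
    move=> t Ht; change (Rabs (t - 0) < d); by rewrite Rminus_0_r.
  have Hf0 := fun k => INR_fact_neq_0 k.
  have key : Derive_n f i 0 / INR (fact i) - a i = 0.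
    apply: (sum_f_R0_small n (fun k => Derive_n f k 0 / INR (fact k) - a k) (M + K) d) => //.
      exact: cond_pos.
    move=> t Ht.
    have Ht' : Rabs t < d by rewrite Rabs_pos_eq; lra.
    have [E1 _] := Hd t (inb t Ht').
    have HexT : forall s, 0 <= s <= t -> forall k, (k <= S n)%nat -> ex_derive_n f k s.
      move=> s Hs [|k] Hk //=; apply: smooth_on_Derive_n Hf _.
      apply: (proj2 (proj2 (Hd s _))); apply: inb; rewrite Rabs_pos_eq; lra.
    have [z [Hz E2]] := Taylor_Lagrange f n 0 t (proj1 Ht) HexT.
    have Hz' : Rabs z < d by rewrite Rabs_pos_eq; lra.
    have [_ [E3 _]] := Hd z (inb z Hz').
    rewrite (sum_eq _ (fun m => (t - 0) ^ m / INR (fact m) * Derive_n f m 0 - a m * t ^ m)); last first.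
      by move=> m _; rewrite Rminus_0_r; field.
    rewrite minus_sum.
    set S1 := sum_f_R0 _ n in E2 *; set S2 := sum_f_R0 _ n in E1 *.
    have -> : S1 - S2 = (f t - S2) + - ((t - 0) ^ S n / INR (fact (S n)) * Derive_n f (S n) z).
      by rewrite E2; ring.
    apply: Rle_trans (Rabs_triang _ _) _.
    rewrite Rabs_Ropp Rminus_0_r (Rabs_pos_eq t) in E1 *; last lra.
    have hpos : 0 <= t ^ S n by apply: pow_le; lra.
    have hfact : 1 <= INR (fact (S n)).
      have := lt_O_fact (S n) => h; have := le_INR 1 (fact (S n)) ltac:(lia); by rewrite /=.
    rewrite Rabs_mult (Rabs_pos_eq (t ^ S n / INR (fact (S n)))).
      have : t ^ S n / INR (fact (S n)) <= t ^ S n.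
        apply: (Rmult_le_reg_r (INR (fact (S n)))); first lra.
        rewrite /Rdiv Rmult_assoc Rinv_l; last lra.
        nra.
      move=> h; have hM : t ^ S n / INR (fact (S n)) * Rabs (Derive_n f (S n) z) <= t ^ S n * M.
        apply: Rmult_le_compat => //; last exact: Rabs_pos.
        apply: Rmult_le_pos => //; left; apply: Rinv_0_lt_compat; lra.
      lra.
    apply: Rmult_le_pos => //; left; apply: Rinv_0_lt_compat; lra.
  have -> : a i = Derive_n f i 0 / INR (fact i) by lra.
  by field.
Qed.

Lemma smooth_near_line {E : NormedModule R_AbsRing} (f : E -> R) (v : E) :
  smooth_near (zero : E) f -> smooth_near (0 : R) (fun t : R => f (scal t v)).
Proof.
  move=> [U [HU [U0 Hf]]].
  have Hlin : is_linear (fun t : R => scal t v) by exact: is_linear_scal_l.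
  have HV : open (fun t : R => U (scal t v)).
    move=> t Ht; have Hc : continuous (fun t : R => scal t v) t.
      by apply: filterdiff_continuous; exact: ex_filterdiff_linear.
    exact: (Hc _ (HU _ Ht)).
  exists (fun t => U (scal t v)); split=> //; split.
    by rewrite (scal_zero_l v).
  pose l := ((fun t : R => t, v) :: nil)%list.
  have Hl : forall t, lincomb l t = scal t v by move=> t; rewrite /lincomb /= plus_zero_r.
  apply: (smooth_on_ext _ (fun t : R => f (lincomb l t))) => //.
    by move=> t _; rewrite Hl.
  apply: (smooth_on_comp _ U) => //.
    move=> p [<-|[]] /=; apply: smooth_on_linear => //; exact: is_linear_id.
  by move=> t Ht; rewrite Hl.
Qed.

Definition dir_x : R2 := (1, 0).
Definition dir_y : R2 := (0, 1).

Definition small4 (f : R2 -> R) : Prop :=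
  exists K : R, locally ((0, 0) : R2) (fun w : R2 => let (x, y) := w in
    Rabs (f (x, y)) <= K * (x ^ 2 + y ^ 2) ^ 2).

Lemma small4_line (U : R2 -> Prop) (f : R2 -> R) (v : R2) i :
  open U -> U (0, 0) -> smooth_on U f -> small4 f -> (i <= 3)%nat ->
  fold_right ddir f (repeat v i) (0, 0) = 0.
Proof.
  move=> HU U0 Hf [K HK] Hi.
  have H := Derive_n_line U f (zero : R2) v i 0 HU Hf.
  rewrite line_0 in H; change (zero : R2) with ((0, 0) : R2) in H.
  rewrite -H //.
  change (Derive_n (fun s : R => f (plus ((0, 0) : R2) (scal s v))) i 0 = 0).
  have -> : Derive_n (fun s : R => f (plus ((0, 0) : R2) (scal s v))) i 0 =
            Derive_n (fun s : R => f (scal s v)) i 0.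
    by apply: Derive_n_ext => t; congr f; exact: plus_zero_l.
  rewrite (Derive_n_of_expansion _ 3 (fun _ => 0) (K * (fst v ^ 2 + snd v ^ 2) ^ 2)) //.
  - by rewrite Rmult_0_l.
  - apply: smooth_near_line; by exists U.
  - have Hc : continuous (fun t : R => scal t v) 0.
      by apply: filterdiff_continuous; apply: ex_filterdiff_linear; exact: is_linear_scal_l.
    rewrite /continuous (scal_zero_l v) in Hc.
    have H' := Hc _ HK; rewrite /filtermap in H'.
    apply: filter_imp H' => t; rewrite /= /scal /= /prod_scal /= /scal /= /mult /=.
    case: v {H Hc} => [a b] /=; rewrite !Rmult_0_l !Rplus_0_r Rminus_0_r => h.
    apply: Rle_trans h _; right.
    have -> : Rabs t * (Rabs t * (Rabs t * (Rabs t * 1))) = (t * t) * (t * t).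
      have E : Rabs t * Rabs t = t * t by rewrite -Rabs_mult Rabs_pos_eq //; nra.
      by rewrite -E; ring.
    ring.
Qed.

(** Polarization: the pure second derivatives vanish in the directions [dir_x], [dir_y] and their
    sum, and mixed derivatives commute. *)
Lemma small4_second (U : R2 -> Prop) (f : R2 -> R) :
  open U -> U (0, 0) -> smooth_on U f -> small4 f ->
  ddir dir_x (ddir dir_y f) (0, 0) = 0 /\ ddir dir_y (ddir dir_x f) (0, 0) = 0.
Proof.
  move=> HU U0 Hf H4.
  have Z := fun v => small4_line U f v 2 HU U0 Hf H4 ltac:(lia).
  rewrite /= in Z.
  have C := ddir_comm U f (0, 0) dir_x dir_y HU Hf U0.
  have S1 := smooth_on_ddir _ _ dir_x Hf; have S2 := smooth_on_ddir _ _ dir_y Hf.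
  have D1 := smooth_on_diff _ _ _ S1 U0; have D2 := smooth_on_diff _ _ _ S2 U0.
  have := Z (plus dir_x dir_y).
  rewrite (ddir_ext_locally _ (fun y => ddir dir_x f y + ddir dir_y f y)); last first.
    apply: filter_imp (HU _ U0) => y Hy; apply: ddir_lin_plus; exact: smooth_on_diff Hy.
  rewrite ddir_plus // !ddir_lin_plus // !Z; lra.
Qed.

(** Polarization of a cubic form: in the directions [dir_x + k dir_y] with [k = 1] and [k = -1] the
    pure third derivatives vanish, and so do those along the axes. The difference of the two
    expansions isolates the coefficient of [x^2 y]. *)
Lemma small4_third (U : R2 -> Prop) (f : R2 -> R) :
  open U -> U (0, 0) -> smooth_on U f -> small4 f ->
  ddir dir_y (ddir dir_x (ddir dir_x f)) (0, 0) = 0.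
Proof.
  move=> HU U0 Hf H4.
  have Z := fun v => small4_line U f v 3 HU U0 Hf H4 ltac:(lia).
  rewrite /= in Z.
  have lin : forall k g x, smooth_on U g -> U x ->
      ddir (plus dir_x (scal k dir_y)) g x = ddir dir_x g x + k * ddir dir_y g x.
    move=> k g x Hg Hx; have Hd := smooth_on_diff _ _ _ Hg Hx.
    by rewrite ddir_lin_plus // ddir_lin_scal.
  have Sd : forall v g, smooth_on U g -> smooth_on U (ddir v g) by move=> v g; exact: smooth_on_ddir.
  have lin2 : forall k v g x, smooth_on U g -> U x ->
      ddir v (ddir (plus dir_x (scal k dir_y)) g) x = ddir v (ddir dir_x g) x + k * ddir v (ddir dir_y g) x.
    move=> k v g x Hg Hx.
    rewrite (ddir_ext_locally _ (fun y => ddir dir_x g y + k * ddir dir_y g y)); last first.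
      apply: filter_imp (HU _ Hx) => y Hy; exact: lin.
    have D1 := smooth_on_diff _ _ _ (Sd dir_x _ Hg) Hx.
    have D2 := smooth_on_diff _ _ _ (Sd dir_y _ Hg) Hx.
    rewrite ddir_plus //.
      rewrite ddir_mult //; last exact: ex_filterdiff_const.
      rewrite ddir_const; ring.
    by apply: ex_filterdiff_Rmult => //; exact: ex_filterdiff_const.
  have lin3 : forall k, ddir (plus dir_x (scal k dir_y)) (ddir (plus dir_x (scal k dir_y))
        (ddir (plus dir_x (scal k dir_y)) f)) (0, 0) =
      ddir dir_x (ddir dir_x (ddir dir_x f)) (0, 0) + 3 * k * ddir dir_y (ddir dir_x (ddir dir_x f)) (0, 0) +
      3 * k ^ 2 * ddir dir_x (ddir dir_y (ddir dir_y f)) (0, 0) + k ^ 3 * ddir dir_y (ddir dir_y (ddir dir_y f)) (0, 0).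
    move=> k; set v := plus dir_x (scal k dir_y).
    have step : forall w, ddir w (ddir v (ddir v f)) (0, 0) =
       ddir w (ddir dir_x (ddir dir_x f)) (0, 0) + 2 * k * ddir w (ddir dir_y (ddir dir_x f)) (0, 0)
       + k ^ 2 * ddir w (ddir dir_y (ddir dir_y f)) (0, 0).
      move=> w.
      rewrite (ddir_ext_locally _ (fun y => ddir dir_x (ddir dir_x f) y + k * ddir dir_x (ddir dir_y f) y
          + k * (ddir dir_y (ddir dir_x f) y + k * ddir dir_y (ddir dir_y f) y))); last first.
        apply: filter_imp (HU _ U0) => y Hy.
        by rewrite lin ?lin2 //; exact: Sd.
      rewrite (ddir_ext_locally _ (fun y => ddir dir_x (ddir dir_x f) y + (2 * k) * ddir dir_y (ddir dir_x f) y
          + k ^ 2 * ddir dir_y (ddir dir_y f) y)); last first.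
        apply: filter_imp (HU _ U0) => y Hy.
        rewrite (ddir_comm U f y dir_x dir_y HU Hf Hy); ring.
      have D11 := smooth_on_diff _ _ _ (Sd dir_x _ (Sd dir_x _ Hf)) U0.
      have D21 := smooth_on_diff _ _ _ (Sd dir_y _ (Sd dir_x _ Hf)) U0.
      have D22 := smooth_on_diff _ _ _ (Sd dir_y _ (Sd dir_y _ Hf)) U0.
      have Dc : forall c : R, ex_filterdiff (fun _ : R2 => c) (locally ((0, 0) : R2))
        by move=> c; exact: ex_filterdiff_const.
      have M : forall (c : R) g, ex_filterdiff g (locally ((0, 0) : R2)) ->
         ex_filterdiff (fun y => c * g y) (locally ((0, 0) : R2)) /\
         ddir w (fun y => c * g y) (0, 0) = c * ddir w g (0, 0).
        move=> c g Hg; split; first exact: ex_filterdiff_Rmult.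
        rewrite ddir_mult // ddir_const; ring.
      rewrite ddir_plus ?ddir_plus //; try exact: (proj1 (M _ _ _)).
        by rewrite !(proj2 (M _ _ _)).
      by apply: ex_filterdiff_Rplus => //; exact: (proj1 (M _ _ _)).
    have Svv := Sd v _ (Sd v _ Hf).
    rewrite lin // !step.
    have C1 := ddir_comm U (ddir dir_x f) (0, 0) dir_x dir_y HU (Sd _ _ Hf) U0.
    have C2 : ddir dir_y (ddir dir_y (ddir dir_x f)) (0, 0) = ddir dir_x (ddir dir_y (ddir dir_y f)) (0, 0).
      rewrite -(ddir_comm U (ddir dir_y f) (0, 0) dir_y dir_x HU (Sd _ _ Hf) U0).
      apply: ddir_ext_locally; apply: filter_imp (HU _ U0) => y Hy; exact: ddir_comm Hy.
    rewrite C1 C2; ring.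
  have H1 := lin3 1; have H2 := lin3 (-1).
  rewrite !Z in H1, H2; lra.
Qed.

Definition saddle (w : R2) : R := (fst w ^ 2 - snd w ^ 2) / 2.

(** Exactly what the contact equations consume. One third derivative is enough, because its mirror
    image is reached through the symmetry [swap_fam]. *)
Record saddle_jet (h : R2 -> R) : Prop := {
  jet_0 : h (0, 0) = 0;
  jet_x : ddir dir_x h (0, 0) = 0;
  jet_y : ddir dir_y h (0, 0) = 0;
  jet_xx : ddir dir_x (ddir dir_x h) (0, 0) = 1;
  jet_xy : ddir dir_x (ddir dir_y h) (0, 0) = 0;
  jet_yx : ddir dir_y (ddir dir_x h) (0, 0) = 0;
  jet_yy : ddir dir_y (ddir dir_y h) (0, 0) = - 1;
  jet_yxx : ddir dir_y (ddir dir_x (ddir dir_x h)) (0, 0) = 0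
}.

Lemma saddle_jet_of_small4 (U : R2 -> Prop) (h : R2 -> R) :
  open U -> U (0, 0) -> smooth_on U h -> small4 (fun w => h w - saddle w) -> saddle_jet h.
Proof.
  move=> HU U0 Hh H4.
  have lx : is_linear (fun w : R2 => fst w) by exact: is_linear_fst.
  have ly : is_linear (fun w : R2 => snd w) by exact: is_linear_snd.
  have sx : smooth_on U (fun w : R2 => fst w) by exact: smooth_on_linear.
  have sy : smooth_on U (fun w : R2 => snd w) by exact: smooth_on_linear.
  have ss : smooth_on U saddle.
    apply: smooth_on_mult => //; last exact: smooth_on_const.
    by apply: smooth_on_minus => //; apply: smooth_on_pow.
  set e := fun w => h w - saddle w in H4 *.
  have se : smooth_on U e by exact: smooth_on_minus.
  have d1 : forall v w : R2, U w -> ddir v h w = ddir v e w + (fst w * fst v - snd w * snd v).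
    move=> v w Hw.
    have -> : ddir v h w = ddir v (fun w => e w + saddle w) w.
      by apply: ddir_ext_locally; apply: filter_forall => y; rewrite /e; ring.
    rewrite ddir_plus; [|exact: smooth_on_diff se Hw|exact: smooth_on_diff ss Hw].
    congr Rplus; apply: is_derive_unique.
    apply: (is_derive_ext (fun t => ((fst w + t * fst v) ^ 2 - (snd w + t * snd v) ^ 2) / 2)) => //.
    auto_derive => //; field.
  have d2 : forall v' v w : R2, U w -> ddir v' (ddir v h) w = ddir v' (ddir v e) w + (fst v' * fst v - snd v' * snd v).
    move=> v' v w Hw.
    rewrite (ddir_ext_locally _ (fun w => ddir v e w + (fst w * fst v - snd w * snd v))); last first.
      by apply: filter_imp (HU _ Hw) => y; exact: d1.
    have sl : smooth_on U (fun w : R2 => fst w * fst v - snd w * snd v).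
      by apply: smooth_on_minus => //; apply: smooth_on_mult => //; exact: smooth_on_const.
    rewrite ddir_plus; [|exact: smooth_on_diff (smooth_on_ddir _ _ _ se) Hw|exact: smooth_on_diff sl Hw].
    congr Rplus; apply: is_derive_unique.
    apply: (is_derive_ext (fun t => (fst w + t * fst v') * fst v - (snd w + t * snd v') * snd v)) => //.
    auto_derive => //; ring.
  have d3 : forall v2 v' v : R2, ddir v2 (ddir v' (ddir v h)) (0, 0) = ddir v2 (ddir v' (ddir v e)) (0, 0).
    move=> v2 v' v.
    rewrite (ddir_ext_locally _ (fun w => ddir v' (ddir v e) w + (fst v' * fst v - snd v' * snd v))); last first.
      by apply: filter_imp (HU _ U0) => y; exact: d2.
    rewrite ddir_plus; [|exact: smooth_on_diff (smooth_on_ddir _ _ _ (smooth_on_ddir _ _ _ se)) U0|exact: ex_filterdiff_const].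
    rewrite ddir_const; ring.
  have Z1 := fun v => small4_line U e v 1 HU U0 se H4 ltac:(lia).
  have Z2 := fun v => small4_line U e v 2 HU U0 se H4 ltac:(lia).
  have [M1 M2] := small4_second U e HU U0 se H4.
  have T1 := small4_third U e HU U0 se H4.
  rewrite /= in Z1 Z2.
  split; rewrite ?d1 ?d2 ?d3 ?Z1 ?Z2 ?M1 ?M2 ?T1 /=; try ring; try assumption.
  have := small4_line U e dir_x 0 HU U0 se H4 ltac:(lia); rewrite /= /e /saddle /=; lra.
Qed.

(** * The pencil of cyclides *)

Definition cyc (A x y z : R) : R :=
  A * ((x ^ 2 + y ^ 2 + z ^ 2) ^ 2 - 4 * z ^ 2) + (x ^ 2 + y ^ 2 + z ^ 2) * z / 4
  + (x ^ 2 - y ^ 2) / 2 - z.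

(** On the box of this size the derivative of [cyc A] in [z] is at most [- 9 / 10]. *)
Definition box_size (A : R) : R := / (100 * (1 + A ^ 2)).

Lemma box_size_bounds A : 0 < box_size A <= 1 / 100 /\ Rabs A * box_size A <= 1 / 200.
Proof.
  have h := pow2_ge_0 A.
  have h0 : 0 < 100 * (1 + A ^ 2) by nra.
  have h1 := Rinv_0_lt_compat _ h0.
  have h2 : box_size A * (100 * (1 + A ^ 2)) = 1 by rewrite /box_size Rinv_l //; lra.
  have h3 : Rabs A <= (1 + A ^ 2) / 2.
    have : A ^ 2 = Rabs A ^ 2 by rewrite pow2_abs.
    by move=> ->; have := pow2_ge_0 (Rabs A - 1); nra.
  have h5 : 0 < box_size A by [].
  split; first by split; [|nra].
  have : Rabs A * box_size A <= (1 + A ^ 2) / 2 * box_size A.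
    by apply: Rmult_le_compat_r; lra.
  nra.
Qed.

Lemma Rabs_lt_iff x e : Rabs x < e <-> - e < x < e.
Proof. split; [by move=> /Rabs_def2; lra|by move=> h; apply: Rabs_def1; lra]. Qed.

Lemma Rabs_le_iff x e : Rabs x <= e <-> - e <= x <= e.
Proof. split; [by move=> h; have := Rle_abs x; have := Rle_abs (- x); rewrite Rabs_Ropp; lra|exact: Rabs_le]. Qed.

(** The divided difference of [cyc A x y] between [z] and [z']. A single bound on it yields
    uniqueness of the root, its size and its continuity, and, at [z = z'], a nonvanishing partial
    derivative in [z]. *)
Definition cyc_slope (A x y z z' : R) : R :=
  A * (z + z') * (2 * (x ^ 2 + y ^ 2) + z ^ 2 + z' ^ 2 - 4) + (x ^ 2 + y ^ 2) / 4
  + (z ^ 2 + z * z' + z' ^ 2) / 4 - 1.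

Lemma cyc_slopeE A x y z z' :
  cyc A x y z - cyc A x y z' = (z - z') * cyc_slope A x y z z'.
Proof. rewrite /cyc /cyc_slope; field. Qed.

Lemma small_sqr x e : Rabs x < e -> 0 < e <= 1 / 100 -> 0 <= x ^ 2 <= 1 / 10000.
Proof. move=> /Rabs_lt_iff h h'; split; nra. Qed.

Lemma small_mul A x e : Rabs x < e -> Rabs A * e <= 1 / 200 -> -1 / 200 <= A * x <= 1 / 200.
Proof.
  move=> h h'; have : Rabs (A * x) <= 1 / 200.
    rewrite Rabs_mult; have := Rabs_pos A; have := Rabs_pos x; nra.
  move/Rabs_le_iff; lra.
Qed.

Lemma cyc_slope_bound A x y z z' : let e := box_size A in
  Rabs x < e -> Rabs y < e -> Rabs z < e -> Rabs z' < e ->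
  cyc_slope A x y z z' <= - (9 / 10).
Proof.
  have [He HA] := box_size_bounds A; move: (box_size A) He HA => e He HA /= hx hy hz hz'.
  have := small_sqr _ _ hx He; have := small_sqr _ _ hy He.
  have := small_sqr _ _ hz He; have := small_sqr _ _ hz' He.
  have := small_mul _ _ _ hz HA; have := small_mul _ _ _ hz' HA.
  rewrite /cyc_slope => a1 a2 b1 b2 b3 b4.
  set k := 2 * (x ^ 2 + y ^ 2) + z ^ 2 + z' ^ 2 - 4.
  have hk : -4 <= k <= -3 by rewrite /k; lra.
  have h1 : A * (z + z') * k <= 4 / 100.
    have h2 : -1 / 100 <= A * (z + z') <= 1 / 100 by lra.
    nra.
  have h3 : z * z' <= (z ^ 2 + z' ^ 2) / 2 by have := pow2_ge_0 (z - z'); nra.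
  lra.
Qed.

Lemma cyc_root A x y : Rabs x < box_size A -> Rabs y < box_size A ->
  exists z, Rabs z < box_size A /\ cyc A x y z = 0.
Proof.
  have [He HA] := box_size_bounds A; move: (box_size A) He HA => e He HA hx hy.
  have sx := small_sqr _ _ hx He; have sy := small_sqr _ _ hy He.
  have xe : x ^ 2 <= e / 100 by move/Rabs_lt_iff: hx; nra.
  have ye : y ^ 2 <= e / 100 by move/Rabs_lt_iff: hy; nra.
  (* In the box [cyc] differs from [-z] by at most [e / 4], so it changes sign between [-d] and [d];
     taking [d < e] keeps the root strictly inside the box. *)
  pose d := e * (9 / 10).
  have hd : Rabs d < e by apply/Rabs_lt_iff; rewrite /d; lra.
  have hd' : Rabs (- d) < e by rewrite Rabs_Ropp.
  have bound : forall z, Rabs z < e -> Rabs (cyc A x y z + z) <= e / 4.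
    move=> z hz; have sz := small_sqr _ _ hz He.
    have ze : z ^ 2 <= e / 100 by move/Rabs_lt_iff: hz; nra.
    have q : 0 <= (x ^ 2 + y ^ 2 + z ^ 2) <= e / 33 by lra.
    have Ae : Rabs A * e <= 1 / 200 := HA.
    have -> : cyc A x y z + z = A * ((x ^ 2 + y ^ 2 + z ^ 2) ^ 2 - 4 * z ^ 2)
        + (x ^ 2 + y ^ 2 + z ^ 2) * z / 4 + (x ^ 2 - y ^ 2) / 2 by rewrite /cyc; field.
    have t1 : Rabs (A * ((x ^ 2 + y ^ 2 + z ^ 2) ^ 2 - 4 * z ^ 2)) <= e / 10.
      rewrite Rabs_mult.
      have : Rabs ((x ^ 2 + y ^ 2 + z ^ 2) ^ 2 - 4 * z ^ 2) <= 5 * e ^ 2.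
        have z2 : z ^ 2 <= e ^ 2 by move/Rabs_lt_iff: hz; nra.
        have q2 : (x ^ 2 + y ^ 2 + z ^ 2) ^ 2 <= (e / 33) ^ 2 by apply: pow_incr.
        have q3 := pow2_ge_0 (x ^ 2 + y ^ 2 + z ^ 2).
        apply/Rabs_le_iff; nra.
      have hA := Rabs_pos A => h.
      apply: (Rle_trans _ (Rabs A * (5 * e ^ 2))); first exact: Rmult_le_compat_l.
      nra.
    have t2 : Rabs ((x ^ 2 + y ^ 2 + z ^ 2) * z / 4) <= e / 100.
      apply/Rabs_le_iff; move/Rabs_lt_iff: hz => hz; nra.
    have t3 : Rabs ((x ^ 2 - y ^ 2) / 2) <= e / 100 by apply/Rabs_le_iff; lra.
    apply: Rle_trans (Rabs_triang _ _) _.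
    have := Rabs_triang (A * ((x ^ 2 + y ^ 2 + z ^ 2) ^ 2 - 4 * z ^ 2)) ((x ^ 2 + y ^ 2 + z ^ 2) * z / 4).
    lra.
  have b1 := bound d hd; have b2 := bound _ hd'.
  move/Rabs_le_iff: b1 => b1; move/Rabs_le_iff: b2 => b2.
  have hc : continuity (cyc A x y).
    move=> z; apply: derivable_continuous_pt; apply: ex_derive_Reals_0.
    by rewrite /cyc; auto_derive.
  have [z [hz hz0]] : {z | Rmin (- d) d <= z <= Rmax (- d) d /\ cyc A x y z = 0}.
    apply: IVT_gen => //; rewrite Rmin_right; last (rewrite /d in b1, b2 *; lra).
    rewrite Rmax_left; rewrite /d in b1, b2 *; lra.
  exists z; split=> //; apply/Rabs_lt_iff.
  move: hz; rewrite Rmin_left; last (rewrite /d; lra).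
  rewrite Rmax_right; rewrite /d; lra.
Qed.

(** The parameter [A] is a variable on a par with [x] and [y], since the family must be smooth in it
    as well. Outside [cyc_dom] no root is guaranteed and the value is arbitrary. *)
Definition cycF (q : R * R2) : R :=
  epsilon (inhabits 0) (fun z => Rabs z < box_size (fst q) /\
    cyc (fst q) (fst (snd q)) (snd (snd q)) z = 0).

Definition cyc_dom (q : R * R2) : Prop :=
  Rabs (fst (snd q)) < box_size (fst q) /\ Rabs (snd (snd q)) < box_size (fst q).

Lemma cycF_spec A x y : cyc_dom (A, (x, y)) ->
  Rabs (cycF (A, (x, y))) < box_size A /\ cyc A x y (cycF (A, (x, y))) = 0.
Proof.
  move=> [hx hy].
  exact: (epsilon_spec (inhabits 0) (fun z => Rabs z < box_size A /\ cyc A x y z = 0)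
    (cyc_root A x y hx hy)).
Qed.

Lemma cyc_root_unique A x y z z' : Rabs x < box_size A -> Rabs y < box_size A ->
  Rabs z < box_size A -> Rabs z' < box_size A ->
  cyc A x y z = 0 -> cyc A x y z' = 0 -> z = z'.
Proof.
  move=> hx hy hz hz' E E'.
  have := cyc_slopeE A x y z z'; have := cyc_slope_bound A x y z z' hx hy hz hz'.
  rewrite E E'; nra.
Qed.

Lemma cycF_unique A x y z : cyc_dom (A, (x, y)) -> Rabs z < box_size A ->
  cyc A x y z = 0 -> z = cycF (A, (x, y)).
Proof.
  move=> hd hz E; have [h1 h2] := cycF_spec A x y hd; case: hd => hx hy.
  exact: (cyc_root_unique A x y).
Qed.

Lemma is_linear_x3 : is_linear (fun q : R * R2 => fst (snd q)).
Proof. apply: (is_linear_comp snd fst); [exact: is_linear_snd|exact: is_linear_fst]. Qed.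
Lemma is_linear_y3 : is_linear (fun q : R * R2 => snd (snd q)).
Proof. apply: (is_linear_comp snd snd); exact: is_linear_snd. Qed.

Lemma continuous_box_size A : continuous box_size A.
Proof.
  apply: ex_derive_continuous; rewrite /box_size; auto_derive.
  have := pow2_ge_0 A; nra.
Qed.

Lemma locally_lt {T : UniformSpace} (f g : T -> R) (x : T) :
  continuous f x -> continuous g x -> f x < g x -> locally x (fun y => f y < g y).
Proof.
  move=> Hf Hg H.
  have Hd : continuous (fun y => minus (g y) (f y)) x by exact: continuous_minus.
  have hp : 0 < g x - f x by lra.
  have h := Hd _ (locally_ball _ (mkposreal _ hp)); rewrite /filtermap in h.
  apply: filter_imp h => y hy.
  have {hy} : Rabs ((g y - f y) - (g x - f x)) < g x - f x by exact: hy.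
  move/Rabs_lt_iff; lra.
Qed.

Lemma open_cyc_dom : open cyc_dom.
Proof.
  move=> q [hx hy].
  have cb : continuous (fun q : R * R2 => box_size (fst q)) q.
    apply: continuous_comp; last exact: continuous_box_size.
    exact: continuous_fst.
  apply: filter_and; apply: locally_lt => //.
  - apply: (continuous_comp (fun q : R * R2 => fst (snd q)) Rabs); last exact: continuous_Rabs.
    apply: filterdiff_continuous; exact: ex_filterdiff_linear is_linear_x3.
  - apply: (continuous_comp (fun q : R * R2 => snd (snd q)) Rabs); last exact: continuous_Rabs.
    apply: filterdiff_continuous; exact: ex_filterdiff_linear is_linear_y3.
Qed.

Lemma Ck_pow {E : NormedModule R_AbsRing} n (U : E -> Prop) (HU : open U) (f : E -> R) k :
  Ck n U f -> Ck n U (fun q => f q ^ k).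
Proof. move=> Hf; elim: k => [|k IH] /=; [exact: Ck_const|exact: Ck_mult]. Qed.

Ltac Ck_tac HU :=
  repeat (first
    [ assumption
    | apply: (Ck_plus _ _ _ _ HU) | apply: (Ck_minus _ _ _ _ HU)
    | apply: (Ck_mult _ _ _ _ HU) | apply: (Ck_opp _ _ _ HU)
    | apply: (Ck_pow _ _ HU) | exact: (Ck_const _ _ _ HU) ]).

Lemma smooth_cyc {E : NormedModule R_AbsRing} n (U : E -> Prop) (a x y z : E -> R) : open U ->
  Ck n U a -> Ck n U x -> Ck n U y -> Ck n U z -> Ck n U (fun q => cyc (a q) (x q) (y q) (z q)).
Proof. move=> HU Ha Hx Hy Hz; rewrite /cyc /Rdiv; Ck_tac HU. Qed.

Definition cyc_dz (A x y z : R) : R := cyc_slope A x y z z.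

(** The old root [z0] nearly solves the perturbed equation, and a slope of absolute value at least
    9/10 converts this defect into a bound on the distance to the new root. The box varies with [A],
    so [z0] must first be seen to stay inside the new one. *)
Lemma cycF_continuous q : cyc_dom q -> continuous cycF q.
Proof.
  case: q => A [x y] hq; have [hF hF0] := cycF_spec A x y hq.
  set z0 := cycF (A, (x, y)) in hF hF0.
  have cb : continuous (fun q : R * R2 => box_size (fst q)) (A, (x, y)).
    apply: continuous_comp; last exact: continuous_box_size.
    exact: continuous_fst.
  have L1 : locally ((A, (x, y)) : R * R2) (fun q => Rabs z0 < box_size (fst q)).
    apply: locally_lt => //; exact: continuous_const.
  have L2 := open_cyc_dom _ hq.
  have Cp : continuous (fun q : R * R2 => cyc (fst q) (fst (snd q)) (snd (snd q)) z0) (A, (x, y)).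
    apply: filterdiff_continuous.
    have H : Ck 0 (fun _ : R * R2 => True) (fun q : R * R2 => cyc (fst q) (fst (snd q)) (snd (snd q)) z0).
      apply: smooth_cyc; last (apply: Ck_const; exact: open_true); try exact: open_true;
        apply: Ck_linear; try exact: open_true.
      - exact: is_linear_fst.
      - exact: is_linear_x3.
      - exact: is_linear_y3.
    exact: (proj1 H).
  move=> P [eps HP].
  have He : 0 < eps / 2 by have := cond_pos eps; lra.
  have L3 := Cp _ (locally_ball _ (mkposreal _ He)); rewrite /filtermap in L3.
  rewrite /filtermap; apply: filter_imp (filter_and _ _ L1 (filter_and _ _ L2 L3)).
  move=> [A' [x' y']] [h1 [h2 h3]]; apply: HP.
  have {h3} : Rabs (cyc A' x' y' z0 - cyc A x y z0) < eps / 2 by exact: h3.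
  rewrite hF0 Rminus_0_r => h3.
  have [k1 k2] := cycF_spec A' x' y' h2.
  have s1 := cyc_slopeE A' x' y' z0 (cycF (A', (x', y'))).
  have s2 := cyc_slope_bound A' x' y' z0 (cycF (A', (x', y'))) (proj1 h2) (proj2 h2) h1 k1.
  rewrite k2 Rminus_0_r in s1; rewrite s1 Rabs_mult in h3.
  change (Rabs (cycF (A', (x', y')) - cycF (A, (x, y))) < eps).
  rewrite -/z0 Rabs_minus_sym.
  have s3 : 9 / 10 <= Rabs (cyc_slope A' x' y' z0 (cycF (A', (x', y')))).
    rewrite Rabs_left; lra.
  have := Rabs_pos (z0 - cycF (A', (x', y'))); nra.
Qed.

Lemma ddir_cyc_z A x y z :
  ddir ((zero, 1) : R * R2 * R) (fun w => cyc (fst (fst w)) (fst (snd (fst w))) (snd (snd (fst w))) (snd w))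
    (A, (x, y), z) = cyc_dz A x y z.
Proof.
  rewrite /ddir /=; apply: is_derive_unique.
  apply: (is_derive_ext (fun t => cyc A x y (z + t))).
    move=> t; rewrite /plus /scal /= /prod_plus /prod_scal /= /plus /scal /zero /= /prod_plus /prod_scal /= /mult /plus /scal /=.
    by rewrite /mult /= !Rmult_0_r !Rplus_0_r Rmult_1_r.
  rewrite /cyc /cyc_dz /cyc_slope; auto_derive => //; field.
Qed.

(** Bootstrapping of the implicit function theorem: each directional derivative of [cycF] is a
    rational function of the point and of [cycF] itself, with nonvanishing denominator, so class [n]
    of [cycF] gives class [n] of its derivatives. *)
Lemma cycF_Ck n : Ck n cyc_dom cycF.
Proof.
  pose G (w : R * R2 * R) := cyc (fst (fst w)) (fst (snd (fst w))) (snd (snd (fst w))) (snd w).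
  have l1 : is_linear (fun w : R * R2 * R => fst (fst w)).
    by apply: (is_linear_comp fst fst); exact: is_linear_fst.
  have l2 : is_linear (fun w : R * R2 * R => fst (snd (fst w))).
    by apply: (is_linear_comp fst (fun q : R * R2 => fst (snd q))); [exact: is_linear_fst|exact: is_linear_x3].
  have l3 : is_linear (fun w : R * R2 * R => snd (snd (fst w))).
    by apply: (is_linear_comp fst (fun q : R * R2 => snd (snd q))); [exact: is_linear_fst|exact: is_linear_y3].
  have l4 : is_linear (fun w : R * R2 * R => snd w) by exact: is_linear_snd.
  have GC : forall m, Ck m (fun _ => True) G.
    by move=> m; apply: smooth_cyc; try exact: open_true; apply: Ck_linear => //; exact: open_true.
  have GS : smooth_on (fun _ => True) G by apply/smooth_on_Ck.
  have slope : forall q, cyc_dom q -> cyc_dz (fst q) (fst (snd q)) (snd (snd q)) (cycF q) < 0.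
    move=> [A [x y]] hq; have [h1 h2] := cycF_spec A x y hq.
    have := cyc_slope_bound A x y _ _ (proj1 hq) (proj2 hq) h1 h1; rewrite /cyc_dz /=; lra.
  have D : forall q, cyc_dom q -> filterdiff cycF (locally q)
     (fun v => - ddir ((v, 0) : R * R2 * R) G (q, cycF q) / cyc_dz (fst q) (fst (snd q)) (snd (snd q)) (cycF q)).
    move=> q hq; have sq := slope q hq.
    have dz : ddir ((zero, 1) : R * R2 * R) G (q, cycF q) = cyc_dz (fst q) (fst (snd q)) (snd (snd q)) (cycF q).
      case: q hq sq => A [x y] hq sq; exact: ddir_cyc_z.
    rewrite -dz; apply: (implicit_filterdiff G cycF q (fun v => ddir v G (q, cycF q))).
    - apply: ddir_filterdiff; exact: (smooth_on_diff _ _ _ GS I).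
    - rewrite dz; exact: Rlt_not_eq.
    - exact: cycF_continuous.
    - apply: filter_imp (open_cyc_dom _ hq) => -[A [x y]] h; exact: (proj2 (cycF_spec A x y h)).
  have cx' : forall m, Ck m cyc_dom (fun q : R * R2 => fst q).
    by move=> m; apply: Ck_linear; [exact: open_cyc_dom|exact: is_linear_fst].
  have cy' : forall m, Ck m cyc_dom (fun q : R * R2 => fst (snd q)).
    by move=> m; apply: Ck_linear; [exact: open_cyc_dom|exact: is_linear_x3].
  have cz' : forall m, Ck m cyc_dom (fun q : R * R2 => snd (snd q)).
    by move=> m; apply: Ck_linear; [exact: open_cyc_dom|exact: is_linear_y3].
  elim: n => [|n IH]; split=> //; try by move=> q hq; eexists; exact: D.
  move=> v.
  (* The numerator must be exhibited as a polynomial in [A], [x], [y], [z] in order to apply the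
     closure properties of [Ck] after substituting [z = cycF q]. *)
  have dG : exists H : R -> R -> R -> R -> R,
     (forall A x y z, ddir ((v, 0) : R * R2 * R) G ((A, (x, y)), z) = H A x y z) /\
     Ck n cyc_dom (fun q => H (fst q) (fst (snd q)) (snd (snd q)) (cycF q)).
    case: v => a [b c].
    exists (fun A x y z => a * ((x ^ 2 + y ^ 2 + z ^ 2) ^ 2 - 4 * z ^ 2)
      + (A * (4 * (x ^ 2 + y ^ 2 + z ^ 2)) + z * / 2) * (x * b + y * c) + (x * b - y * c)).
    split; last first.
      have HU := open_cyc_dom; have c1 := cx' n; have c2 := cy' n; have c3 := cz' n.
      Ck_tac HU.
    move=> A x y z; rewrite /ddir; apply: is_derive_unique.
    apply: (is_derive_ext (fun t => cyc (A + t * a) (x + t * b) (y + t * c) z)).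
      move=> t; rewrite /G /plus /scal /= /prod_plus /prod_scal /= /plus /scal /= /prod_plus /prod_scal /= /mult /plus /scal /=.
      by rewrite /mult /= Rmult_0_r Rplus_0_r.
    rewrite /cyc; auto_derive => //; field.
  case: dG => H [HH CH].
  apply: (Ck_ext _ _ (fun q => - H (fst q) (fst (snd q)) (snd (snd q)) (cycF q) *
     / cyc_dz (fst q) (fst (snd q)) (snd (snd q)) (cycF q))).
  - exact: open_cyc_dom.
  - move=> q hq; rewrite (filterdiff_ddir _ _ _ _ (D q hq)) /Rdiv.
    by case: q hq => A [x y] hq; rewrite HH.
  - have HU := open_cyc_dom; have c1 := cx' n; have c2 := cy' n; have c3 := cz' n.
    apply: Ck_mult => //; first exact: Ck_opp.
    apply: Ck_inv => //; first by move=> q hq; exact: Rlt_not_eq (slope q hq).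
    rewrite /cyc_dz /cyc_slope /Rdiv; Ck_tac HU.
Qed.

Lemma cycF_smooth : smooth_on cyc_dom cycF.
Proof. apply/smooth_on_Ck; exact: cycF_Ck. Qed.

Lemma cyc_dom_0 A : cyc_dom (A, (0, 0)).
Proof. by rewrite /cyc_dom /= Rabs_R0; have [] := box_size_bounds A; lra. Qed.

Lemma cycF_size A x y : cyc_dom (A, (x, y)) -> Rabs (cycF (A, (x, y))) <= 2 * (x ^ 2 + y ^ 2).
Proof.
  move=> hd; have [h1 h2] := cycF_spec A x y hd; case: hd => /= hx hy.
  have [He HA] := box_size_bounds A.
  have h0 : Rabs 0 < box_size A by rewrite Rabs_R0; lra.
  have := cyc_slopeE A x y (cycF (A, (x, y))) 0.
  have sl := cyc_slope_bound A x y _ _ hx hy h1 h0.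
  rewrite h2 Rminus_0_r; move: sl; set z := cycF _; set s := cyc_slope _ _ _ _ _ => sl E.
  have Hc : Rabs (cyc A x y 0) <= x ^ 2 + y ^ 2.
    have -> : cyc A x y 0 = A * (x ^ 2 + y ^ 2) ^ 2 + (x ^ 2 - y ^ 2) / 2 by rewrite /cyc; field.
    have sx := small_sqr _ _ hx He; have sy := small_sqr _ _ hy He.
    have xa := small_mul _ _ _ hx HA; have ya := small_mul _ _ _ hy HA.
    have xe : x ^ 2 = x * x by ring.
    have t : -1/100 <= A * (x ^ 2 + y ^ 2) <= 1/100.
      have -> : A * (x ^ 2 + y ^ 2) = (A * x) * x + (A * y) * y by ring.
      move/Rabs_lt_iff: hx => hx; move/Rabs_lt_iff: hy => hy; split; nra.
    have -> : A * (x ^ 2 + y ^ 2) ^ 2 = A * (x ^ 2 + y ^ 2) * (x ^ 2 + y ^ 2) by ring.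
    apply/Rabs_le_iff; split; nra.
  have Hs : Rabs z * Rabs s = Rabs (cyc A x y 0).
    rewrite -Rabs_mult -E -Rabs_Ropp; congr Rabs; ring.
  have s3 : 9 / 10 <= Rabs s by rewrite Rabs_left; lra.
  have := Rabs_pos z; nra.
Qed.

Lemma Rabs_mult_le a b c d : Rabs a <= c -> Rabs b <= d -> Rabs (a * b) <= c * d.
Proof.
  move=> h1 h2; rewrite Rabs_mult; apply: Rmult_le_compat => //; exact: Rabs_pos.
Qed.

Lemma Rabs_plus_le a b c d : Rabs a <= c -> Rabs b <= d -> Rabs (a + b) <= c + d.
Proof. move=> h1 h2; apply: Rle_trans (Rabs_triang _ _) _; lra. Qed.

(** The equation expresses [z - (x^2 - y^2) / 2] through terms that become quartic once
    [z = O(x^2 + y^2)] is known from [cycF_size]. *)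
Lemma cycF_order2 A x y : cyc_dom (A, (x, y)) ->
  Rabs (cycF (A, (x, y)) - (x ^ 2 - y ^ 2) / 2) <= (20 * Rabs A + 1) * (x ^ 2 + y ^ 2) ^ 2.
Proof.
  move=> hd; have hz := cycF_size A x y hd; have [_ h] := cycF_spec A x y hd.
  have [He HA] := box_size_bounds A; case: hd => /= hx hy.
  move: hz h; set z := cycF _; set q := x ^ 2 + y ^ 2 => hz h.
  have sx := small_sqr _ _ hx He; have sy := small_sqr _ _ hy He.
  have hq : 0 <= q <= 1 / 5000 by rewrite /q; lra.
  have -> : z - (x ^ 2 - y ^ 2) / 2 = A * ((q + z ^ 2) ^ 2 - 4 * z ^ 2) + (q + z ^ 2) * z / 4.
    rewrite -[LHS]Rplus_0_r -h /q /cyc; field.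
  have z2 : 0 <= z ^ 2 <= 4 * q ^ 2.
    move/Rabs_le_iff: hz => hz; split; nra.
  have z2' : z ^ 2 <= q by nra.
  have t1 : Rabs ((q + z ^ 2) ^ 2 - 4 * z ^ 2) <= 20 * q ^ 2.
    apply/Rabs_le_iff; split; nra.
  have t2 : Rabs ((q + z ^ 2) * z / 4) <= q ^ 2.
    have -> : (q + z ^ 2) * z / 4 = ((q + z ^ 2) / 4) * z by field.
    have -> : q ^ 2 = (q / 2) * (2 * q) by field.
    apply: Rabs_mult_le => //; apply/Rabs_le_iff; lra.
  have := Rabs_plus_le _ _ _ _ (Rabs_mult_le _ _ _ _ (Rle_refl (Rabs A)) t1) t2; lra.
Qed.

(** Second substitution: put [q = x^2 + y^2], [k = (x^2 - y^2) / 2] and insert [z = k + O(q^2)] into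
    the equation. The term in [A] becomes [q^2 - 4 k^2 = 4 x^2 y^2], the next one [q k / 4], and all
    the rest is [O(q^3)]. *)
Lemma cycF_order4 A x y : cyc_dom (A, (x, y)) ->
  Rabs (cycF (A, (x, y)) - (x ^ 2 - y ^ 2) / 2
        - (A * 4 * x ^ 2 * y ^ 2 + (x ^ 2 + y ^ 2) * (x ^ 2 - y ^ 2) / 8))
  <= (1000 * (1 + Rabs A) ^ 2) * (x ^ 2 + y ^ 2) ^ 3.
Proof.
  move=> hd; have hz := cycF_size A x y hd; have h2 := cycF_order2 A x y hd.
  have [_ h] := cycF_spec A x y hd.
  have [He HA] := box_size_bounds A; case: hd => /= hx hy.
  move: hz h2 h; set z := cycF _ => hz h2 h.
  have sx := small_sqr _ _ hx He; have sy := small_sqr _ _ hy He.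
  pose q := x ^ 2 + y ^ 2; pose k := (x ^ 2 - y ^ 2) / 2.
  have hq : 0 <= q <= 1 / 5000 by rewrite /q; lra.
  have hk : Rabs k <= q by apply/Rabs_le_iff; rewrite /q /k; lra.
  rewrite -/q -/k in hz h2 *.
  have a0 := Rabs_pos A.
  have -> : z - k - (A * 4 * x ^ 2 * y ^ 2 + q * (x ^ 2 - y ^ 2) / 8) =
     A * (z ^ 2 * (2 * q + z ^ 2) - 4 * ((z - k) * (z + k))) + (q * (z - k) / 4 + z ^ 2 * z / 4).
    rewrite -[LHS]Rplus_0_r -h /q /k /cyc; field.
  have z2 : Rabs (z ^ 2) <= 4 * q ^ 2.
    apply/Rabs_le_iff; move/Rabs_le_iff: hz => hz; split; nra.
  have z2' : Rabs (2 * q + z ^ 2) <= 3 * q by apply/Rabs_le_iff; move/Rabs_le_iff: z2 => z2; have := pow2_ge_0 z; nra.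
  have zk : Rabs (z + k) <= 3 * q by have := Rabs_plus_le _ _ _ _ hz hk; lra.
  have t1 := Rabs_mult_le _ _ _ _ z2 z2'.
  have t2 := Rabs_mult_le _ _ _ _ h2 zk.
  have t3 : Rabs (z ^ 2 * (2 * q + z ^ 2) - 4 * ((z - k) * (z + k))) <= (4 * q ^ 2) * (3 * q) + 4 * ((20 * Rabs A + 1) * q ^ 2 * (3 * q)).
    apply: Rabs_plus_le => //; rewrite Rabs_Ropp Rabs_mult (Rabs_pos_eq 4); lra.
  have t4 : Rabs (q * (z - k) / 4) <= q * ((20 * Rabs A + 1) * q ^ 2).
    have -> : q * (z - k) / 4 = (q / 4) * (z - k) by field.
    apply: Rabs_mult_le => //; apply/Rabs_le_iff; lra.
  have t5 : Rabs (z ^ 2 * z / 4) <= 4 * q ^ 2 * (2 * q).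
    have -> : z ^ 2 * z / 4 = z ^ 2 * (z / 4) by field.
    apply: Rabs_mult_le => //; rewrite /Rdiv Rabs_mult (Rabs_pos_eq (/ 4)); lra.
  have t6 := Rabs_plus_le _ _ _ _ (Rabs_mult_le _ _ _ _ (Rle_refl (Rabs A)) t3) (Rabs_plus_le _ _ _ _ t4 t5).
  apply: Rle_trans t6 _.
  have q3 : 0 <= q ^ 3 by apply: pow_le; lra.
  have -> : Rabs A * (4 * q ^ 2 * (3 * q) + 4 * ((20 * Rabs A + 1) * q ^ 2 * (3 * q))) +
    (q * ((20 * Rabs A + 1) * q ^ 2) + 4 * q ^ 2 * (2 * q)) =
    (Rabs A * (12 + 12 * (20 * Rabs A + 1)) + 20 * Rabs A + 9) * q ^ 3 by ring.
  apply: Rmult_le_compat_r => //; nra.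
Qed.

(** * Moebius transformations *)

#[local] Arguments cx : simpl never.
#[local] Arguments cy : simpl never.
#[local] Arguments cz : simpl never.

Ltac smooth_tac HU :=
  repeat (first
    [ assumption
    | apply: (smooth_on_plus _ _ _ HU) | apply: (smooth_on_minus _ _ _ HU)
    | apply: (smooth_on_mult _ _ _ HU) | apply: (smooth_on_opp _ _ HU)
    | apply: (smooth_on_pow _ _ _ HU) | exact: (smooth_on_const _ _ HU)
    | exact: (smooth_on_linear _ _ HU is_linear_cx)
    | exact: (smooth_on_linear _ _ HU is_linear_cy)
    | exact: (smooth_on_linear _ _ HU is_linear_cz) ]).

Lemma R3_eta (v : R3) : v = (cx v, cy v, cz v).
Proof. by case: v => [[]]. Qed.

Lemma R3_eq (v w : R3) : cx v = cx w -> cy v = cy w -> cz v = cz w -> v = w.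
Proof. by case: v => [[? ?] ?]; case: w => [[? ?] ?]; rewrite /cx /cy /cz /= => -> -> ->. Qed.

Lemma dot_comm (v w : R3) : dot v w = dot w v.
Proof. rewrite /dot; ring. Qed.

Lemma cx_plus (v w : R3) : cx (plus v w) = cx v + cx w. Proof. by []. Qed.
Lemma cy_plus (v w : R3) : cy (plus v w) = cy v + cy w. Proof. by []. Qed.
Lemma cz_plus (v w : R3) : cz (plus v w) = cz v + cz w. Proof. by []. Qed.
Lemma cx_scal (k : R) (v : R3) : cx (scal k v) = k * cx v. Proof. by []. Qed.
Lemma cy_scal (k : R) (v : R3) : cy (scal k v) = k * cy v. Proof. by []. Qed.
Lemma cz_scal (k : R) (v : R3) : cz (scal k v) = k * cz v. Proof. by []. Qed.
Lemma cx_opp (v : R3) : cx (opp v) = - cx v. Proof. by []. Qed.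
Lemma cy_opp (v : R3) : cy (opp v) = - cy v. Proof. by []. Qed.
Lemma cz_opp (v : R3) : cz (opp v) = - cz v. Proof. by []. Qed.
Definition coordE := (cx_plus, cy_plus, cz_plus, cx_scal, cy_scal, cz_scal, cx_opp, cy_opp, cz_opp).

Lemma continuous_R3 {T : UniformSpace} (f : T -> R3) (x : T) :
  continuous (fun y => cx (f y)) x -> continuous (fun y => cy (f y)) x ->
  continuous (fun y => cz (f y)) x -> continuous f x.
Proof.
  move=> H1 H2 H3 P [e He].
  have h1 := H1 _ (locally_ball _ e); have h2 := H2 _ (locally_ball _ e).
  have h3 := H3 _ (locally_ball _ e); rewrite /filtermap in h1 h2 h3 *.
  apply: filter_imp (filter_and _ _ h1 (filter_and _ _ h2 h3)) => y [k1 [k2 k3]].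
  by apply: He; split; [split|].
Qed.

Lemma smooth_map_continuous {E : NormedModule R_AbsRing} (U : E -> Prop) (f : E -> R3) x :
  smooth_map U f -> U x -> continuous f x.
Proof.
  by move=> [h1 [h2 h3]] Hx; apply: continuous_R3; apply: smooth_on_continuous Hx.
Qed.

Lemma smooth_map_ext {E : NormedModule R_AbsRing} (U : E -> Prop) (f g : E -> R3) :
  open U -> (forall x, U x -> f x = g x) -> smooth_map U f -> smooth_map U g.
Proof.
  move=> HU H [h1 [h2 h3]]; split; [|split];
    by [apply: smooth_on_ext HU _ h1 => x Hx; rewrite H|apply: smooth_on_ext HU _ h2 => x Hx; rewrite H|apply: smooth_on_ext HU _ h3 => x Hx; rewrite H].
Qed.

Lemma smooth_on_comp_map {E : NormedModule R_AbsRing} (U : E -> Prop) (W : R3 -> Prop)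
    (phi : R3 -> R) (f : E -> R3) :
  open U -> smooth_map U f -> (forall x, U x -> W (f x)) -> smooth_on W phi ->
  smooth_on U (fun x => phi (f x)).
Proof.
  move=> HU [h1 [h2 h3]] HW Hphi.
  apply: (smooth_on_ext _ (fun x => phi (cx (f x), cy (f x), cz (f x)))) => //.
    by move=> x _; rewrite -R3_eta.
  apply: (smooth_on_comp3 U W) => // x Hx; rewrite -R3_eta; exact: HW.
Qed.

Lemma smooth_map_comp {E : NormedModule R_AbsRing} (U : E -> Prop) (W : R3 -> Prop)
    (g : R3 -> R3) (f : E -> R3) :
  open U -> smooth_map U f -> (forall x, U x -> W (f x)) -> smooth_map W g ->
  smooth_map U (fun x => g (f x)).
Proof.
  move=> HU Hf HW [h1 [h2 h3]]; split; [|split];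
    [exact: (smooth_on_comp_map U W (fun y => cx (g y)))
    |exact: (smooth_on_comp_map U W (fun y => cy (g y)))
    |exact: (smooth_on_comp_map U W (fun y => cz (g y)))].
Qed.

Lemma open_preimage {T U : UniformSpace} (D : T -> Prop) (D' : U -> Prop) (f : T -> U) :
  open D -> open D' -> (forall x, D x -> continuous f x) -> open (fun x => D x /\ D' (f x)).
Proof.
  move=> HD HD' Hf x [hx hx']; apply: filter_and; first exact: HD.
  exact: (Hf x hx _ (HD' _ hx')).
Qed.

Definition scale_sphere (k : R) (s : sphere) : sphere :=
  Sphere (k * sph_a s) (scal k (sph_b s)) (k * sph_c s).

Definition smooth_spheres (I : R -> Prop) (s : R -> sphere) : Prop :=
  smooth_on I (fun t => sph_a (s t)) /\ smooth_map I (fun t => sph_b (s t)) /\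
  smooth_on I (fun t => sph_c (s t)).

(** The equation of [s] pulled back by [g] is that of [T s] up to the factor [m], which does not
    depend on the sphere; it therefore passes through derivatives in the parameter of a family, and
    both envelope equations transfer. The last clause keeps different spheres different, equations
    being defined up to a factor. *)
Definition pulls_back_spheres (g : R3 -> R3) (D : R3 -> Prop) (m : R3 -> R)
    (T : sphere -> sphere) : Prop :=
  (forall x, D x -> m x <> 0) /\
  (forall s x, D x -> sphere_eq s (g x) = m x * sphere_eq (T s) x) /\
  (forall s, true_sphere s -> true_sphere (T s)) /\
  (forall I s, open I -> smooth_spheres I s -> smooth_spheres I (fun t => T (s t))) /\
  (forall k s s', T s = scale_sphere k (T s') -> s = scale_sphere k s').

(** One direction of an invertible transformation. The inverse of each generator below is of the
    same kind, so one proof of this half serves for both. *)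
Definition moebius_half (g gi : R3 -> R3) (D D' : R3 -> Prop) : Prop :=
  open D /\ smooth_map D g /\ (forall x, D x -> D' (g x) /\ gi (g x) = x) /\
  exists m T, pulls_back_spheres g D m T.

Definition moebius_pair (g gi : R3 -> R3) (D D' : R3 -> Prop) : Prop :=
  moebius_half g gi D D' /\ moebius_half gi g D' D.

Lemma moebius_half_comp g1 gi1 D1 D1' g2 gi2 D2 D2' :
  moebius_half g1 gi1 D1 D1' -> moebius_half g2 gi2 D2 D2' ->
  moebius_half (fun x => g2 (g1 x)) (fun y => gi1 (gi2 y))
    (fun x => D1 x /\ D2 (g1 x)) (fun y => D2' y /\ D1' (gi2 y)).
Proof.
  move=> [o1 [s1 [i1 [m1 [T1 [a1 [b1 [c1 [d1 f1]]]]]]]]] [o2 [s2 [i2 [m2 [T2 [a2 [b2 [c2 [d2 f2]]]]]]]]].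
  have o : open (fun x => D1 x /\ D2 (g1 x)).
    by apply: open_preimage => // x Hx; exact: smooth_map_continuous Hx.
  split=> //; split.
    apply: (smooth_map_comp _ D2) => //; last by move=> x [].
    by move: s1 => [h1 [h2 h3]]; split; [|split]; (apply: smooth_on_sub; last eassumption); move=> x [].
  split.
    move=> x [h1 h2]; have [k1 k2] := i1 x h1; have [l1 l2] := i2 _ h2; by rewrite l2.
  exists (fun x => m2 (g1 x) * m1 x), (fun s => T1 (T2 s)); split; [|split; [|split; [|split]]].
  - move=> x [h1 h2]; apply: Rmult_integral_contrapositive_currified; [exact: a2|exact: a1].
  - move=> s x [h1 h2]; rewrite b2 // b1 //; ring.
  - by move=> s hs; apply: c1; apply: c2.
  - move=> I s hI hs; apply: (d1 I (fun t => T2 (s t)) hI); exact: d2.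
  - by move=> k s s' h; apply: f2; apply: f1.
Qed.

Lemma moebius_pair_comp g1 gi1 D1 D1' g2 gi2 D2 D2' :
  moebius_pair g1 gi1 D1 D1' -> moebius_pair g2 gi2 D2 D2' ->
  moebius_pair (fun x => g2 (g1 x)) (fun y => gi1 (gi2 y))
    (fun x => D1 x /\ D2 (g1 x)) (fun y => D2' y /\ D1' (gi2 y)).
Proof. by move=> [h1 h1'] [h2 h2']; split; apply: moebius_half_comp. Qed.

Lemma moebius_pair_ext g0 gi D0 D' g (D : R3 -> Prop) :
  (forall x, D x <-> D0 x) -> (forall x, D x -> g x = g0 x) ->
  moebius_pair g0 gi D0 D' -> moebius_pair g gi D D'.
Proof.
  move=> HD Hg [[o [s [i [m [T [a [b [c [d f]]]]]]]]] [o' [s' [i' M']]]]; split.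
    have oD : open D by apply: open_ext o => x; have := HD x; tauto.
    split=> //; split.
      have sg : smooth_map D g0.
        by move: s => [h1 [h2 h3]]; split; [|split]; (apply: smooth_on_sub; last eassumption); move=> x /HD.
      by apply: smooth_map_ext oD _ sg => x /Hg.
    split.
      by move=> x hx; rewrite Hg //; apply: i; apply/HD.
    exists m, T; split; [|split; [|split; [|split]]] => //.
    - by move=> x /HD; exact: a.
    - by move=> s0 x hx; rewrite Hg //; apply: b; apply/HD.
  split=> //; split=> //; split=> //.
  move=> y hy; have [h1 h2] := i' y hy.
  have h3 : D (gi y) by apply/HD.
  by rewrite Hg.
Qed.

Lemma sphere_ext (s s' : sphere) : sph_a s = sph_a s' -> sph_b s = sph_b s' ->
  sph_c s = sph_c s' -> s = s'.
Proof. by case: s => a b c; case: s' => a' b' c' /= -> -> ->. Qed.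

Lemma scale_sphere_inj k s s' : s = scale_sphere k s' <->
  sph_a s = k * sph_a s' /\ cx (sph_b s) = k * cx (sph_b s') /\
  cy (sph_b s) = k * cy (sph_b s') /\ cz (sph_b s) = k * cz (sph_b s') /\
  sph_c s = k * sph_c s'.
Proof.
  split; first by move=> ->.
  by move=> [h1 [h2 [h3 [h4 h5]]]]; apply: sphere_ext => //; apply: R3_eq.
Qed.

Lemma moebius_half_translation (v : R3) :
  moebius_half (fun x => plus x v) (fun x => minus x v) (fun _ => True) (fun _ => True).
Proof.
  have o : open (fun _ : R3 => True) by exact: open_true.
  split=> //; split.
    split; [|split]; rewrite /plus /=; [apply: (smooth_on_ext _ (fun x => cx x + cx v))
      |apply: (smooth_on_ext _ (fun x => cy x + cy v))|apply: (smooth_on_ext _ (fun x => cz x + cz v))] => //;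
      by smooth_tac o.
  split.
    by move=> x _; split=> //; apply: R3_eq; rewrite /minus !coordE; ring.
  exists (fun _ => 1), (fun s => Sphere (sph_a s) (minus (sph_b s) (scal (sph_a s) v))
     (sph_c s - 2 * dot (sph_b s) v + sph_a s * dot v v)); split; [|split; [|split; [|split]]].
  - by move=> x _; lra.
  - by move=> s x _; rewrite /sphere_eq /dot /minus /= !coordE; ring.
  - move=> s; rewrite /true_sphere /dot /minus /= !coordE => h; nra.
  - move=> I s hI [h1 [[h2 [h3 h4]] h5]]; split; [|split; [split; [|split]|]] => /=; rewrite /minus /dot.
    + by [].
    + apply: (smooth_on_ext _ (fun t => cx (sph_b (s t)) + - (sph_a (s t) * cx v))) => //; smooth_tac hI.
    + apply: (smooth_on_ext _ (fun t => cy (sph_b (s t)) + - (sph_a (s t) * cy v))) => //; smooth_tac hI.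
    + apply: (smooth_on_ext _ (fun t => cz (sph_b (s t)) + - (sph_a (s t) * cz v))) => //; smooth_tac hI.
    + smooth_tac hI.
  - move=> k s s' /scale_sphere_inj /=; rewrite /dot /minus !coordE => -[h1 [h2 [h3 [h4 h5]]]].
    apply/scale_sphere_inj; rewrite h1 in h2 h3 h4 h5.
    have e2 : cx (sph_b s) = k * cx (sph_b s') by lra.
    have e3 : cy (sph_b s) = k * cy (sph_b s') by lra.
    have e4 : cz (sph_b s) = k * cz (sph_b s') by lra.
    rewrite e2 e3 e4 in h5 *; repeat split=> //; nra.
Qed.

Lemma moebius_pair_translation (v : R3) :
  moebius_pair (fun x => plus x v) (fun x => minus x v) (fun _ => True) (fun _ => True).
Proof.
  split; first exact: moebius_half_translation.
  have := moebius_half_translation (opp v); rewrite /moebius_half.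
  move=> [o [s [i M]]]; split=> //; split=> //; split=> //.
  by move=> x _; split=> //; apply: R3_eq; rewrite /minus !coordE; ring.
Qed.

Lemma moebius_half_scaling (l : R) : l <> 0 ->
  moebius_half (fun x => scal l x) (fun x => scal (/ l) x) (fun _ => True) (fun _ => True).
Proof.
  move=> hl.
  have o : open (fun _ : R3 => True) by exact: open_true.
  split=> //; split.
    split; [|split]; [apply: (smooth_on_ext _ (fun x => l * cx x))
      |apply: (smooth_on_ext _ (fun x => l * cy x))|apply: (smooth_on_ext _ (fun x => l * cz x))] => //;
      by smooth_tac o.
  split.
    by move=> x _; split=> //; apply: R3_eq; rewrite !coordE; field.
  exists (fun _ => 1), (fun s => Sphere (sph_a s * l ^ 2) (scal l (sph_b s)) (sph_c s));
    split; [|split; [|split; [|split]]].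
  - by move=> x _; lra.
  - by move=> s x _; rewrite /sphere_eq /dot /= !coordE; ring.
  - move=> s; rewrite /true_sphere /dot /= !coordE => h; have := Rsqr_pos_lt l hl; rewrite /Rsqr; nra.
  - move=> I s hI [h1 [[h2 [h3 h4]] h5]]; split; [|split; [split; [|split]|]] => /=.
    + smooth_tac hI.
    + apply: (smooth_on_ext _ (fun t => l * cx (sph_b (s t)))) => //; smooth_tac hI.
    + apply: (smooth_on_ext _ (fun t => l * cy (sph_b (s t)))) => //; smooth_tac hI.
    + apply: (smooth_on_ext _ (fun t => l * cz (sph_b (s t)))) => //; smooth_tac hI.
    + by [].
  - move=> k s s' /scale_sphere_inj /=; rewrite !coordE => -[h1 [h2 [h3 [h4 h5]]]].
    have hl2 : l ^ 2 <> 0 by apply: pow_nonzero.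
    apply/scale_sphere_inj; repeat split=> //.
    + apply: (Rmult_eq_reg_r (l ^ 2)) => //; lra.
    + apply: (Rmult_eq_reg_l l) => //; lra.
    + apply: (Rmult_eq_reg_l l) => //; lra.
    + apply: (Rmult_eq_reg_l l) => //; lra.
Qed.

Lemma moebius_pair_scaling (l : R) : l <> 0 ->
  moebius_pair (fun x => scal l x) (fun x => scal (/ l) x) (fun _ => True) (fun _ => True).
Proof.
  move=> hl; split; first exact: moebius_half_scaling.
  have := moebius_half_scaling (/ l) (Rinv_neq_0_compat _ hl); by rewrite Rinv_inv.
Qed.

Definition matrix_map (u v w : R3) (x : R3) : R3 := (dot x u, dot x v, dot x w).

Lemma moebius_half_isometry (u v w u' v' w' : R3) :
  let M := matrix_map u v w in let N := matrix_map u' v' w' in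
  (forall x y, dot (M x) y = dot x (N y)) -> (forall x, N (M x) = x) -> (forall x, M (N x) = x) ->
  moebius_half M N (fun _ => True) (fun _ => True).
Proof.
  move=> M N adj NM MN.
  have o : open (fun _ : R3 => True) by exact: open_true.
  split=> //; split.
    by split; [|split]; rewrite /M /matrix_map /cx /cy /cz /= /dot; smooth_tac o.
  split=> //.
  exists (fun _ => 1), (fun s => Sphere (sph_a s) (N (sph_b s)) (sph_c s));
    split; [|split; [|split; [|split]]].
  - by move=> x _; lra.
  - move=> s x _; rewrite /sphere_eq /= adj NM.
    have -> : dot (sph_b s) (M x) = dot (N (sph_b s)) x by rewrite -{1}(MN (sph_b s)) adj NM.
    ring.
  - by move=> s; rewrite /true_sphere /= -adj MN.
  - move=> I s hI [h1 [[h2 [h3 h4]] h5]]; split; [|split; [split; [|split]|]] => //=;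
      rewrite /N /matrix_map /cx /cy /cz /= /dot; smooth_tac hI.
  - move=> k s s' /scale_sphere_inj /= [h1 [h2 [h3 [h4 h5]]]].
    have h : sph_b s = scal k (sph_b s').
      rewrite -(MN (sph_b s)) -(MN (sph_b s')).
      have -> : N (sph_b s) = scal k (N (sph_b s')) by apply: R3_eq.
      by apply: R3_eq; rewrite /M /matrix_map /dot /cx /cy /cz /=; rewrite /scal /= /mult /=; ring.
    by apply: sphere_ext.
Qed.

Definition ex : R3 := (1, 0, 0).
Definition ey : R3 := (0, 1, 0).
Definition ez : R3 := (0, 0, 1).

(** The transpose [N] is a left inverse because dot products are preserved. That it is also a right
    inverse is a dimension argument: [y - A (N y)] is orthogonal to the three orthonormal vectors
    [A ex], [A ey], [A ez]. *)
Lemma orthogonal_map_matrix (A : R3 -> R3) : orthogonal_map A ->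
  exists N, moebius_pair A N (fun _ => True) (fun _ => True).
Proof.
  move=> [lin orth].
  pose N := matrix_map (A ex) (A ey) (A ez).
  have Aexp : forall x, A x = plus (plus (scal (cx x) (A ex)) (scal (cy x) (A ey))) (scal (cz x) (A ez)).
    move=> x; rewrite -!(linear_scal A lin) -!(linear_plus A lin); congr A.
    by apply: R3_eq; rewrite !coordE /cx /cy /cz /=; ring.
  have NA : forall x, N (A x) = x.
    by move=> x; rewrite /N /matrix_map !orth; apply: R3_eq; rewrite /dot /ex /ey /ez /cx /cy /cz /=; ring.
  have adj : forall x y, dot (A x) y = dot x (N y).
    move=> x y; rewrite Aexp /N /matrix_map /dot !coordE /cx /cy /cz /=; ring.
  have AN : forall y, A (N y) = y.
    move=> y.
    have := orth ex ex; have := orth ey ey; have := orth ez ez.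
    have := orth ex ey; have := orth ey ez; have := orth ex ez.
    have key := Aexp (N y).
    have ortho : forall x, dot (minus y (A (N y))) (A x) = 0.
      move=> x; have -> : dot (minus y (A (N y))) (A x) = dot (A x) y - dot (A (N y)) (A x).
        by rewrite /dot /minus !coordE; ring.
      rewrite adj orth /dot; ring.
    have := ortho ex; have := ortho ey; have := ortho ez.
    set d := minus y (A (N y)); set u := A ex; set v := A ey; set w := A ez.
    move=> h1 h2 h3 g1 g2 g3 g4 g5 g6.
    have n1 : dot ex ex = 1 by rewrite /dot /ex /cx /cy /cz /=; ring.
    have n2 : dot ey ey = 1 by rewrite /dot /ey /cx /cy /cz /=; ring.
    have n3 : dot ez ez = 1 by rewrite /dot /ez /cx /cy /cz /=; ring.
    have n4 : dot ex ey = 0 by rewrite /dot /ex /ey /cx /cy /cz /=; ring.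
    have n5 : dot ex ez = 0 by rewrite /dot /ex /ez /cx /cy /cz /=; ring.
    have n6 : dot ey ez = 0 by rewrite /dot /ey /ez /cx /cy /cz /=; ring.
    rewrite ?n1 ?n2 ?n3 ?n4 ?n5 ?n6 in g1 g2 g3 g4 g5 g6.
    (* The square of this determinant is the Gram determinant of [u], [v], [w], hence 1; by Cramer's
       rule a vector orthogonal to all three vanishes. *)
    pose det := cx u * (cy v * cz w - cz v * cy w) - cy u * (cx v * cz w - cz v * cx w)
                + cz u * (cx v * cy w - cy v * cx w).
    have det2 : det ^ 2 = 1.
      have -> : det ^ 2 = dot u u * (dot v v * dot w w - dot v w ^ 2)
        - dot u v * (dot u v * dot w w - dot v w * dot u w)
        + dot u w * (dot u v * dot v w - dot v v * dot u w) by rewrite /det /dot; ring.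
      rewrite g1 g2 g3 g4 g5 g6; ring.
    have dx : det * cx d = dot d u * (cy v * cz w - cz v * cy w) + dot d v * (cy w * cz u - cz w * cy u)
        + dot d w * (cy u * cz v - cz u * cy v) by rewrite /det /dot; ring.
    have dy : det * cy d = dot d u * (cz v * cx w - cx v * cz w) + dot d v * (cz w * cx u - cx w * cz u)
        + dot d w * (cz u * cx v - cx u * cz v) by rewrite /det /dot; ring.
    have dz : det * cz d = dot d u * (cx v * cy w - cy v * cx w) + dot d v * (cx w * cy u - cy w * cx u)
        + dot d w * (cx u * cy v - cy u * cx v) by rewrite /det /dot; ring.
    rewrite h1 h2 h3 !Rmult_0_l !Rplus_0_l in dx dy dz.
    have det0 : det <> 0 by move=> h; rewrite h in det2; lra.
    have zx : cx d = 0 by case: (Rmult_integral _ _ dx).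
    have zy : cy d = 0 by case: (Rmult_integral _ _ dy).
    have zz : cz d = 0 by case: (Rmult_integral _ _ dz).
    move: zx zy zz; rewrite /d /minus !coordE => zx zy zz.
    apply: R3_eq; lra.
  pose M := matrix_map (N ex) (N ey) (N ez).
  have AM : forall x, A x = M x.
    move=> x; apply: R3_eq; rewrite /M /matrix_map -!adj /dot /ex /ey /ez /cx /cy /cz /=; ring.
  exists N; apply: (moebius_pair_ext M _ (fun _ => True)) => //.
  have NM : forall x, N (M x) = x by move=> x; rewrite -AM NA.
  have MN : forall x, M (N x) = x by move=> x; rewrite -AM AN.
  have adjM : forall x y, dot (M x) y = dot x (N y) by move=> x y; rewrite -AM adj.
  split; first exact: moebius_half_isometry.
  apply: moebius_half_isometry => // x y.
  by rewrite dot_comm -adjM dot_comm.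
Qed.

Definition inversion (x : R3) : R3 := scal (/ dot x x) x.

Lemma dot_pos (x : R3) : x <> zero -> 0 < dot x x.
Proof.
  move=> hx; have h1 := pow2_ge_0 (cx x); have h2 := pow2_ge_0 (cy x); have h3 := pow2_ge_0 (cz x).
  have hd : dot x x = cx x ^ 2 + cy x ^ 2 + cz x ^ 2 by rewrite /dot; ring.
  case: (Req_dec (dot x x) 0) => [h|]; last lra.
  case: hx; apply: R3_eq; change (cx zero) with 0; change (cy zero) with 0; change (cz zero) with 0; nra.
Qed.

Lemma moebius_half_inversion :
  moebius_half inversion inversion (fun x => x <> zero) (fun x => x <> zero).
Proof.
  have o : open (fun x : R3 => x <> zero).
    move=> x /dot_pos hx.
    have cd : continuous (fun x : R3 => dot x x) x.
      apply: (smooth_on_continuous (fun _ => True)) => //.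
      have o : open (fun _ : R3 => True) by exact: open_true.
      rewrite /dot; smooth_tac o.
    apply: filter_imp (locally_lt (fun _ => 0) _ x (continuous_const _ _) cd hx) => y hy hz.
    by move: hy; rewrite hz /dot /cx /cy /cz /=; rewrite /zero /=; lra.
  have d0 : forall x : R3, x <> zero -> dot x x <> 0 by move=> x /dot_pos; lra.
  have si : smooth_on (fun x : R3 => x <> zero) (fun x => / dot x x).
    by apply: smooth_on_inv => //; rewrite /dot; smooth_tac o.
  split=> //; split.
    split; [|split]; [apply: (smooth_on_ext _ (fun x => / dot x x * cx x))
      |apply: (smooth_on_ext _ (fun x => / dot x x * cy x))|apply: (smooth_on_ext _ (fun x => / dot x x * cz x))] => //;
      smooth_tac o.
  have dd : forall x, x <> zero -> dot (inversion x) (inversion x) = / dot x x.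
    move=> x /d0 hx; rewrite /inversion {1}/dot !coordE; rewrite {5}/dot in hx *; move: hx; rewrite /dot => hx; field; exact hx.
  split.
    move=> x hx; have hx0 := d0 _ hx; split.
      move=> h; have := dd x hx; rewrite h => h'.
      have : / dot x x <> 0 by apply: Rinv_neq_0_compat.
      by rewrite -h'; case; rewrite /dot /cx /cy /cz /= /zero /=; ring.
    rewrite {1}/inversion dd // /inversion; apply: R3_eq; rewrite !coordE; field; exact: hx0.
  exists (fun x => / dot x x), (fun s => Sphere (sph_c s) (sph_b s) (sph_a s));
    split; [|split; [|split; [|split]]].
  - by move=> x hx; apply: Rinv_neq_0_compat; exact: d0.
  - move=> s x hx; rewrite /sphere_eq dd //=.
    have -> : dot (sph_b s) (inversion x) = / dot x x * dot (sph_b s) x.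
      by rewrite /inversion; set k := / dot x x; rewrite /dot !coordE; ring.
    field; exact: d0.
  - by move=> s; rewrite /true_sphere /=; lra.
  - by move=> I s hI [h1 [h2 h5]]; split; [|split].
  - move=> k s s' /scale_sphere_inj /= [h1 [h2 [h3 [h4 h5]]]].
    by apply/scale_sphere_inj.
Qed.

(** Both alternatives of [moebius] factor through the generators: translation by [-a], in the second
    case the unit inversion, then [A], scaling by [lambda] and translation by [b]. *)
Lemma moebius_inverse g D : moebius g D ->
  exists gi D', moebius_pair g gi D D'.
Proof.
  move=> [a [b [l [A [hl [hA H]]]]]].
  have [N pA] := orthogonal_map_matrix A hA.
  have p1 := moebius_pair_translation (opp a).
  have p2 := moebius_pair_scaling l ltac:(lra).
  have p3 := moebius_pair_translation b.
  have lin := proj1 hA.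
  case: H => H.
    have p := moebius_pair_comp _ _ _ _ _ _ _ _ p1 (moebius_pair_comp _ _ _ _ _ _ _ _ pA
      (moebius_pair_comp _ _ _ _ _ _ _ _ p2 p3)).
    do 2 eexists; apply: moebius_pair_ext p.
    - by move=> x; have [h _] := H x; tauto.
    - by move=> x _; have [_ ->] := H x; rewrite plus_comm.
  have pI : moebius_pair inversion inversion (fun x => x <> zero) (fun x => x <> zero).
    by split; exact: moebius_half_inversion.
  have p := moebius_pair_comp _ _ _ _ _ _ _ _ p1 (moebius_pair_comp _ _ _ _ _ _ _ _ pI
      (moebius_pair_comp _ _ _ _ _ _ _ _ pA (moebius_pair_comp _ _ _ _ _ _ _ _ p2 p3))).
  have az : forall x, plus x (opp a) = zero <-> x = a.
    move=> x; split; last by move=> ->; exact: plus_opp_r.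
    move=> h; have := f_equal (fun y => plus y a) h.
    by rewrite -plus_assoc plus_opp_l plus_zero_r plus_zero_l.
  do 2 eexists; apply: moebius_pair_ext p.
  - move=> x; have [h _] := H x; have := az x; tauto.
  - move=> x hx; have [h h'] := H x; rewrite h'; last by apply/h.
    rewrite plus_comm; congr plus; rewrite /inversion (linear_scal A lin) scal_assoc.
    by congr scal.
Qed.

(** * The cyclides as envelopes *)

(** Each pair of antipodal points [(b + sqrt r d) / a], [(b - sqrt r d) / a] of the first sphere
    lies on the second; subtracting the two equations gives [a' b.d = a b'.d]. Three axes determine
    [b'], and one more point determines [c']. *)
Lemma same_sphere_scale_ball (s s' : sphere) : sph_a s <> 0 ->
  true_sphere s -> true_sphere s' -> (forall x, sphere_eq s x = 0 -> sphere_eq s' x = 0) ->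
  exists k, s' = scale_sphere k s.
Proof.
  case: s => a b c; case: s' => a' b' c'; rewrite /true_sphere /sphere_eq /= => ha hs hs' H.
  set r := dot b b - a * c in hs.
  have hr : 0 < sqrt r by exact: sqrt_lt_R0.
  have hr2 : sqrt r * sqrt r = r by apply: sqrt_sqrt; lra.
  have on : forall (d : R3) e, dot d d = 1 -> e * e = 1 ->
      a' * dot (scal (/ a) (plus b (scal (e * sqrt r) d))) (scal (/ a) (plus b (scal (e * sqrt r) d)))
      - 2 * dot b' (scal (/ a) (plus b (scal (e * sqrt r) d))) + c' = 0.
    move=> d e hd he; apply: H.
    have E : a * dot (scal (/ a) (plus b (scal (e * sqrt r) d))) (scal (/ a) (plus b (scal (e * sqrt r) d)))
      - 2 * dot b (scal (/ a) (plus b (scal (e * sqrt r) d))) + c =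
      / a * ((e * e) * (sqrt r * sqrt r) * dot d d - r).
      by rewrite /r /dot !coordE; field.
    rewrite E hr2 hd he; ring.
  have dif : forall d : R3, dot d d = 1 -> a' * dot b d = a * dot b' d.
    move=> d hd; have p1 := on d 1 hd ltac:(ring); have p2 := on d (-1) hd ltac:(ring).
    have E : forall e : R, a' * dot (scal (/ a) (plus b (scal (e * sqrt r) d))) (scal (/ a) (plus b (scal (e * sqrt r) d)))
      - 2 * dot b' (scal (/ a) (plus b (scal (e * sqrt r) d))) + c' =
      a' * / a ^ 2 * (dot b b + e ^ 2 * (sqrt r * sqrt r) * dot d d) - 2 * / a * dot b' b + c'
      + 2 * e * sqrt r * / a ^ 2 * (a' * dot b d - a * dot b' d).
      by move=> e; rewrite /dot !coordE; field.
    rewrite !E in p1 p2.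
    have h : sqrt r * / a ^ 2 * (a' * dot b d - a * dot b' d) = 0 by lra.
    have ha2 : / a ^ 2 <> 0 by apply: Rinv_neq_0_compat; apply: pow_nonzero.
    case: (Rmult_integral _ _ h) => [h'|]; last lra.
    case: (Rmult_integral _ _ h') => //; lra.
  have nx : dot ex ex = 1 by rewrite /dot /ex /cx /cy /cz /=; ring.
  have ny : dot ey ey = 1 by rewrite /dot /ey /cx /cy /cz /=; ring.
  have nz : dot ez ez = 1 by rewrite /dot /ez /cx /cy /cz /=; ring.
  have bx := dif ex nx; have by' := dif ey ny; have bz := dif ez nz.
  have Dx : forall v, dot v ex = cx v by move=> [[? ?] ?]; rewrite /dot /ex /cx /cy /cz /=; ring.
  have Dy : forall v, dot v ey = cy v by move=> [[? ?] ?]; rewrite /dot /ey /cx /cy /cz /=; ring.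
  have Dz : forall v, dot v ez = cz v by move=> [[? ?] ?]; rewrite /dot /ez /cx /cy /cz /=; ring.
  rewrite !Dx in bx; rewrite !Dy in by'; rewrite !Dz in bz.
  exists (a' / a); apply/scale_sphere_inj => /=.
  have fx : cx b' = a' / a * cx b by apply: (Rmult_eq_reg_l a) => //; rewrite -bx; field.
  have fy : cy b' = a' / a * cy b by apply: (Rmult_eq_reg_l a) => //; rewrite -by'; field.
  have fz : cz b' = a' / a * cz b by apply: (Rmult_eq_reg_l a) => //; rewrite -bz; field.
  repeat split=> //; first by field.
  have p1 := on ex 1 nx ltac:(ring).
  have E : a' * dot (scal (/ a) (plus b (scal (1 * sqrt r) ex))) (scal (/ a) (plus b (scal (1 * sqrt r) ex)))
      - 2 * dot b' (scal (/ a) (plus b (scal (1 * sqrt r) ex))) + c' =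
      c' + a' * / a ^ 2 * ((sqrt r * sqrt r) * dot ex ex - dot b b).
    by rewrite /dot !coordE fx fy fz; field.
  rewrite E hr2 nx /r in p1.
  have -> : a' / a * c = a' * / a ^ 2 * (a * c) by field.
  lra.
Qed.

(** A plane cannot coincide with a round sphere: its equation would be a multiple of the round one
    with leading coefficient 0, hence zero. This leaves two planes. *)
Lemma same_sphere_scale (s s' : sphere) : true_sphere s -> true_sphere s' -> same_sphere s s' ->
  exists k, s' = scale_sphere k s.
Proof.
  move=> hs hs' H.
  case: (Req_dec (sph_a s) 0) => ha; last first.
    by apply: same_sphere_scale_ball => // x; rewrite H.
  case: (Req_dec (sph_a s') 0) => ha'; last first.
    have [k hk] := same_sphere_scale_ball s' s ha' hs' hs (fun x h => proj2 (H x) h).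
    have hk0 : k = 0.
      by move: ha; rewrite hk /= => h; case: (Rmult_integral _ _ h).
    by move: hs; rewrite hk hk0 /true_sphere /dot /= !coordE; lra.
  move: s s' ha ha' hs hs' H => [a b c] [a' b' c'] /= -> ->.
  rewrite /true_sphere /same_sphere /sphere_eq /= !Rmult_0_l => hs hs' H.
  have hb : 0 < dot b b by lra.
  have hb' : 0 < dot b' b' by lra.
  (* [b' - k b] is the component of [b'] parallel to the first plane. The line [pt] runs inside that
     plane in this direction; as it stays in the second plane too, the component is orthogonal to
     [b'], so it vanishes. *)
  pose k := dot b b' / dot b b.
  pose pt (t : R) : R3 := plus (scal (c / (2 * dot b b)) b) (scal t (minus b' (scal k b))).
  have on : forall t, 0 * dot (pt t) (pt t) - 2 * dot b (pt t) + c = 0.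
    move=> t.
    have -> : dot b (pt t) = c / (2 * dot b b) * dot b b + t * (dot b b' - k * dot b b).
      by rewrite /pt /minus; set q := c / _; rewrite /dot !coordE; ring.
    rewrite /k; field; lra.
  have on' : forall t, 0 * dot (pt t) (pt t) - 2 * dot b' (pt t) + c' = 0.
    by move=> t; apply/H; rewrite Rmult_0_l -[RHS](on t); ring.
  have E : forall t, dot b' (pt t) = c / (2 * dot b b) * dot b b' + t * (dot b' b' - k * dot b b').
    by move=> t; rewrite /pt /minus; set q := c / _; rewrite /dot !coordE; ring.
  have o0 := on' 0; have o1 := on' 1; rewrite !E in o0 o1.
  have perp : dot b' b' - k * dot b b' = 0 by lra.
  have nul : dot (minus b' (scal k b)) (minus b' (scal k b)) = 0.
    have -> : dot (minus b' (scal k b)) (minus b' (scal k b)) =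
      dot b' b' - k * dot b b' - k * (dot b b' - k * dot b b) by rewrite /minus /dot !coordE; ring.
    rewrite perp /k; field; lra.
  have eb : b' = scal k b.
    have hz : minus b' (scal k b) = zero.
      case: (excluded_middle_informative (minus b' (scal k b) = zero)) => // /dot_pos; lra.
    have := f_equal (fun v => plus v (scal k b)) hz.
    by rewrite /minus -plus_assoc plus_opp_l plus_zero_r plus_zero_l.
  exists k; rewrite /scale_sphere /=; apply: sphere_ext => //=; first ring.
  have -> : k * c = 2 * (c / (2 * dot b b) * dot b b') by rewrite /k; field; lra.
  lra.
Qed.

(** [cyc A] is the discriminant in [t], up to sign, of each of the equations
    [M0 + 2 t y + t^2 M1 = 0] and [N0 + 2 t x - t^2 N1 = 0], which are the two families of spheres
    enveloped by the cyclide: see [cyc3_M] and [cyc3_N]. *)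
Definition cyc_sphere1 (A t : R) : sphere :=
  Sphere (1 / 2 + 2 * A * t ^ 2) (0, - t, 1 / 2 - (1 / 4 + 2 * A) * t ^ 2) (t ^ 2).

Definition cyc_sphere2 (A t : R) : sphere :=
  Sphere (- (1 / 2) + 2 * A * t ^ 2) (- t, 0, 1 / 2 + (2 * A - 1 / 4) * t ^ 2) (- t ^ 2).

Definition cyc_M0 (y : R3) : R := dot y y / 2 - cz y.
Definition cyc_M1 (A : R) (y : R3) : R := 1 + 2 * A * dot y y + (1 / 2 + 4 * A) * cz y.
Definition cyc_N0 (y : R3) : R := - (dot y y / 2) - cz y.
Definition cyc_N1 (A : R) (y : R3) : R := 1 - 2 * A * dot y y + (4 * A - 1 / 2) * cz y.

Lemma cyc_sphere1_eq A t y :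
  sphere_eq (cyc_sphere1 A t) y = cyc_M0 y + 2 * t * cy y + t ^ 2 * cyc_M1 A y.
Proof.
  case: y => [[a b] c]; rewrite /sphere_eq /cyc_sphere1 /cyc_M0 /cyc_M1 /dot /cx /cy /cz /=; field.
Qed.

Lemma cyc_sphere2_eq A t y :
  sphere_eq (cyc_sphere2 A t) y = cyc_N0 y + 2 * t * cx y - t ^ 2 * cyc_N1 A y.
Proof.
  case: y => [[a b] c]; rewrite /sphere_eq /cyc_sphere2 /cyc_N0 /cyc_N1 /dot /cx /cy /cz /=; field.
Qed.

Definition cyc3 (A : R) (y : R3) : R := cyc A (cx y) (cy y) (cz y).

Lemma cyc3_M A y : cyc3 A y = cyc_M0 y * cyc_M1 A y - cy y ^ 2.
Proof. rewrite /cyc3 /cyc /cyc_M0 /cyc_M1 /dot; field. Qed.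

Lemma cyc3_N A y : cyc3 A y = cyc_N0 y * cyc_N1 A y + cx y ^ 2.
Proof. rewrite /cyc3 /cyc /cyc_N0 /cyc_N1 /dot; field. Qed.

Definition box (A : R) (y : R3) : Prop :=
  Rabs (cx y) < box_size A /\ Rabs (cy y) < box_size A /\ Rabs (cz y) < box_size A.

Lemma box_M1 A y : box A y -> 9 / 10 <= cyc_M1 A y /\ 9 / 10 <= cyc_N1 A y.
Proof.
  have [He HA] := box_size_bounds A; rewrite /box /cyc_M1 /cyc_N1 /dot.
  move: (box_size A) He HA => e He HA [hx [hy hz]].
  have xa := small_mul _ _ _ hx HA; have ya := small_mul _ _ _ hy HA; have za := small_mul _ _ _ hz HA.
  move/Rabs_lt_iff: hx => hx; move/Rabs_lt_iff: hy => hy; move/Rabs_lt_iff: hz => hz.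
  have qx : -1 / 2000 <= (A * cx y) * cx y <= 1 / 2000 by split; nra.
  have qy : -1 / 2000 <= (A * cy y) * cy y <= 1 / 2000 by split; nra.
  have qz : -1 / 2000 <= (A * cz y) * cz y <= 1 / 2000 by split; nra.
  by split; lra.
Qed.

Lemma open_box A : open (box A).
Proof.
  have o : open (fun _ : R3 => True) by exact: open_true.
  have c : forall l : R3 -> R, is_linear l -> forall y, continuous (fun y => Rabs (l y)) y.
    move=> l hl y; apply: (continuous_comp l Rabs); last exact: continuous_Rabs.
    apply: filterdiff_continuous; exact: ex_filterdiff_linear.
  move=> y [h1 [h2 h3]]; apply: filter_and; last apply: filter_and;
    apply: locally_lt => //; try exact: continuous_const; apply: c;
    [exact: is_linear_cx|exact: is_linear_cy|exact: is_linear_cz].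
Qed.

Lemma box_0 A : box A (0, 0, 0).
Proof. by rewrite /box /cx /cy /cz /= Rabs_R0; have [] := box_size_bounds A; lra. Qed.

(** The touching spheres have parameters [- y / M1] and [x / N1]. In the box the denominators are at
    least 9/10, so the factor 2 leaves room, while the range is small enough for the spheres to be
    real and distinct. *)
Definition in_range A t := in_interval (Finite (- (2 * box_size A))) (Finite (2 * box_size A)) t.

Lemma open_interval (a b : R) : open (in_interval (Finite a) (Finite b)).
Proof. apply: open_and; [exact: open_gt|exact: open_lt]. Qed.

Lemma range_disc A t : in_range A t ->
  -1 / 4 <= 2 * A * t ^ 2 <= 1 / 4 /\ 0 <= t ^ 2 <= 1 / 4.
Proof.
  move=> [/= h1 h2]; have [He HA] := box_size_bounds A.
  have ht : Rabs (t / 2) < box_size A by apply/Rabs_lt_iff; lra.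
  have h := small_mul _ _ _ ht HA.
  have q : -1 / 1000 <= (A * (t / 2)) * t <= 1 / 1000 by split; nra.
  split; last by split; nra.
  have -> : 2 * A * t ^ 2 = 4 * ((A * (t / 2)) * t) by field.
  lra.
Qed.

Lemma cyc_sphere1_true A t : in_range A t -> true_sphere (cyc_sphere1 A t).
Proof.
  move/range_disc => [h1 h2]; rewrite /true_sphere.
  have -> : dot (sph_b (cyc_sphere1 A t)) (sph_b (cyc_sphere1 A t)) - sph_a (cyc_sphere1 A t) * sph_c (cyc_sphere1 A t)
    = (1 / 2 + (1 / 4 - 2 * A) * t ^ 2) ^ 2.
    by rewrite /cyc_sphere1 /dot /cx /cy /cz /=; field.
  apply: pow_lt; lra.
Qed.

Lemma cyc_sphere2_true A t : in_range A t -> true_sphere (cyc_sphere2 A t).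
Proof.
  move/range_disc => [h1 h2]; rewrite /true_sphere.
  have -> : dot (sph_b (cyc_sphere2 A t)) (sph_b (cyc_sphere2 A t)) - sph_a (cyc_sphere2 A t) * sph_c (cyc_sphere2 A t)
    = (1 / 2 + (1 / 4 + 2 * A) * t ^ 2) ^ 2.
    by rewrite /cyc_sphere2 /dot /cx /cy /cz /=; field.
  apply: pow_lt; lra.
Qed.

Lemma is_linear_idR : is_linear (fun t : R => t).
Proof. exact: is_linear_id. Qed.

Ltac smooth_R HU :=
  repeat (first
    [ assumption | exact: (smooth_on_const _ _ HU)
    | exact: (smooth_on_linear _ _ HU is_linear_idR)
    | apply: (smooth_on_plus _ _ _ HU) | apply: (smooth_on_minus _ _ _ HU)
    | apply: (smooth_on_mult _ _ _ HU) | apply: (smooth_on_opp _ _ HU)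
    | apply: (smooth_on_pow _ _ _ HU)  ]).

Lemma cyc_sphere1_smooth A (I : R -> Prop) : open I -> smooth_spheres I (cyc_sphere1 A).
Proof.
  move=> o; rewrite /smooth_spheres /smooth_map /cyc_sphere1 /cx /cy /cz /=.
  split; [|split; [split; [|split]|]]; rewrite /Rdiv; smooth_R o.
Qed.

Lemma cyc_sphere2_smooth A (I : R -> Prop) : open I -> smooth_spheres I (cyc_sphere2 A).
Proof.
  move=> o; rewrite /smooth_spheres /smooth_map /cyc_sphere2 /cx /cy /cz /=.
  split; [|split; [split; [|split]|]]; rewrite /Rdiv; smooth_R o.
Qed.

Lemma Derive_cyc_sphere1 A t y :
  Derive (fun t' => sphere_eq (cyc_sphere1 A t') y) t = 2 * cy y + 2 * t * cyc_M1 A y.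
Proof.
  apply: is_derive_unique.
  apply: (is_derive_ext (fun t' => cyc_M0 y + 2 * t' * cy y + t' ^ 2 * cyc_M1 A y)).
    by move=> t'; rewrite cyc_sphere1_eq.
  auto_derive => //; ring.
Qed.

Lemma Derive_cyc_sphere2 A t y :
  Derive (fun t' => sphere_eq (cyc_sphere2 A t') y) t = 2 * cx y - 2 * t * cyc_N1 A y.
Proof.
  apply: is_derive_unique.
  apply: (is_derive_ext (fun t' => cyc_N0 y + 2 * t' * cx y - t' ^ 2 * cyc_N1 A y)).
    by move=> t'; rewrite cyc_sphere2_eq.
  auto_derive => //; ring.
Qed.

(** * Transport of the pencil by the Moebius transformation *)

Section Pullback.
Variables (g gi : R3 -> R3) (D D' : R3 -> Prop) (p : R3).
Hypothesis hpair : moebius_pair g gi D D'.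
Hypotheses (Dp : D p) (gp : g p = (0, 0, 0)).

Lemma pb_D'0 : D' (0, 0, 0).
Proof. have [[_ [_ [h _]]] _] := hpair; have [] := h p Dp; by rewrite gp. Qed.

Lemma pb_open : open D. Proof. by have [[]] := hpair. Qed.
Lemma pb_open' : open D'. Proof. by have [_ []] := hpair. Qed.
Lemma pb_smooth : smooth_map D g. Proof. by have [[_ []]] := hpair. Qed.
Lemma pb_smooth' : smooth_map D' gi. Proof. by have [_ [_ []]] := hpair. Qed.
Lemma pb_gK x : D x -> D' (g x) /\ gi (g x) = x.
Proof. by have [[_ [_ [h _]]] _] := hpair; exact: h. Qed.
Lemma pb_giK y : D' y -> D (gi y) /\ g (gi y) = y.
Proof. by have [_ [_ [_ [h _]]]] := hpair; exact: h. Qed.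
Lemma pb_cont x : D x -> continuous g x.
Proof. move=> h; exact: smooth_map_continuous pb_smooth h. Qed.
Lemma pb_cont_xy x : D x -> continuous (fun x => (cx (g x), cy (g x)) : R2) x.
Proof.
  move=> hD P [e He]; have [s1 [s2 _]] := pb_smooth.
  have h1 := smooth_on_continuous _ _ _ s1 hD _ (locally_ball _ e).
  have h2 := smooth_on_continuous _ _ _ s2 hD _ (locally_ball _ e).
  rewrite /filtermap in h1 h2 *; apply: filter_imp (filter_and _ _ h1 h2) => y [l1 l2]; exact: He.
Qed.
Lemma pb_cont' y : D' y -> continuous gi y.
Proof. move=> h; exact: smooth_map_continuous pb_smooth' h. Qed.

(** Cutting by the box keeps only the sheet through the origin, which is a graph; regularity is then
    immediate. *)
Definition cyclide (A : R) (x : R3) : Prop := D x /\ box A (g x) /\ cyc3 A (g x) = 0.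

Definition chart_dom (A : R) (x : R3) : Prop := D x /\ box A (g x).

Lemma open_chart_dom A : open (chart_dom A).
Proof. apply: open_preimage; [exact: pb_open|exact: open_box|exact: pb_cont]. Qed.

Lemma cycF_slice_open A : open (fun w : R2 => cyc_dom (A, w)).
Proof.
  move=> w hw.
  have c : continuous (fun w : R2 => (A, w) : R * R2) w.
    move=> P [e He]; exists e => w' hw'; apply: He; split=> //=; exact: ball_center.
  exact: (c _ (open_cyc_dom _ hw)).
Qed.

Lemma cycF_slice_smooth A : smooth_on (fun w : R2 => cyc_dom (A, w)) (fun w => cycF (A, w)).
Proof.
  have o := cycF_slice_open A.
  apply: (smooth_on_ext _ (fun w : R2 => cycF (A, (fst w, snd w))) _ o).
    by move=> [x y].
  apply: (smooth_on_comp3' _ cyc_dom cycF (fun _ => A) fst snd o).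
  - exact: smooth_on_const.
  - apply: smooth_on_linear => //; exact: is_linear_fst.
  - apply: smooth_on_linear => //; exact: is_linear_snd.
  - by move=> [x y].
  - exact: cycF_smooth.
Qed.

Lemma cyclide_graphE A x : chart_dom A x ->
  (cyclide A x <-> cz (g x) = cycF (A, (cx (g x), cy (g x)))).
Proof.
  move=> [hD [hx [hy hz]]]; have hd : cyc_dom (A, (cx (g x), cy (g x))) by [].
  split.
    by move=> [_ [_ h]]; exact: cycF_unique.
  by move=> h; split=> //; split=> //; rewrite /cyc3 h; have [] := cycF_spec A _ _ hd.
Qed.

Lemma chart_dom_p A : chart_dom A p.
Proof. split=> //; rewrite gp; exact: box_0. Qed.

Lemma cyclide_graph_at A : graph_at g p (cyclide A) (fun w => cycF (A, w)).
Proof.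
  split.
    exists (fun w : R2 => cyc_dom (A, w)); split; [exact: cycF_slice_open|split].
      exact: cyc_dom_0.
    exact: cycF_slice_smooth.
  apply: filter_imp (open_chart_dom A _ (chart_dom_p A)) => x; exact: cyclide_graphE.
Qed.

Definition lift (A : R) (w : R2) : R3 := (fst w, snd w, cycF (A, w)).

Lemma lift_smooth A : smooth_map (fun w : R2 => cyc_dom (A, w)) (lift A).
Proof.
  have o := cycF_slice_open A.
  split; [|split]; rewrite /lift /cx /cy /cz /=.
  - apply: smooth_on_linear => //; exact: is_linear_fst.
  - apply: smooth_on_linear => //; exact: is_linear_snd.
  - exact: cycF_slice_smooth.
Qed.

Lemma cyclide_surface A : smooth_surface (cyclide A).
Proof.
  move=> q hq.
  pose W (w : R2) := cyc_dom (A, w) /\ D' (lift A w).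
  have oW : open W.
    apply: open_preimage; [exact: cycF_slice_open|exact: pb_open'|].
    move=> w hw; exact: (smooth_map_continuous _ _ _ (lift_smooth A) hw).
  exists W, (chart_dom A), (fun w => gi (lift A w)), (fun x => (cx (g x), cy (g x))).
  have gr : forall w, W w -> g (gi (lift A w)) = lift A w by move=> w [_ /pb_giK []].
  have bx : forall w, W w -> box A (lift A w).
    by move=> [x y] [h _]; have [k _] := cycF_spec A x y h; case: h.
  have sr : smooth_map W (fun w => gi (lift A w)).
    apply: (smooth_map_comp W D') => //; [|by move=> w []|exact: pb_smooth'].
    by have [h1 [h2 h3]] := lift_smooth A; split; [|split]; (apply: smooth_on_sub; last eassumption); move=> w [].
  split=> //; split; first exact: open_chart_dom.
  split; first by case: hq => h1 [h2 _].
  split=> //; split; [|split].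
  - move=> w hw; have hc : chart_dom A (gi (lift A w)).
      by case: (hw) => _ /pb_giK [h _]; split=> //; rewrite gr //; exact: bx.
    split; [|split=> //].
      apply/cyclide_graphE => //; rewrite gr //; by case: w {hw hc}.
    rewrite gr //; by case: w {hw hc}.
  - move=> x hx hcx.
    have hz := proj1 (cyclide_graphE A x hcx) hx.
    have hl : lift A (cx (g x), cy (g x)) = g x.
      by rewrite /lift /= -hz -R3_eta.
    case: hcx => hD [b1 [b2 b3]]; have [k1 k2] := pb_gK x hD.
    split; [|split].
    + by split; [|rewrite hl].
    + by rewrite hl.
    + have c := pb_cont_xy x hD.
      apply: filterlim_filter_le_1 c; exact: filter_le_within.
  - move=> w v hw hv.
    have hD : D (gi (lift A w)) by have [_ /pb_giK []] := hw.
    (* The first two coordinates of [g] undo the chart. If the chart had derivative zero along [v],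
       so would the map [t => w + t v], whence [v = 0]. *)
    have key : forall c : R3 -> R, is_linear c -> smooth_on D (fun x => c (g x)) ->
       is_derive (fun t : R => c (g (gi (lift A (plus w (scal t v)))))) 0 0.
      move=> c lc sc.
      have [l hl] := smooth_on_diff _ _ _ sc hD.
      have lz : l zero = 0.
        by rewrite -(scal_zero_r (0 : R_AbsRing)) (linear_scal l (proj1 hl)) /scal /= /mult /= Rmult_0_l.
      have hl' : filterdiff (fun x => c (g x)) (locally (gi (lift A (plus w (scal (0 : R) v))))) l.
        by rewrite line_0.
      have := filterdiff_derive_comp (fun t : R => gi (lift A (plus w (scal t v)))) _ _ _ _ hv hl'.
      by rewrite lz.
    have Wt : locally 0 (fun t : R => W (plus w (scal t v))).
      have c := ex_derive_continuous _ _ (ex_intro _ _ (is_derive_line v w)).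
      by rewrite /continuous line_0 in c; exact: (c _ (oW _ hw)).
    have [s1 [s2 _]] := pb_smooth.
    have k1 := key cx is_linear_cx s1; have k2 := key cy is_linear_cy s2.
    have d1 : is_derive (fun t : R => fst w + t * fst v) 0 0.
      apply: is_derive_ext_loc k1; apply: filter_imp Wt => t ht; by rewrite gr.
    have d2 : is_derive (fun t : R => snd w + t * snd v) 0 0.
      apply: is_derive_ext_loc k2; apply: filter_imp Wt => t ht; by rewrite gr.
    have f1 : is_derive (fun t : R => fst w + t * fst v) 0 (fst v) by auto_derive => //; ring.
    have f2 : is_derive (fun t : R => snd w + t * snd v) 0 (snd v) by auto_derive => //; ring.
    have e1 := is_derive_unique _ _ _ d1; rewrite (is_derive_unique _ _ _ f1) in e1.
    have e2 := is_derive_unique _ _ _ d2; rewrite (is_derive_unique _ _ _ f2) in e2.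
    by case: v e1 e2 {hv key Wt k1 k2 d1 d2 f1 f2} => [a b] /= -> ->.
Qed.

(** An identity between pulled back spheres can be read only at points of the image [D'], which need
    not be all of space; test points are therefore taken near the origin. *)
Lemma near0_D' : exists e, 0 < e /\ forall y : R3, Rabs (cx y) < e -> Rabs (cy y) < e -> Rabs (cz y) < e -> D' y.
Proof.
  have [e He] := pb_open' _ pb_D'0; exists e; split; first exact: cond_pos.
  move=> y h1 h2 h3; apply: He; split; [split|].
  - by change (Rabs (cx y - 0) < e); rewrite Rminus_0_r.
  - by change (Rabs (cy y - 0) < e); rewrite Rminus_0_r.
  - by change (Rabs (cz y - 0) < e); rewrite Rminus_0_r.
Qed.

Lemma cyclide_dupin A : dupin_cyclide (cyclide A).
Proof.
  split; first exact: cyclide_surface.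
  have [[_ [_ [_ [m [T [mn [mT [trT [smT prT]]]]]]]]] _] := hpair.
  have oI := open_interval (- (2 * box_size A)) (2 * box_size A).
  have [He HA] := box_size_bounds A.
  exists (Finite (- (2 * box_size A))), (Finite (2 * box_size A)), (fun t => T (cyc_sphere1 A t)).
  exists (Finite (- (2 * box_size A))), (Finite (2 * box_size A)), (fun t => T (cyc_sphere2 A t)).
  have DT : forall (s : R -> sphere) x t, D x ->
      Derive (fun t' => sphere_eq (s t') (g x)) t = m x * Derive (fun t' => sphere_eq (T (s t')) x) t.
    move=> s x t hx; rewrite -Derive_scal; apply: Derive_ext => t'; exact: mT.
  have imm : forall (s : R -> sphere) t l,
      (forall x, Derive (fun t' => sphere_eq (T (s t')) x) t = l * sphere_eq (T (s t)) x) ->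
      forall y, D' y -> Derive (fun t' => sphere_eq (s t') y) t = l * sphere_eq (s t) y.
    move=> s t l H y hy; have [k1 k2] := pb_giK y hy.
    have E := mT (s t) (gi y) k1; have E' := DT s (gi y) t k1; rewrite k2 in E E'.
    rewrite E E' H; ring.
  have [e [epos De]] := near0_D'.
  have e2 : Rabs (e / 2) < e by rewrite Rabs_pos_eq; lra.
  have e2' : Rabs (- (e / 2)) < e by rewrite Rabs_Ropp.
  have e0 : Rabs 0 < e by rewrite Rabs_R0.
  split; [|split].
  - have [h1 [h2 h3]] := smT _ _ oI (cyc_sphere1_smooth A _ oI).
    split=> //; split=> //; split=> //; split.
      by move=> t ht; apply: trT; exact: cyc_sphere1_true.
    (* Proportionality is tested at the origin and at two opposite points of the [y]-axis. The odd
       part gives [l t = 1], the origin gives [2 t = l t^2 = t]; so [t = 0], a contradiction. The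
       second family is treated likewise on the [x]-axis. *)
    move=> t ht [l hl]; have I1 := imm _ _ _ hl.
    have y0 := I1 (0, 0, 0) pb_D'0.
    have y1 := I1 (0, e / 2, 0) (De (0, e / 2, 0) e0 e2 e0).
    have y2 := I1 (0, - (e / 2), 0) (De (0, - (e / 2), 0) e0 e2' e0).
    rewrite !Derive_cyc_sphere1 !cyc_sphere1_eq /cyc_M0 /cyc_M1 /dot /cx /cy /cz /= in y0 y1 y2.
    have z1 : 2 * t = l * (t ^ 2) by lra.
    have z2 : e * (l * t - 1) = 0 by lra.
    case: (Rmult_integral _ _ z2) => [|z3]; first lra.
    have z4 : 2 * t = t by rewrite {2}(_ : t = t * 1); [rewrite -(Rminus_diag_uniq _ _ z3) z1; ring|ring].
    have t0 : t = 0 by lra.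
    rewrite t0 in z3; lra.
  - have [h1 [h2 h3]] := smT _ _ oI (cyc_sphere2_smooth A _ oI).
    split=> //; split=> //; split=> //; split.
      by move=> t ht; apply: trT; exact: cyc_sphere2_true.
    move=> t ht [l hl]; have I1 := imm _ _ _ hl.
    have y0 := I1 (0, 0, 0) pb_D'0.
    have y1 := I1 (e / 2, 0, 0) (De (e / 2, 0, 0) e2 e0 e0).
    have y2 := I1 (- (e / 2), 0, 0) (De (- (e / 2), 0, 0) e2' e0 e0).
    rewrite !Derive_cyc_sphere2 !cyc_sphere2_eq /cyc_N0 /cyc_N1 /dot /cx /cy /cz /= in y0 y1 y2.
    have z1 : 2 * t = l * (t ^ 2) by lra.
    have z2 : e * (l * t - 1) = 0 by lra.
    case: (Rmult_integral _ _ z2) => [|z3]; first lra.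
    have z4 : 2 * t = t by rewrite {2}(_ : t = t * 1); [rewrite -(Rminus_diag_uniq _ _ z3) z1; ring|ring].
    have t0 : t = 0 by lra.
    rewrite t0 in z3; lra.
  - move=> q hq.
    exists (chart_dom A), (fun x => - cy (g x) / cyc_M1 A (g x)), (fun x => cx (g x) / cyc_N1 A (g x)).
    have oC := open_chart_dom A.
    have [s1 [s2 s3]] : smooth_map (chart_dom A) g.
      by have [s1 [s2 s3]] := pb_smooth; split; [|split]; (apply: smooth_on_sub; last eassumption); move=> x [].
    split=> //; split; first by case: hq => h1 [h2 _].
    split; [|split].
    + apply: smooth_on_div => //.
      * move=> x [_ /box_M1]; lra.
      * smooth_tac oC.
      * rewrite /cyc_M1 /dot /Rdiv; smooth_tac oC.
    + apply: smooth_on_div => //.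
      * move=> x [_ /box_M1]; lra.
      * rewrite /cyc_N1 /dot /Rdiv; smooth_tac oC.
    + move=> x [hD hB] [_ [_ hx]].
      have [m1 n1] := box_M1 A _ hB; case: (hB) => bx [by' bz].
      have r1 : in_range A (- cy (g x) / cyc_M1 A (g x)).
        have h : Rabs (- cy (g x) / cyc_M1 A (g x)) < 2 * box_size A.
          rewrite /Rdiv Rabs_mult Rabs_Ropp Rabs_inv (Rabs_pos_eq (cyc_M1 _ _)); last lra.
          apply: (Rmult_lt_reg_r (cyc_M1 A (g x))); first lra.
          rewrite Rmult_assoc Rinv_l; [nra|lra].
        by move/Rabs_lt_iff: h => [h1 h2]; split.
      have r2 : in_range A (cx (g x) / cyc_N1 A (g x)).
        have h : Rabs (cx (g x) / cyc_N1 A (g x)) < 2 * box_size A.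
          rewrite /Rdiv Rabs_mult Rabs_inv (Rabs_pos_eq (cyc_N1 _ _)); last lra.
          apply: (Rmult_lt_reg_r (cyc_N1 A (g x))); first lra.
          rewrite Rmult_assoc Rinv_l; [nra|lra].
        by move/Rabs_lt_iff: h => [h1 h2]; split.
      have env : forall s t, sphere_eq (s t) (g x) = 0 -> Derive (fun t' => sphere_eq (s t') (g x)) t = 0 ->
          envelope_eqs (fun t => T (s t)) t x.
        move=> s t E1 E2; have mx := mn x hD; split.
          by rewrite mT // in E1; case: (Rmult_integral _ _ E1).
        by rewrite DT // in E2; case: (Rmult_integral _ _ E2).
      split=> //; split.
        apply: env; rewrite ?Derive_cyc_sphere1 ?cyc_sphere1_eq; last by field; lra.
        have hx1 := hx; rewrite cyc3_M in hx1.
        have -> : cyc_M0 (g x) = cy (g x) ^ 2 / cyc_M1 A (g x).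
          by apply: (Rmult_eq_reg_r (cyc_M1 A (g x))); [rewrite /Rdiv Rmult_assoc Rinv_l; lra|lra].
        field; lra.
      split=> //; split.
        apply: env; rewrite ?Derive_cyc_sphere2 ?cyc_sphere2_eq; last by field; lra.
        have hx1 := hx; rewrite cyc3_N in hx1.
        have -> : cyc_N0 (g x) = - cx (g x) ^ 2 / cyc_N1 A (g x).
          by apply: (Rmult_eq_reg_r (cyc_N1 A (g x))); [rewrite /Rdiv Rmult_assoc Rinv_l; lra|lra].
        field; lra.
      move=> hss.
      (* In this range the leading coefficients of the two spheres have opposite signs and their
         [z]-coefficients are both positive, so no factor [k] can exist. *)
      have [k hk] := same_sphere_scale _ _ (trT _ (cyc_sphere1_true _ _ r1)) (trT _ (cyc_sphere2_true _ _ r2)) hss.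
      have := prT _ _ _ hk => /scale_sphere_inj; rewrite /cyc_sphere1 /cyc_sphere2 /cx /cy /cz /=.
      move: r1 r2 => /range_disc; set t1 := - _ / _ => -[d1 d1'] /range_disc; set t2 := _ / cyc_N1 _ _ => -[d2 d2'].
      move=> [k1 [_ [_ [k2 _]]]].
      have d1'' : t1 * (t1 * 1) = t1 ^ 2 by ring.
      have d2'' : t2 * (t2 * 1) = t2 ^ 2 by ring.
      rewrite d1'' d2'' in k1 k2.
      nra.
Qed.

End Pullback.

Lemma locally_line (c s : R) (P : R2 -> Prop) : locally ((0, 0) : R2) P ->
  locally 0 (fun t : R => P (t * c, t * s)).
Proof.
  have Hc : continuous (fun t : R => scal t ((c, s) : R2)) 0.
    by apply: filterdiff_continuous; apply: ex_filterdiff_linear; exact: is_linear_scal_l.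
  rewrite /continuous (scal_zero_l ((c, s) : R2)) in Hc => H; exact: (Hc _ H).
Qed.

Lemma smooth_near_line2 (c s : R) (f : R2 -> R) : smooth_near ((0, 0) : R2) f ->
  smooth_near (0 : R) (fun t : R => f (t * c, t * s)).
Proof. exact: (smooth_near_line f ((c, s) : R2)). Qed.

Lemma cycF_line (A c s : R) i : c ^ 2 + s ^ 2 = 1 -> (i <= 4)%nat ->
  Derive_n (fun t => cycF (A, (t * c, t * s))) i 0 =
  match i with 2 => (c ^ 2 - s ^ 2) / 2 | 4 => 4 * A * (c * s) ^ 2 + (c ^ 2 - s ^ 2) / 8 | _ => 0 end
  * INR (fact i).
Proof.
  move=> hcs hi.
  refine (Derive_n_of_expansion _ 4 (fun j => match j with 2 => (c ^ 2 - s ^ 2) / 2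
      | 4 => 4 * A * (c * s) ^ 2 + (c ^ 2 - s ^ 2) / 8 | _ => 0 end)
      (1000 * (1 + Rabs A) ^ 2) _ _ i hi).
    apply: (smooth_near_line2 c s (fun w => cycF (A, w))).
    exists (fun w : R2 => cyc_dom (A, w)); split; [exact: cycF_slice_open|split].
      exact: cyc_dom_0.
    exact: cycF_slice_smooth.
  have L := locally_line c s _ (cycF_slice_open A _ (cyc_dom_0 A)).
  have B := locally_ball (0 : R) (mkposreal 1 Rlt_0_1).
  apply: filter_imp (filter_and _ _ L B) => t [hd hb].
  have ht : Rabs t < 1.
    have : Rabs (t - 0) < 1 by exact: hb.
    by rewrite Rminus_0_r.
  have := cycF_order4 A _ _ hd.
  have -> : (t * c) ^ 2 + (t * s) ^ 2 = t ^ 2 by rewrite -[RHS]Rmult_1_r -hcs; ring.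
  have -> : cycF (A, (t * c, t * s)) - ((t * c) ^ 2 - (t * s) ^ 2) / 2 -
    (A * 4 * (t * c) ^ 2 * (t * s) ^ 2 + t ^ 2 * ((t * c) ^ 2 - (t * s) ^ 2) / 8) =
    cycF (A, (t * c, t * s)) -
    sum_f_R0 (fun j => match j with 2 => (c ^ 2 - s ^ 2) / 2
      | 4 => 4 * A * (c * s) ^ 2 + (c ^ 2 - s ^ 2) / 8 | _ => 0 end * t ^ j) 4 by rewrite /=; field.
  move=> h; apply: Rle_trans h _; apply: Rmult_le_compat_l.
    have := pow2_ge_0 (1 + Rabs A); lra.
  have -> : (t ^ 2) ^ 3 = Rabs t ^ 6 by rewrite -(pow2_abs t); ring.
  have h0 := Rabs_pos t; have h5 : 0 <= Rabs t ^ 5 by apply: pow_le.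
  have -> : Rabs t ^ 6 = Rabs t * Rabs t ^ 5 by ring.
  nra.
Qed.

Lemma line_jet3 (f : R2 -> R) (th1 th2 c s K : R) i : smooth_near ((0, 0) : R2) f ->
  locally ((0, 0) : R2) (fun w : R2 => let (x, y) := w in
    Rabs (f (x, y) - ((x ^ 2 - y ^ 2) / 2 + (th1 * x ^ 3 + th2 * y ^ 3) / 6))
    <= K * (x ^ 2 + y ^ 2) ^ 2) ->
  c ^ 2 + s ^ 2 = 1 -> (i <= 3)%nat ->
  Derive_n (fun t => f (t * c, t * s)) i 0 =
  match i with 2 => (c ^ 2 - s ^ 2) / 2 | 3 => (th1 * c ^ 3 + th2 * s ^ 3) / 6 | _ => 0 end
  * INR (fact i).
Proof.
  move=> hf hK hcs hi.
  refine (Derive_n_of_expansion _ 3 (fun j => match j with 2 => (c ^ 2 - s ^ 2) / 2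
      | 3 => (th1 * c ^ 3 + th2 * s ^ 3) / 6 | _ => 0 end) K _ _ i hi).
    exact: smooth_near_line2.
  apply: filter_imp (locally_line c s _ hK) => t.
  have -> : (t * c) ^ 2 + (t * s) ^ 2 = t ^ 2 by rewrite -[RHS]Rmult_1_r -hcs; ring.
  have -> : (t ^ 2) ^ 2 = Rabs t ^ 4 by rewrite -(pow2_abs t); ring.
  move=> h; apply: Rle_trans h; right; congr Rabs; rewrite /=; field.
Qed.

(** * Germs of graphs at the base point, and the family of cyclides *)

Section Family.
Variables (g gi : R3 -> R3) (D D' : R3 -> Prop) (p : R3).
Hypothesis hpair : moebius_pair g gi D D'.
Hypotheses (Dp : D p) (gp : g p = (0, 0, 0)).

Lemma gi_0 : gi (0, 0, 0) = p.
Proof. rewrite -gp; exact: (proj2 (pb_gK _ _ _ _ hpair p Dp)). Qed.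

Lemma graph_at_0 (S : R3 -> Prop) f : graph_at g p S f -> S p -> f (0, 0) = 0.
Proof.
  move=> [_ h] hp; have := proj1 (locally_singleton _ _ h) hp.
  by rewrite gp /cx /cy /cz /= => <-.
Qed.

Lemma smooth_near_continuous {E : NormedModule R_AbsRing} (f : E -> R) x :
  smooth_near x f -> continuous f x.
Proof. move=> [U [_ [hx hf]]]; exact: smooth_on_continuous hf hx. Qed.

(** [graph_at] speaks of points of space near [p]; composing with [gi] and the graph map, both
    continuous, restates it over the plane near the origin. *)
Lemma graph_lift_locally (S : R3 -> Prop) f (P : R3 -> Prop) : graph_at g p S f -> S p -> locally p P ->
  locally ((0, 0) : R2) (fun w : R2 => let x := gi (fst w, snd w, f w) in
     D' (fst w, snd w, f w) /\ D x /\ g x = (fst w, snd w, f w) /\ S x /\ P x).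
Proof.
  move=> hg hp hP; have f0 := graph_at_0 _ _ hg hp; case: hg => sf hS.
  have cl : continuous (fun w : R2 => (fst w, snd w, f w) : R3) (0, 0).
    apply: continuous_R3; rewrite /cx /cy /cz /=.
    - exact: continuous_fst.
    - exact: continuous_snd.
    - exact: smooth_near_continuous.
  have D0 := pb_D'0 _ _ _ _ _ hpair Dp gp.
  have lD := pb_open' _ _ _ _ hpair _ D0.
  have cgi := pb_cont' _ _ _ _ hpair _ D0.
  have h1 : locally ((0, 0) : R2) (fun w : R2 => D' (fst w, snd w, f w)).
    by rewrite /continuous /= f0 in cl; exact: (cl _ lD).
  have h2 : locally ((0, 0) : R2) (fun w : R2 => let x := gi (fst w, snd w, f w) in
      (S x <-> cz (g x) = f (cx (g x), cy (g x))) /\ P x).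
    rewrite /continuous gi_0 in cgi; rewrite /continuous /= f0 in cl.
    exact: (cl _ (cgi _ (filter_and _ _ hS hP))).
  apply: filter_imp (filter_and _ _ h1 h2) => -[x y] [hD' [hSx hPx]] /=.
  have [k1 k2] := pb_giK _ _ _ _ hpair _ hD'.
  split=> //; split=> //; split=> //; split=> //.
  by apply/hSx; rewrite k2.
Qed.

Lemma graph_at_unique (S : R3 -> Prop) f h : graph_at g p S f -> graph_at g p S h -> S p ->
  locally ((0, 0) : R2) (fun w => f w = h w).
Proof.
  move=> hf hh hp; have := graph_lift_locally S f _ hf hp (proj2 hh).
  apply: filter_imp => -[x y] [hD' [hD [hgx [hS H]]]].
  by have := proj1 H hS; rewrite hgx /cx /cy /cz /=.
Qed.

Lemma graph_at_germ (S S' : R3 -> Prop) f : graph_at g p S f -> same_germ p S S' -> graph_at g p S' f.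
Proof.
  move=> [h1 h2] h3; split=> //; apply: filter_imp (filter_and _ _ h2 h3) => x [k1 k2]; tauto.
Qed.

Lemma graph_at_same_germ (S S' : R3 -> Prop) f f' : graph_at g p S f -> graph_at g p S' f' ->
  locally ((0, 0) : R2) (fun w => f w = f' w) -> same_germ p S S'.
Proof.
  move=> [_ h1] [_ h2] h3.
  have c := pb_cont_xy _ _ _ _ hpair _ Dp.
  rewrite /continuous gp in c; have h4 := c _ h3; rewrite /filtermap in h4.
  apply: filter_imp (filter_and _ _ h1 (filter_and _ _ h2 h4)) => x [k1 [k2 k3]].
  by rewrite k1 k2 k3.
Qed.

Notation cyclide := (cyclide g D).

Lemma cyclide_p A : cyclide A p.
Proof.
  split=> //; split; rewrite gp; first exact: box_0.
  rewrite /cyc3 /cyc /cx /cy /cz /=; field.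
Qed.

Lemma cycF_germ_inj (A A' c s : R) : c ^ 2 + s ^ 2 = 1 -> c * s <> 0 ->
  Derive_n (fun t => cycF (A, (t * c, t * s))) 4 0 = Derive_n (fun t => cycF (A', (t * c, t * s))) 4 0 ->
  A = A'.
Proof.
  move=> hcs hn; rewrite !cycF_line //; try lia.
  have hf := INR_fact_neq_0 4 => h.
  have h' := Rmult_eq_reg_r _ _ _ h hf.
  have hn2 : (c * s) ^ 2 <> 0 by apply: pow_nonzero.
  apply: (Rmult_eq_reg_r ((c * s) ^ 2)) => //; lra.
Qed.

Lemma cyclide_family : one_parameter_family g p cyclide.
Proof.
  split.
    exists cycF => t; split.
      exists cyc_dom; split; [exact: open_cyc_dom|split]; [exact: cyc_dom_0|exact: cycF_smooth].
    exact: (cyclide_graph_at _ _ _ _ _ hpair Dp gp t).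
  move=> t t' h.
  have h1 := cyclide_graph_at _ _ _ _ _ hpair Dp gp t.
  have h2 := cyclide_graph_at _ _ _ _ _ hpair Dp gp t'.
  have h3 := graph_at_unique _ _ _ (graph_at_germ _ _ _ h1 h) h2 (cyclide_p t').
  (* The diagonal direction: off the axes the quartic term determines [A], so one line distinguishes
     the germs. *)
  have h4 : 0 < sqrt (/ 2) by apply: sqrt_lt_R0; lra.
  have h5 : sqrt (/ 2) ^ 2 = / 2 by rewrite -Rsqr_pow2 Rsqr_sqrt //; lra.
  apply: (cycF_germ_inj _ _ (sqrt (/ 2)) (sqrt (/ 2))).
  - rewrite h5; lra.
  - nra.
  - apply: Derive_n_ext_loc; exact: (locally_line _ _ _ h3).
Qed.

Lemma cyclide_standard X1 X2 A :
  (exists l : R, 0 < l /\ is_derive (fun t : R => g (plus p (scal t X1))) 0 ((l, 0, 0) : R3)) ->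
  (exists l : R, 0 < l /\ is_derive (fun t : R => g (plus p (scal t X2))) 0 ((0, l, 0) : R3)) ->
  cyclide_at g p X1 X2 (cyclide A).
Proof.
  move=> h1 h2; split; first exact: (cyclide_dupin _ _ _ _ _ hpair Dp gp A).
  split=> //; split=> //; split=> //; exists (fun w => cycF (A, w)).
  split; first exact: (cyclide_graph_at _ _ _ _ _ hpair Dp gp A).
  exists (20 * Rabs A + 1).
  apply: filter_imp (cycF_slice_open A _ (cyc_dom_0 A)) => -[x y] hd.
  have := cycF_order2 A x y hd.
  by have -> : (x ^ 2 - y ^ 2) / 2 + (0 * x ^ 3 + 0 * y ^ 3) / 6 = (x ^ 2 - y ^ 2) / 2 by field.
Qed.

End Family.

Lemma osculation_cubic th1 th2 alpha : osculation_angle th1 th2 alpha ->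
  th1 * cos (- alpha) ^ 3 + th2 * sin (- alpha) ^ 3 = 0.
Proof.
  move=> [h1 h2]; rewrite cos_neg sin_neg; case: (Req_dec th2 0) => h.
    rewrite h (h2 h) cos_PI2; ring.
  have [hc ht] := h1 h.
  have hs : sin alpha = tan alpha * cos alpha by rewrite /tan; field.
  have -> : th1 = tan alpha ^ 3 * th2 by rewrite ht; field.
  rewrite hs; ring.
Qed.

(** * Enveloping families along a saddle *)

Record fam := Fam { fa : R -> R; fb1 : R -> R; fb2 : R -> R; fb3 : R -> R; fc : R -> R }.

Definition fam_eq (F : fam) (t x y z : R) : R :=
  fa F t * (x ^ 2 + y ^ 2 + z ^ 2) - 2 * (fb1 F t * x + fb2 F t * y + fb3 F t * z) + fc F t.

Definition fam_deq (F : fam) (t x y z : R) : R :=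
  Derive (fa F) t * (x ^ 2 + y ^ 2 + z ^ 2)
  - 2 * (Derive (fb1 F) t * x + Derive (fb2 F) t * y + Derive (fb3 F) t * z) + Derive (fc F) t.

Record smooth_fam (I : R -> Prop) (F : fam) : Prop := {
  sm_open : open I;
  sm_a : smooth_on I (fa F);
  sm_b1 : smooth_on I (fb1 F);
  sm_b2 : smooth_on I (fb2 F);
  sm_b3 : smooth_on I (fb3 F);
  sm_c : smooth_on I (fc F)
}.

(** The sphere of parameter [u w] touches the graph of [h] at the point over [w]. *)
Record enveloped (U : R2 -> Prop) (h : R2 -> R) (I : R -> Prop) (F : fam) (u : R2 -> R) : Prop := {
  en_fam : smooth_fam I F;
  en_u : smooth_on U u;
  en_I : forall w, U w -> I (u w);
  en_eq : forall w, U w -> fam_eq F (u w) (fst w) (snd w) (h w) = 0;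
  en_deq : forall w, U w -> fam_deq F (u w) (fst w) (snd w) (h w) = 0
}.

Lemma smooth_on_ex_derive (I : R -> Prop) (f : R -> R) t : smooth_on I f -> I t -> ex_derive f t.
Proof. move=> Hf Ht; apply/ex_derive_filterdiff; exact: smooth_on_diff Hf Ht. Qed.

Lemma smooth_on_Derive (I : R -> Prop) (f : R -> R) : open I -> smooth_on I f -> smooth_on I (Derive f).
Proof.
  move=> HI Hf; apply: (smooth_on_ext _ _ _ HI _ (smooth_on_ddir _ _ (1 : R) Hf)).
  by move=> x _; rewrite ddir_R.
Qed.

Section Contact.
Variables (U : R2 -> Prop) (h : R2 -> R) (HU : open U) (sh : smooth_on U h).

Lemma line_near (w v : R2) : U w -> locally 0 (fun t : R => U (plus w (scal t v))).
Proof.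
  move=> hw; have c := ex_derive_continuous _ _ (ex_intro _ _ (is_derive_line v w)).
  by rewrite /continuous line_0 in c; exact: (c _ (HU _ hw)).
Qed.

Lemma line_near_imp (w v : R2) (Q : R2 -> Prop) : (forall w', U w' -> Q w') -> U w ->
  locally 0 (fun t : R => Q (plus w (scal t v))).
Proof. move=> HQ hw; apply: filter_imp (line_near w v hw) => t; exact: HQ. Qed.

Lemma is_derive_comp_line (I : R -> Prop) (phi : R -> R) (u : R2 -> R) (w v : R2) :
  smooth_on I phi -> smooth_on U u -> U w -> I (u w) ->
  is_derive (fun t : R => phi (u (plus w (scal t v)))) 0 (Derive phi (u w) * ddir v u w).
Proof.
  move=> hp hu hw hI.
  have d1 := ddir_is_derive u w v (smooth_on_diff _ _ _ hu hw).
  have d2 := Derive_correct _ _ (smooth_on_ex_derive _ _ _ hp hI).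
  rewrite Rmult_comm; apply: (is_derive_comp phi (fun t : R => u (plus w (scal t v)))) d1.
  by rewrite line_0.
Qed.

Lemma is_derive_smooth_line (f : R2 -> R) (w v : R2) : smooth_on U f -> U w ->
  is_derive (fun t : R => f (plus w (scal t v))) 0 (ddir v f w).
Proof. move=> hf hw; apply: ddir_is_derive; exact: smooth_on_diff hf hw. Qed.

Lemma is_derive_fst_line (w v : R2) :
  is_derive (fun t : R => fst (plus w (scal t v))) 0 (fst v).
Proof.
  apply: (is_derive_ext (fun t : R => fst w + t * fst v)) => //.
  by auto_derive => //; rewrite Rmult_1_l.
Qed.

Lemma is_derive_snd_line (w v : R2) :
  is_derive (fun t : R => snd (plus w (scal t v))) 0 (snd v).
Proof.
  apply: (is_derive_ext (fun t : R => snd w + t * snd v)) => //.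
  by auto_derive => //; rewrite Rmult_1_l.
Qed.

Lemma is_derive_zero_near (f : R -> R) l : is_derive f 0 l -> locally 0 (fun t => f t = 0) -> l = 0.
Proof.
  move=> H Hz; rewrite -(is_derive_unique _ _ _ H).
  by rewrite (Derive_ext_loc _ (fun _ => 0) _ Hz) Derive_const.
Qed.

(** This and the next two lemmas differentiate an identity along a line. The ingredients are
    abstract functions of [t], so that only their values and derivatives at 0 enter. *)
Lemma contact_line (A B1 B2 B3 C X Y Z : R -> R) (dA dB1 dB2 dB3 dC dX dY dZ : R) :
  is_derive A 0 dA -> is_derive B1 0 dB1 -> is_derive B2 0 dB2 -> is_derive B3 0 dB3 ->
  is_derive C 0 dC -> is_derive X 0 dX -> is_derive Y 0 dY -> is_derive Z 0 dZ ->
  locally 0 (fun t => A t * (X t ^ 2 + Y t ^ 2 + Z t ^ 2)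
     - 2 * (B1 t * X t + B2 t * Y t + B3 t * Z t) + C t = 0) ->
  dA * (X 0 ^ 2 + Y 0 ^ 2 + Z 0 ^ 2) - 2 * (dB1 * X 0 + dB2 * Y 0 + dB3 * Z 0) + dC
  + 2 * (A 0 * (X 0 * dX + Y 0 * dY + Z 0 * dZ) - (B1 0 * dX + B2 0 * dY + B3 0 * dZ)) = 0.
Proof.
  move=> hA h1 h2 h3 hC hX hY hZ H; apply: is_derive_zero_near H.
  auto_derive; first by repeat split; eexists; eassumption.
  rewrite (is_derive_unique _ _ _ hA) (is_derive_unique _ _ _ h1) (is_derive_unique _ _ _ h2)
    (is_derive_unique _ _ _ h3) (is_derive_unique _ _ _ hC) (is_derive_unique _ _ _ hX)
    (is_derive_unique _ _ _ hY) (is_derive_unique _ _ _ hZ); ring.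
Qed.

Lemma tangency_line (A B1 B2 B3 X Y Z W : R -> R) (dA dB1 dB2 dB3 dX dY dZ dW v1 v2 : R) :
  is_derive A 0 dA -> is_derive B1 0 dB1 -> is_derive B2 0 dB2 -> is_derive B3 0 dB3 ->
  is_derive X 0 dX -> is_derive Y 0 dY -> is_derive Z 0 dZ -> is_derive W 0 dW ->
  locally 0 (fun t => A t * (X t * v1 + Y t * v2 + Z t * W t)
     - (B1 t * v1 + B2 t * v2 + B3 t * W t) = 0) ->
  dA * (X 0 * v1 + Y 0 * v2 + Z 0 * W 0) + A 0 * (dX * v1 + dY * v2 + dZ * W 0 + Z 0 * dW)
  - (dB1 * v1 + dB2 * v2 + dB3 * W 0 + B3 0 * dW) = 0.
Proof.
  move=> hA h1 h2 h3 hX hY hZ hW H; apply: is_derive_zero_near H.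
  auto_derive; first by repeat split; eexists; eassumption.
  rewrite (is_derive_unique _ _ _ hA) (is_derive_unique _ _ _ h1) (is_derive_unique _ _ _ h2)
    (is_derive_unique _ _ _ h3) (is_derive_unique _ _ _ hX)
    (is_derive_unique _ _ _ hY) (is_derive_unique _ _ _ hZ) (is_derive_unique _ _ _ hW); ring.
Qed.

Lemma third_line (A A' B' B3 B3' P X Z W V : R -> R) (dA dA' dB' dB3 dB3' dP dX dW : R) :
  is_derive A 0 dA -> is_derive A' 0 dA' -> is_derive B' 0 dB' -> is_derive B3 0 dB3 ->
  is_derive B3' 0 dB3' -> is_derive P 0 dP -> is_derive X 0 dX -> is_derive Z 0 0 ->
  is_derive W 0 dW -> is_derive V 0 0 ->
  P 0 = 0 -> X 0 = 0 -> Z 0 = 0 -> W 0 = 0 -> V 0 = 1 -> B' 0 = 0 ->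
  locally 0 (fun t => A' t * P t * (X t + Z t * W t) + A t * (1 + W t * W t + Z t * V t)
     - (B' t * P t + B3' t * P t * W t + B3 t * V t) = 0) -> dA - dB3 = 0.
Proof.
  move=> hA hA' hB' hB3 hB3' hP hX hZ hW hV p x z w v b H.
  apply: is_derive_zero_near H.
  auto_derive; first by repeat split; eexists; eassumption.
  rewrite (is_derive_unique _ _ _ hA) (is_derive_unique _ _ _ hA') (is_derive_unique _ _ _ hB')
    (is_derive_unique _ _ _ hB3) (is_derive_unique _ _ _ hB3') (is_derive_unique _ _ _ hP)
    (is_derive_unique _ _ _ hX) (is_derive_unique _ _ _ hZ) (is_derive_unique _ _ _ hW)
    (is_derive_unique _ _ _ hV) p x z w v b; ring.
Qed.

Variables (I : R -> Prop) (F : fam) (u : R2 -> R) (Hen : enveloped U h I F u).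

(** When [fam_eq = 0] is differentiated along the graph, the variation of the parameter is
    multiplied by [fam_deq = 0]. What remains is the tangency of the sphere to the graph. *)
Lemma contact (w v : R2) : U w ->
  fa F (u w) * (fst w * fst v + snd w * snd v + h w * ddir v h w)
  - (fb1 F (u w) * fst v + fb2 F (u w) * snd v + fb3 F (u w) * ddir v h w) = 0.
Proof.
  move=> hw; have [[oI sa s1 s2 s3 sc] su hI heq hdeq] := Hen.
  have hIw := hI w hw.
  have := contact_line _ _ _ _ _ _ _ _ _ _ _ _ _ _ _ _
    (is_derive_comp_line I _ u w v sa su hw hIw) (is_derive_comp_line I _ u w v s1 su hw hIw)
    (is_derive_comp_line I _ u w v s2 su hw hIw) (is_derive_comp_line I _ u w v s3 su hw hIw)
    (is_derive_comp_line I _ u w v sc su hw hIw)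
    (is_derive_fst_line w v) (is_derive_snd_line w v) (is_derive_smooth_line h w v sh hw).
  move=> H; have {H} := H (line_near_imp w v _ heq hw).
  rewrite !line_0; have := hdeq w hw; rewrite /fam_deq.
  set X := fst w; set Y := snd w; set du := ddir v u w => E H.
  have E2 := f_equal (Rmult du) E; lra.
Qed.

Lemma contact_derivative (w v v' : R2) : U w ->
  Derive (fa F) (u w) * ddir v' u w * (fst w * fst v + snd w * snd v + h w * ddir v h w)
  + fa F (u w) * (fst v' * fst v + snd v' * snd v + ddir v' h w * ddir v h w + h w * ddir v' (ddir v h) w)
  - (Derive (fb1 F) (u w) * ddir v' u w * fst v + Derive (fb2 F) (u w) * ddir v' u w * snd v
     + Derive (fb3 F) (u w) * ddir v' u w * ddir v h w + fb3 F (u w) * ddir v' (ddir v h) w) = 0.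
Proof.
  move=> hw; have [[oI sa s1 s2 s3 sc] su hI heq hdeq] := Hen.
  have hIw := hI w hw.
  have := tangency_line _ _ _ _ _ _ _ _ _ _ _ _ _ _ _ _ (fst v) (snd v)
    (is_derive_comp_line I _ u w v' sa su hw hIw) (is_derive_comp_line I _ u w v' s1 su hw hIw)
    (is_derive_comp_line I _ u w v' s2 su hw hIw) (is_derive_comp_line I _ u w v' s3 su hw hIw)
    (is_derive_fst_line w v') (is_derive_snd_line w v') (is_derive_smooth_line h w v' sh hw)
    (is_derive_smooth_line (ddir v h) w v' (smooth_on_ddir _ _ v sh) hw).
  move=> H; have {H} := H (line_near_imp w v' _ (fun w' => contact w' v) hw).
  by rewrite !line_0.
Qed.

Hypotheses (U0 : U (0, 0)) (J : saddle_jet h).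

(** [contact] and its derivatives along the two axes, evaluated on the Hessian [diag(1, -1)]: the
    left sides [fa - fb3] and [fa + fb3] measure how far the sphere is from osculating along each
    axis. *)
Lemma contact_at_0 : let t0 := u (0, 0) in
  fb1 F t0 = 0 /\ fb2 F t0 = 0 /\ fc F t0 = 0 /\ Derive (fc F) t0 = 0 /\
  fa F t0 - fb3 F t0 = Derive (fb1 F) t0 * ddir dir_x u (0, 0) /\
  fa F t0 + fb3 F t0 = Derive (fb2 F) t0 * ddir dir_y u (0, 0) /\
  Derive (fb1 F) t0 * ddir dir_y u (0, 0) = 0 /\ Derive (fb2 F) t0 * ddir dir_x u (0, 0) = 0.
Proof.
  have [j0 jx jy jxx jxy jyx jyy _] := J.
  have [_ _ _ heq hdeq] := Hen.
  have c1 := contact (0, 0) dir_x U0; have c2 := contact (0, 0) dir_y U0.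
  have d11 := contact_derivative (0, 0) dir_x dir_x U0; have d12 := contact_derivative (0, 0) dir_x dir_y U0.
  have d21 := contact_derivative (0, 0) dir_y dir_x U0; have d22 := contact_derivative (0, 0) dir_y dir_y U0.
  have q := heq _ U0; have q' := hdeq _ U0.
  rewrite /fam_eq /fam_deq j0 /= in q q'.
  rewrite j0 jx /= in c1; rewrite j0 jy /= in c2.
  rewrite j0 jx jxx /= in d11; rewrite j0 jx jy jyx /= in d12.
  rewrite j0 jy jx jxy /= in d21; rewrite j0 jy jyy /= in d22.
  move=> t0; rewrite -/t0 in c1 c2 d11 d12 d21 d22 q q'.
  by repeat split; lra.
Qed.

(** The second-order contact in [x] is differentiated in [y]. The unknown second derivative of [u]
    comes with the factor [Derive (fb1 F) t0 = 0], and [h] has no term in [x^2 y]; only the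
    variation of [fa - fb3] survives. *)
Lemma contact_third : let t0 := u (0, 0) in ddir dir_x u (0, 0) = 0 -> Derive (fb1 F) t0 = 0 ->
  (Derive (fa F) t0 - Derive (fb3 F) t0) * ddir dir_y u (0, 0) = 0.
Proof.
  move=> t0 ux b1'; have [j0 jx jy jxx jxy jyx jyy jyxx] := J.
  have [[oI sa s1 s2 s3 sc] su hI heq hdeq] := Hen.
  have hI0 := hI _ U0.
  have DL := fun f (sf : smooth_on I f) => is_derive_comp_line I f u (0, 0) dir_y sf su U0 hI0.
  have A0 := DL _ sa; have B0 := DL _ s3.
  have A1 := DL _ (smooth_on_Derive _ _ oI sa); have B1 := DL _ (smooth_on_Derive _ _ oI s1).
  have B3 := DL _ (smooth_on_Derive _ _ oI s3).
  have X := is_derive_fst_line (0, 0) dir_y.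
  have SL := fun f (sf : smooth_on U f) => is_derive_smooth_line f (0, 0) dir_y sf U0.
  have H0 := SL _ sh; have H1 := SL _ (smooth_on_ddir _ _ dir_x sh).
  have H2 := SL _ (smooth_on_ddir _ _ dir_x (smooth_on_ddir _ _ dir_x sh)).
  have V := SL _ (smooth_on_ddir _ _ dir_x su).
  have L := line_near_imp (0, 0) dir_y _ (fun w' => contact_derivative w' dir_x dir_x) U0.
  rewrite jy in H0; rewrite jyxx in H2; rewrite -/t0 in A0 B0.
  have -> : (Derive (fa F) t0 - Derive (fb3 F) t0) * ddir dir_y u (0, 0) =
    Derive (fa F) t0 * ddir dir_y u (0, 0) - Derive (fb3 F) t0 * ddir dir_y u (0, 0) by ring.
  apply: (third_line _ _ _ _ _ _ _ _ _ _ _ _ _ _ _ _ _ _ A0 A1 B1 B0 B3 V X H0 H1 H2);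
    rewrite ?line_0 //.
  apply: filter_imp L => t Ht; rewrite -[RHS]Ht /=; ring.
Qed.
End Contact.

(** * Local surjectivity of a pair of functions on the plane *)

Lemma locally_R2_box (P : R2 -> Prop) : locally ((0, 0) : R2) P ->
  exists d : R, 0 < d /\ forall x y, Rabs x < d -> Rabs y < d -> P (x, y).
Proof.
  move=> [d Hd]; exists d; split; first exact: cond_pos.
  move=> x y hx hy; apply: Hd; split.
    by change (Rabs (x - 0) < d); rewrite Rminus_0_r.
  by change (Rabs (y - 0) < d); rewrite Rminus_0_r.
Qed.

(** With [y] as the main variable of [f] and [x] as that of [k], the equation [f = s] is solved
    for [y] as a function of [x], and then [k = t] along its solutions. *)
Lemma surjective_on_box (f k : R -> R -> R) (r d : R) : 0 < d < r ->
  (forall x y, Rabs x < r -> Rabs y < r -> Rabs (f x y - y) <= d / 4 /\ Rabs (k x y - x) <= d / 4) ->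
  (forall x y y', Rabs x < r -> Rabs y < r -> Rabs y' < r -> y <= y' -> (y' - y) / 2 <= f x y' - f x y) ->
  (forall x y, Rabs x < r -> Rabs y < r ->
     continuous (fun w : R2 => f (fst w) (snd w)) (x, y) /\ continuous (fun w : R2 => k (fst w) (snd w)) (x, y)) ->
  forall s t, Rabs s <= d / 2 -> Rabs t <= d / 2 ->
  exists x y, Rabs x < r /\ Rabs y < r /\ f x y = s /\ k x y = t.
Proof.
  move=> Hd Hbound Hmono Hc s t /Rabs_le_iff hs /Rabs_le_iff ht.
  have cx1 : forall x y, Rabs x < r -> Rabs y < r -> continuous (fun x => f x y) x.
    move=> x y hx hy; apply: (continuous_comp_2 (fun x => x) (fun _ => y) f).
    - exact: continuous_id.
    - exact: continuous_const.
    - exact: (proj1 (Hc x y hx hy)).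
  have cy1 : forall x y, Rabs x < r -> Rabs y < r -> continuous (f x) y.
    move=> x y hx hy; apply: (continuous_comp_2 (fun _ => x) (fun y => y) f).
    - exact: continuous_const.
    - exact: continuous_id.
    - exact: (proj1 (Hc x y hx hy)).
  have root : forall x, Rabs x < r -> exists y, Rabs y <= d /\ f x y = s.
    move=> x hx.
    have hd : Rabs d < r by rewrite Rabs_pos_eq; lra.
    have hd' : Rabs (- d) < r by rewrite Rabs_Ropp.
    have [/Rabs_le_iff b1 _] := Hbound x d hx hd; have [/Rabs_le_iff b2 _] := Hbound x (- d) hx hd'.
    have [z [hz hz0]] : {z | - d <= z <= d /\ f x z - s = 0}.
      apply: (IVT_interv (fun y => f x y - s)); try lra.
      move=> y hy; apply/continuity_pt_filterlim.
      apply: (continuous_minus (f x) (fun _ => s)); last exact: continuous_const.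
      apply: cy1 => //; apply/Rabs_lt_iff; lra.
    exists z; split; [apply/Rabs_le_iff; lra|lra].
  pose Y x := epsilon (inhabits 0) (fun y => Rabs y <= d /\ f x y = s).
  have HY : forall x, Rabs x < r -> Rabs (Y x) <= d /\ f x (Y x) = s.
    move=> x hx; exact: (epsilon_spec _ _ (root x hx)).
  (* [f x'] increases with slope at least 1/2, so a change of [f] by less than [e / 2] at the old
     solution moves the solution by less than [e]. *)
  have cY : forall x, Rabs x < r -> continuous Y x.
    move=> x hx P [e He].
    have [y1 y2] := HY x hx.
    have hY : Rabs (Y x) < r by lra.
    have he : 0 < e / 2 by have := cond_pos e; lra.
    have L1 := cx1 x (Y x) hx hY _ (locally_ball _ (mkposreal _ he)).
    have L2 : locally x (fun x' => Rabs x' < r).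
      by apply: locally_lt => //; [exact: continuous_Rabs|exact: continuous_const].
    rewrite /filtermap in L1 *; apply: filter_imp (filter_and _ _ L1 L2) => x' [h1 h2].
    apply: He; change (Rabs (Y x' - Y x) < e).
    have {}h1 : Rabs (f x' (Y x) - f x (Y x)) < e / 2 by exact: h1.
    have [z1 z2] := HY x' h2; have hY' : Rabs (Y x') < r by lra.
    rewrite y2 -z2 in h1; move/Rabs_lt_iff: h1 => h1.
    apply/Rabs_lt_iff.
    case: (Rle_dec (Y x) (Y x')) => hle.
      have := Hmono x' _ _ h2 hY hY' hle; lra.
    have := Hmono x' _ _ h2 hY' hY ltac:(lra); lra.
  have [x [hx hx0]] : {x | - d <= x <= d /\ k x (Y x) - t = 0}.
    have Yb : forall x, Rabs x <= d -> Rabs (k x (Y x) - x) <= d / 4.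
      move=> x hx; have hx' : Rabs x < r by lra.
      have [h1 _] := HY x hx'; apply: (proj2 (Hbound x (Y x) hx' _)); lra.
    have hd : Rabs d <= d by rewrite Rabs_pos_eq; lra.
    have hd' : Rabs (- d) <= d by rewrite Rabs_Ropp.
    have /Rabs_le_iff b1 := Yb d hd; have /Rabs_le_iff b2 := Yb (- d) hd'.
    apply: (IVT_interv (fun x => k x (Y x) - t)); try lra.
    move=> x hx; apply/continuity_pt_filterlim.
    have hx' : Rabs x < r by apply/Rabs_lt_iff; lra.
    apply: (continuous_minus (fun x => k x (Y x)) (fun _ => t)); last exact: continuous_const.
    apply: (continuous_comp_2 (fun x => x) Y k); first exact: continuous_id.
      exact: cY.
    by apply: (proj2 (Hc x (Y x) hx' _)); have [] := HY x hx'; lra.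
  have hx' : Rabs x < r by apply/Rabs_lt_iff; lra.
  have [h1 h2] := HY x hx'.
  exists x, (Y x); repeat split=> //; lra.
Qed.

Lemma filterdiff_close (u : R2 -> R) (l : R2 -> R) (eps : posreal) :
  filterdiff u (locally ((0, 0) : R2)) l -> locally ((0, 0) : R2) (fun w : R2 => Rabs (u w - u (0, 0) - l w) <= eps * norm w).
Proof.
  move=> [_ H]; have := H (0, 0) (fun _ h => h) eps.
  apply: filter_imp => w; have -> : minus w ((0, 0) : R2) = w by exact: minus_zero_r.
  done.
Qed.

(** The surjective half of the inverse function theorem. Divided by their nonzero partial
    derivatives, the increments of [u1] and [u2] are close to [y] and [x], so two successive uses of
    the intermediate value theorem suffice. *)
Lemma local_surjectivity (U : R2 -> Prop) (u1 u2 : R2 -> R) (P : R2 -> Prop) : open U -> U (0, 0) ->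
  smooth_on U u1 -> smooth_on U u2 ->
  ddir dir_x u1 (0, 0) = 0 -> ddir dir_y u1 (0, 0) <> 0 -> ddir dir_y u2 (0, 0) = 0 -> ddir dir_x u2 (0, 0) <> 0 ->
  locally ((0, 0) : R2) P ->
  exists e, 0 < e /\ forall s t, Rabs (s - u1 (0, 0)) < e -> Rabs (t - u2 (0, 0)) < e ->
    exists w, P w /\ u1 w = s /\ u2 w = t.
Proof.
  move=> HU U0 s1 s2 ux uy vy vx HP.
  pose k1 := ddir dir_y u1 (0, 0); pose k2 := ddir dir_x u2 (0, 0).
  pose f x y := (u1 (x, y) - u1 (0, 0)) / k1.
  pose k x y := (u2 (x, y) - u2 (0, 0)) / k2.
  (* On a box of half-width [r] the norm is at most [2 r], so an error of 1/16 of the norm is at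
     most [r / 8], the [d / 4] needed with [d = r / 2]. *)
  have e16 : 0 < 1 / 16 by lra.
  have expand : forall (u : R2 -> R) (w : R2), ex_filterdiff u (locally ((0, 0) : R2)) ->
     ddir w u (0, 0) = fst w * ddir dir_x u (0, 0) + snd w * ddir dir_y u (0, 0).
    move=> u [x y] hu; rewrite -!ddir_lin_scal // -ddir_lin_plus //.
    congr (ddir _ u (0, 0)).
    by rewrite /plus /scal /= /prod_plus /prod_scal /= /plus /scal /= /mult /=; congr pair; ring.
  have F1 := smooth_on_diff _ _ _ s1 U0; have F2 := smooth_on_diff _ _ _ s2 U0.
  have close : forall (u : R2 -> R) (c : R), c <> 0 -> ex_filterdiff u (locally ((0, 0) : R2)) ->
     locally ((0, 0) : R2) (fun w : R2 => Rabs ((u w - u (0, 0)) / c - ddir w u (0, 0) / c) <= 1 / 16 * norm w).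
    move=> u c hc hu.
    have hc' : 0 < 1 / 16 * Rabs c by apply: Rmult_lt_0_compat; [lra|exact: Rabs_pos_lt].
    apply: filter_imp (filterdiff_close u _ (mkposreal _ hc') (ddir_filterdiff _ _ hu)) => w /= h.
    have -> : (u w - u (0, 0)) / c - ddir w u (0, 0) / c = (u w - u (0, 0) - ddir w u (0, 0)) / c by field.
    rewrite /Rdiv Rabs_mult Rabs_inv; apply: (Rmult_le_reg_r (Rabs c)); first exact: Rabs_pos_lt.
    rewrite Rmult_assoc Rinv_l; last exact: Rabs_no_R0.
    lra.
  have C1 := close u1 k1 uy F1; have C2 := close u2 k2 vx F2.
  have S := smooth_on_ddir _ _ dir_y s1.
  have Dpos : locally ((0, 0) : R2) (fun w => 1 / 2 < ddir dir_y u1 w / k1).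
    apply: (locally_lt (fun _ => 1 / 2) (fun w => ddir dir_y u1 w / k1)).
    - exact: continuous_const.
    - apply: (continuous_mult (ddir dir_y u1) (fun _ => / k1)); last exact: continuous_const.
      exact: smooth_on_continuous S U0.
    - rewrite -/k1 /Rdiv Rinv_r //; lra.
  have [r [r0 Hr]] := locally_R2_box _ (filter_and _ _ HP (filter_and _ _ (HU _ U0) (filter_and _ _ Dpos (filter_and _ _ C1 C2)))).
  have k1p := Rabs_pos_lt _ uy; have k2p := Rabs_pos_lt _ vx.
  rewrite -/k1 in k1p; rewrite -/k2 in k2p.
  exists (r / 4 * Rmin (Rabs k1) (Rabs k2)); split.
    apply: Rmult_lt_0_compat; [lra|exact: Rmin_glb_lt].
  move=> s t hs ht.
  have [x [y [hx [hy [E1 E2]]]]] : exists x y, Rabs x < r /\ Rabs y < r /\ f x y = (s - u1 (0, 0)) / k1 /\ k x y = (t - u2 (0, 0)) / k2.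
    apply: (surjective_on_box f k r (r / 2)); first lra.
    - move=> x y hx hy; have [_ [_ [_ [h1 h2]]]] := Hr x y hx hy.
      have hn : norm ((x, y) : R2) <= 2 * r := norm_pair_le x y r (Rlt_le _ _ hx) (Rlt_le _ _ hy).
      rewrite expand //= ux -/k1 in h1; rewrite expand //= vy -/k2 in h2.
      have g1 : (x * 0 + y * k1) / k1 = y by field.
      have g2 : (x * k2 + y * 0) / k2 = x by field.
      rewrite g1 in h1; rewrite g2 in h2; rewrite /f /k; split; lra.
    - move=> x y y' hx hy hy' hle.
      have dl : forall z, Rabs z < r -> is_derive (fun z => f x z) z (ddir dir_y u1 (x, z) / k1).
        move=> z hz; have [_ [hU _]] := Hr x z hx hz.
        have H := ddir_is_derive u1 (x, z) dir_y (smooth_on_diff _ _ _ s1 hU).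
        have H' : is_derive (fun z' => u1 (x, z')) z (ddir dir_y u1 (x, z)).
          apply: (is_derive_ext (fun z' => u1 (plus ((x, z) : R2) (scal (z' - z) dir_y)))).
            move=> z'; congr u1; rewrite /plus /scal /= /prod_plus /prod_scal /= /plus /scal /= /mult /=.
            by congr pair; ring.
          have Hs : is_derive (fun z' : R => z' - z) z 1 by auto_derive.
          have -> : ddir dir_y u1 (x, z) = scal 1 (ddir dir_y u1 (x, z)) by rewrite /scal /= /mult /= Rmult_1_l.
          apply: (is_derive_comp (fun t : R => u1 (plus ((x, z) : R2) (scal t dir_y))) (fun z' => z' - z)) Hs.
          by rewrite Rminus_diag.
        rewrite /f; have := is_derive_scal_l (fun z' => u1 (x, z') - u1 (0, 0)) z _ (/ k1) (is_derive_minus _ _ _ _ _ H' (is_derive_const (u1 (0, 0)) z)).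
        rewrite /scal /= /mult /= /minus /plus /opp /zero /=.
        by have -> : ddir dir_y u1 (x, z) + - 0 = ddir dir_y u1 (x, z) by ring.
      have hin : forall z, Rmin y y' <= z <= Rmax y y' -> Rabs z < r.
        rewrite Rmin_left // Rmax_right // => z hz; move/Rabs_lt_iff: hy => hy; move/Rabs_lt_iff: hy' => hy'.
        apply/Rabs_lt_iff; lra.
      have [c [hc Ec]] := MVT_gen (fun z => f x z) y y' (fun z => ddir dir_y u1 (x, z) / k1)
        (fun z hz => dl z (hin z (conj (Rlt_le _ _ (proj1 hz)) (Rlt_le _ _ (proj2 hz)))))
        (fun z hz => proj2 (continuity_pt_filterlim _ _) (ex_derive_continuous _ _ (ex_intro _ _ (dl z (hin z hz))))).
      rewrite Ec; have [_ [_ [h _]]] := Hr x c hx (hin c hc).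
      nra.
    - move=> x y hx hy; have [_ [hU _]] := Hr x y hx hy.
      have cc : forall (u : R2 -> R) (c c' : R), continuous u ((x, y) : R2) ->
         continuous (fun w : R2 => (u (fst w, snd w) - c) / c') ((x, y) : R2).
        move=> u c c' hu; apply: (continuous_mult (fun w : R2 => u (fst w, snd w) - c) (fun _ => / c')); last exact: continuous_const.
        apply: (continuous_minus (fun w : R2 => u (fst w, snd w)) (fun _ => c)); last exact: continuous_const.
        by apply: continuous_ext hu => -[].
      split; apply: cc; [exact: smooth_on_continuous s1 hU|exact: smooth_on_continuous s2 hU].
    - rewrite /Rdiv Rabs_mult Rabs_inv; apply: (Rmult_le_reg_r (Rabs k1)) => //.
      rewrite Rmult_assoc Rinv_l; last lra.
      have := Rmin_l (Rabs k1) (Rabs k2); nra.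
    - rewrite /Rdiv Rabs_mult Rabs_inv; apply: (Rmult_le_reg_r (Rabs k2)) => //.
      rewrite Rmult_assoc Rinv_l; last lra.
      have := Rmin_r (Rabs k1) (Rabs k2); nra.
  have [hP _] := Hr x y hx hy.
  exists (x, y); split=> //; split.
  - have := f_equal (fun z => z * k1) E1; rewrite /f /Rdiv !Rmult_assoc Rinv_l //; lra.
  - have := f_equal (fun z => z * k2) E2; rewrite /k /Rdiv !Rmult_assoc Rinv_l //; lra.
Qed.

(** * The base sphere of an enveloping family osculates the saddle *)

Ltac eta_Derive :=
  repeat match goal with |- context [Derive (fun x : R => ?f x) ?t] =>
    progress change (Derive (fun x : R => f x) t) with (Derive f t) end.

(** The sphere of parameter [t0] is [r^2 = 2 z], the osculating sphere of the saddle in the direction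
    of the [x]-axis; the last clause is third-order information on the surface. *)
Record touches_x (F : fam) (t0 : R) : Prop := {
  tx_b1 : fb1 F t0 = 0;
  tx_b2 : fb2 F t0 = 0;
  tx_c : fc F t0 = 0;
  tx_a : fa F t0 = fb3 F t0;
  tx_b3 : fb3 F t0 <> 0;
  tx_db1 : Derive (fb1 F) t0 = 0;
  tx_db2 : Derive (fb2 F) t0 <> 0;
  tx_dc : Derive (fc F) t0 = 0;
  tx_da : Derive (fa F) t0 = Derive (fb3 F) t0
}.

(** Image of [F] under the isometry [(x, y, z) -> (y, x, - z)]. *)
Definition swap_fam (F : fam) : fam := Fam (fa F) (fb2 F) (fb1 F) (fun t => - fb3 F t) (fc F).

Definition swap (w : R2) : R2 := (snd w, fst w).

Lemma smooth_on_swap (U : R2 -> Prop) (f : R2 -> R) :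
  open U -> smooth_on U f -> open (fun w => U (swap w)) /\ smooth_on (fun w => U (swap w)) (fun w => f (swap w)).
Proof.
  move=> HU sf.
  have o : open (fun w => U (swap w)).
    move=> w hw; have [e He] := HU _ hw; exists e => w' [h1 h2]; apply: He; by split.
  split=> //; apply: (smooth_on_comp2 _ U f (fun w => snd w) (fun w => fst w)) => //.
  - apply: smooth_on_linear => //; exact: is_linear_snd.
  - apply: smooth_on_linear => //; exact: is_linear_fst.
Qed.

Lemma smooth_fam_swap I F : smooth_fam I F -> smooth_fam I (swap_fam F).
Proof. move=> [o sa s1 s2 s3 sc]; split=> //=; exact: smooth_on_opp. Qed.

Lemma enveloped_swap U h I F u : open U -> enveloped U h I F u ->
  enveloped (fun w => U (swap w)) (fun w => - h (swap w)) I (swap_fam F) (fun w => u (swap w)).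
Proof.
  move=> HU [sF su hI heq hdeq]; split.
  - exact: smooth_fam_swap.
  - exact: (proj2 (smooth_on_swap U u HU su)).
  - by move=> w hw; exact: hI.
  - move=> w hw; rewrite -[RHS](heq _ hw) /fam_eq /=; ring.
  - move=> w hw; rewrite -[RHS](hdeq _ hw) /fam_deq /= Derive_opp; ring.
Qed.

Lemma small4_swap (h : R2 -> R) : small4 (fun w => h w - saddle w) ->
  small4 (fun w => - h (swap w) - saddle w).
Proof.
  move=> [K H]; exists K.
  have [d [d0 Hd]] := locally_R2_box _ H.
  exists (mkposreal d d0) => -[x y] [h1 h2].
  have hx : Rabs x < d by have : Rabs (x - 0) < d by []; rewrite Rminus_0_r.
  have hy : Rabs y < d by have : Rabs (y - 0) < d by []; rewrite Rminus_0_r.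
  have := Hd y x hy hx; rewrite /swap /saddle /= => h3.
  rewrite -Rabs_Ropp; have -> : - (- h (y, x) - (x * (x * 1) - y * (y * 1)) / 2) = h (y, x) - (y * (y * 1) - x * (x * 1)) / 2 by field.
  apply: Rle_trans h3 _; right; ring.
Qed.

Section Dichotomy.
Variables (U : R2 -> Prop) (h : R2 -> R) (HU : open U) (U0 : U (0, 0)) (sh : smooth_on U h).
Hypothesis h4 : small4 (fun w => h w - saddle w).

Lemma touches_x_intro I F u : enveloped U h I F u -> fb3 F (u (0, 0)) <> 0 ->
  ddir dir_x u (0, 0) = 0 -> ddir dir_y u (0, 0) <> 0 /\ touches_x F (u (0, 0)).
Proof.
  move=> en b3n ux.
  have J := saddle_jet_of_small4 U h HU U0 sh h4.
  have [z1 [z2 [zc [zdc [q1 [q2 [q3 q4]]]]]]] := contact_at_0 U h HU sh I F u en U0 J.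
  rewrite ux in q1 q4.
  have n : Derive (fb2 F) (u (0, 0)) * ddir dir_y u (0, 0) <> 0 by rewrite -q2; move: b3n q1; lra.
  have uy : ddir dir_y u (0, 0) <> 0 by move=> E; apply: n; rewrite E; ring.
  have b2' : Derive (fb2 F) (u (0, 0)) <> 0 by move=> E; apply: n; rewrite E; ring.
  have b1' : Derive (fb1 F) (u (0, 0)) = 0 by case: (Rmult_integral _ _ q3).
  have t := contact_third U h HU sh I F u en U0 J ux b1'.
  split=> //; split=> //; first lra.
  by case: (Rmult_integral _ _ t) => //; lra.
Qed.

End Dichotomy.

(** As [fb3 <> 0], the numbers [fa - fb3] and [fa + fb3] are not both 0. The products in
    [contact_at_0] then force exactly one partial derivative of [u] to vanish, which tells the axis
    of osculation; the swap reduces the second case to the first. *)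
Lemma touches_dichotomy U h I F u : open U -> U (0, 0) -> smooth_on U h ->
  small4 (fun w => h w - saddle w) -> enveloped U h I F u -> fb3 F (u (0, 0)) <> 0 ->
  (ddir dir_x u (0, 0) = 0 /\ ddir dir_y u (0, 0) <> 0 /\ touches_x F (u (0, 0))) \/
  (ddir dir_y u (0, 0) = 0 /\ ddir dir_x u (0, 0) <> 0 /\ touches_x (swap_fam F) (u (0, 0))).
Proof.
  move=> HU U0 sh h4 en b3n.
  case: (Req_dec (ddir dir_x u (0, 0)) 0) => ux.
    by left; split=> //; apply: touches_x_intro en b3n ux.
  right.
  have J := saddle_jet_of_small4 U h HU U0 sh h4.
  have [z1 [z2 [zc [zdc [q1 [q2 [q3 q4]]]]]]] := contact_at_0 U h HU sh I F u en U0 J.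
  have b2' : Derive (fb2 F) (u (0, 0)) = 0 by case: (Rmult_integral _ _ q4).
  have uy : ddir dir_y u (0, 0) = 0.
    case: (Rmult_integral _ _ q3) => // b1'; case: b3n.
    by rewrite b1' in q1; rewrite b2' in q2; lra.
  split=> //.
  have [oU su] := smooth_on_swap U u HU (en_u _ _ _ _ _ en).
  have [_ sh'] := smooth_on_swap U h HU sh.
  have H := touches_x_intro (fun w => U (swap w)) (fun w => - h (swap w)) oU U0
    (smooth_on_opp _ _ oU sh') (small4_swap h h4) I (swap_fam F) _ (enveloped_swap _ _ _ _ _ HU en).
  apply: H; last exact: uy.
  move=> E; apply: b3n; have {}E : - fb3 F (u (0, 0)) = 0 by exact: E.
  lra.
Qed.

(** [fam_disc] is the squared radius times [fa ^ 2]; the spheres of parameters [t] and [s] are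
    tangent when [fam_prod F G t s ^ 2 = fam_disc F t * fam_disc G s]. *)
Definition fam_disc (F : fam) (t : R) : R :=
  fb1 F t ^ 2 + fb2 F t ^ 2 + fb3 F t ^ 2 - fa F t * fc F t.

Definition fam_prod (F G : fam) (t s : R) : R :=
  fb1 F t * fb1 G s + fb2 F t * fb2 G s + fb3 F t * fb3 G s - (fa F t * fc G s + fa G s * fc F t) / 2.

(** Two spheres touching the graph at the same point touch each other. With [X] that point and
    [n = (-p, -q, 1)], contact gives [b - a X = l n] and [b' - a' X = l' n]; so the discriminants
    are [l^2 n.n] and [l'^2 n.n], and the product is [l l' n.n]. *)
Lemma fam_tangent U h I F u I' G v w : open U -> smooth_on U h ->
  enveloped U h I F u -> enveloped U h I' G v -> U w ->
  fam_prod F G (u w) (v w) ^ 2 = fam_disc F (u w) * fam_disc G (v w).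
Proof.
  move=> HU sh en en' hw.
  have a1 := contact U h HU sh I F u en w dir_x hw; have a2 := contact U h HU sh I F u en w dir_y hw.
  have a3 := en_eq _ _ _ _ _ en w hw.
  have b1 := contact U h HU sh I' G v en' w dir_x hw; have b2 := contact U h HU sh I' G v en' w dir_y hw.
  have b3 := en_eq _ _ _ _ _ en' w hw.
  rewrite /fam_eq in a3 b3; rewrite /= in a1 a2 b1 b2.
  rewrite /fam_prod /fam_disc; move: a1 a2 a3 b1 b2 b3.
  move: (u w) (v w) (h w) (ddir dir_x h w) (ddir dir_y h w) (fst w) (snd w) => t s z p q x y a1 a2 a3 b1 b2 b3.
  have {}a1 : fb1 F t = fa F t * x + (fa F t * z - fb3 F t) * p by lra.
  have {}a2 : fb2 F t = fa F t * y + (fa F t * z - fb3 F t) * q by lra.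
  have {}b1 : fb1 G s = fa G s * x + (fa G s * z - fb3 G s) * p by lra.
  have {}b2 : fb2 G s = fa G s * y + (fa G s * z - fb3 G s) * q by lra.
  have {}a3 : fc F t = 2 * (fb1 F t * x + fb2 F t * y + fb3 F t * z) - fa F t * (x ^ 2 + y ^ 2 + z ^ 2) by lra.
  have {}b3 : fc G s = 2 * (fb1 G s * x + fb2 G s * y + fb3 G s * z) - fa G s * (x ^ 2 + y ^ 2 + z ^ 2) by lra.
  rewrite a3 b3 a1 a2 b1 b2; field.
Qed.

Lemma locally_neq0 {T : UniformSpace} (f : T -> R) x : continuous f x -> f x <> 0 -> locally x (fun y => f y <> 0).
Proof.
  move=> cf hf.
  have h0 : 0 < Rabs (f x) by exact: Rabs_pos_lt.
  have ca : continuous (fun y => Rabs (f y)) x by apply: (continuous_comp f Rabs) => //; exact: continuous_Rabs.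
  apply: filter_imp (locally_lt (fun _ => 0) _ x (continuous_const _ _) ca h0) => y hy hz.
  by rewrite hz Rabs_R0 in hy; lra.
Qed.

Lemma fam_continuous I F t : smooth_fam I F -> I t ->
  continuous (fa F) t /\ continuous (fb1 F) t /\ continuous (fb2 F) t /\ continuous (fb3 F) t /\ continuous (fc F) t.
Proof.
  move=> [o sa s1 s2 s3 sc] ht; repeat split.
  - exact: smooth_on_continuous sa ht.
  - exact: smooth_on_continuous s1 ht.
  - exact: smooth_on_continuous s2 ht.
  - exact: smooth_on_continuous s3 ht.
  - exact: smooth_on_continuous sc ht.
Qed.

(** Differentiating the tangency condition of the spheres [t] and [s] at [t0]. *)
Lemma tangent_to_touching I F t0 G s : smooth_fam I F -> I t0 -> touches_x F t0 ->
  locally t0 (fun t => fam_prod F G t s ^ 2 = fam_disc F t * fam_disc G s) ->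
  fb3 G s - fc G s / 2 <> 0 ->
  fb2 G s = 0 /\ fam_disc G s = (fb3 G s - fc G s / 2) ^ 2.
Proof.
  move=> [o sa s1 s2 s3 sc] h0 [b1 b2 c a b3 db1 db2 dc da] L hn.
  have eq0 := locally_singleton _ _ L.
  rewrite /fam_prod {1}/fam_disc b1 b2 c a in eq0.
  have hb3 : fb3 F t0 ^ 2 <> 0 by apply: pow_nonzero.
  have disc : fam_disc G s = (fb3 G s - fc G s / 2) ^ 2.
    apply: (Rmult_eq_reg_l (fb3 F t0 ^ 2)) => //; rewrite -[LHS]Rplus_0_r.
    transitivity ((0 ^ 2 + 0 ^ 2 + fb3 F t0 ^ 2 - fb3 F t0 * 0) * fam_disc G s); first ring.
    rewrite -eq0; field.
  split=> //.
  have Dz : Derive (fun t => fam_prod F G t s ^ 2 - fam_disc F t * fam_disc G s) t0 = 0.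
    rewrite (Derive_ext_loc _ (fun _ => 0)) ?Derive_const //.
    by apply: filter_imp L => t ->; ring.
  have ea := smooth_on_ex_derive _ _ _ sa h0; have ec := smooth_on_ex_derive _ _ _ sc h0.
  have ex1 := smooth_on_ex_derive _ _ _ s1 h0; have ex2 := smooth_on_ex_derive _ _ _ s2 h0.
  have ex3 := smooth_on_ex_derive _ _ _ s3 h0.
  have : is_derive (fun t => fam_prod F G t s ^ 2 - fam_disc F t * fam_disc G s) t0
     (2 * fam_prod F G t0 s * (Derive (fb1 F) t0 * fb1 G s + Derive (fb2 F) t0 * fb2 G s + Derive (fb3 F) t0 * fb3 G s
        - (Derive (fa F) t0 * fc G s + fa G s * Derive (fc F) t0) / 2)
      - (2 * fb1 F t0 * Derive (fb1 F) t0 + 2 * fb2 F t0 * Derive (fb2 F) t0 + 2 * fb3 F t0 * Derive (fb3 F) t0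
         - Derive (fa F) t0 * fc F t0 - fa F t0 * Derive (fc F) t0) * fam_disc G s).
    rewrite {1}/fam_prod {1}/fam_disc; auto_derive; first by repeat split.
    rewrite /fam_prod; eta_Derive; field.
  move/is_derive_unique; rewrite Dz disc /fam_prod b1 b2 c a db1 dc da => E.
  (* Here the third-order condition [Derive (fa F) t0 = Derive (fb3 F) t0] acts: the terms in
     [Derive (fb3 F) t0] cancel, and a single product is left. *)
  have E2 : fb3 F t0 * (Derive (fb2 F) t0 * ((fb3 G s - fc G s / 2) * fb2 G s)) = 0 by lra.
  case: (Rmult_integral _ _ E2) => // E3; case: (Rmult_integral _ _ E3) => // E4.
  by case: (Rmult_integral _ _ E4).
Qed.

Lemma fam_swapE F G t s : fam_disc (swap_fam F) t = fam_disc F t /\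
  fam_prod (swap_fam F) (swap_fam G) t s = fam_prod F G t s /\ fam_prod G F s t = fam_prod F G t s.
Proof. by rewrite /fam_disc /fam_prod /=; repeat split; field. Qed.

Section Core.
Variables (U : R2 -> Prop) (h : R2 -> R) (HU : open U) (U0 : U (0, 0)) (sh : smooth_on U h).
Variables (I I' : R -> Prop) (F G : fam) (u v : R2 -> R).
Hypotheses (en : enveloped U h I F u) (en' : enveloped U h I' G v).
Hypotheses (ux : ddir dir_x u (0, 0) = 0) (uy : ddir dir_y u (0, 0) <> 0) (txF : touches_x F (u (0, 0))).
Hypotheses (vy : ddir dir_y v (0, 0) = 0) (vx : ddir dir_x v (0, 0) <> 0) (txG : touches_x (swap_fam G) (v (0, 0))).

(** Tangency holds at the pairs [(u w, v w)]; since [u] varies to first order only along [y] and [v]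
    only along [x], these pairs cover a rectangle of parameters. *)
Lemma tangent_rectangle : exists e, 0 < e /\ forall t s,
  Rabs (t - u (0, 0)) < e -> Rabs (s - v (0, 0)) < e ->
  fam_prod F G t s ^ 2 = fam_disc F t * fam_disc G s.
Proof.
  have [e [he H]] := local_surjectivity U u v U HU U0 (en_u _ _ _ _ _ en) (en_u _ _ _ _ _ en') ux uy vy vx (HU _ U0).
  exists e; split=> // t s ht hs; have [w [hw [<- <-]]] := H t s ht hs.
  exact: fam_tangent en en' hw.
Qed.

Lemma locally_near (x : R) (P : R -> Prop) : locally x P <-> exists e, 0 < e /\ forall y, Rabs (y - x) < e -> P y.
Proof.
  split.
    by move=> [e He]; exists e; split; [exact: cond_pos|move=> y hy; exact: He].
  by move=> [e [he He]]; exists (mkposreal e he) => y hy; exact: He.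
Qed.

(** Near the base parameters each family is orthogonal to the plane of symmetry of the other one and
    tangent to its base sphere; the tangency condition then separates the variables. *)
Lemma separated : exists e, 0 < e /\ forall t s,
  Rabs (t - u (0, 0)) < e -> Rabs (s - v (0, 0)) < e ->
  fb1 F t = 0 /\ fam_disc F t = (fb3 F t + fc F t / 2) ^ 2 /\
  fb2 G s = 0 /\ fam_disc G s = (fb3 G s - fc G s / 2) ^ 2 /\
  fc G s * (fb3 F t - fa F t + fc F t / 2) = fc F t * (fa G s + fb3 G s).
Proof.
  have [r [hr H]] := tangent_rectangle.
  have tF := txF; have tG := txG.
  set t0 := u (0, 0) in H tF *; set s0 := v (0, 0) in H tG *.
  have sF := en_fam _ _ _ _ _ en; have sG := en_fam _ _ _ _ _ en'.
  have It0 : I t0 := en_I _ _ _ _ _ en _ U0; have Is0 : I' s0 := en_I _ _ _ _ _ en' _ U0.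
  have [ca [c1 [c2 [c3 cc]]]] := fam_continuous _ _ _ sF It0.
  have [da [d1 [d2 [d3 dc]]]] := fam_continuous _ _ _ sG Is0.
  have cF : continuous (fun t => fb3 F t + fc F t / 2) t0.
    apply: (continuous_plus (fb3 F)) => //; apply: (continuous_mult (fc F) (fun _ => / 2)) => //; exact: continuous_const.
  have cG : continuous (fun s => fb3 G s - fc G s / 2) s0.
    apply: (continuous_minus (fb3 G)) => //; apply: (continuous_mult (fc G) (fun _ => / 2)) => //; exact: continuous_const.
  have [_ _ zc za zb3 _ _ _ _] := tF; have [_ _ yc ya yb3 _ _ _ _] := tG; rewrite /= in yc ya yb3.
  have nG : fb3 G s0 <> 0 by move: yb3; lra.
  have NF : locally t0 (fun t => 0 < (fb3 F t + fc F t / 2) * fb3 F t0).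
    apply: (locally_lt (fun _ => 0)); first exact: continuous_const.
      apply: (continuous_mult (fun t => fb3 F t + fc F t / 2) (fun _ => fb3 F t0)) => //; exact: continuous_const.
    rewrite zc; have := Rsqr_pos_lt _ zb3; rewrite /Rsqr; lra.
  have NG : locally s0 (fun s => 0 < (fb3 G s - fc G s / 2) * fb3 G s0).
    apply: (locally_lt (fun _ => 0)); first exact: continuous_const.
      apply: (continuous_mult (fun s => fb3 G s - fc G s / 2) (fun _ => fb3 G s0)) => //; exact: continuous_const.
    rewrite yc; have := Rsqr_pos_lt _ nG; rewrite /Rsqr; lra.
  have cP : continuous (fun w : R2 => fam_prod F G (fst w) (snd w)) (t0, s0).
    have cfst : forall f : R -> R, continuous f t0 -> continuous (fun w : R2 => f (fst w)) (t0, s0).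
      by move=> f cf; apply: (continuous_comp fst f) => //; exact: continuous_fst.
    have csnd : forall f : R -> R, continuous f s0 -> continuous (fun w : R2 => f (snd w)) (t0, s0).
      by move=> f cf; apply: (continuous_comp snd f) => //; exact: continuous_snd.
    have cm : forall f k : R -> R, continuous f t0 -> continuous k s0 ->
       continuous (fun w : R2 => f (fst w) * k (snd w)) (t0, s0).
      move=> f k cf ck; apply: (continuous_mult (fun w : R2 => f (fst w)) (fun w : R2 => k (snd w))); [exact: cfst|exact: csnd].
    apply: (continuous_minus (fun w : R2 => fb1 F (fst w) * fb1 G (snd w) + fb2 F (fst w) * fb2 G (snd w) + fb3 F (fst w) * fb3 G (snd w))).
      apply: (continuous_plus (fun w : R2 => fb1 F (fst w) * fb1 G (snd w) + fb2 F (fst w) * fb2 G (snd w))); last exact: cm.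
      by apply: (continuous_plus (fun w : R2 => fb1 F (fst w) * fb1 G (snd w))); exact: cm.
    apply: (continuous_mult (fun w : R2 => fa F (fst w) * fc G (snd w) + fa G (snd w) * fc F (fst w)) (fun _ => / 2)); last exact: continuous_const.
    apply: (continuous_plus (fun w : R2 => fa F (fst w) * fc G (snd w))); first exact: cm.
    apply: (continuous_ext (fun w : R2 => fc F (fst w) * fa G (snd w))); last exact: cm.
    by move=> w; rewrite Rmult_comm.
  have NP : locally ((t0, s0) : R2) (fun w : R2 => 0 < fam_prod F G (fst w) (snd w) * (fb3 F t0 * fb3 G s0)).
    apply: (locally_lt (fun _ => 0)); first exact: continuous_const.
      apply: (continuous_mult (fun w : R2 => fam_prod F G (fst w) (snd w)) (fun _ => fb3 F t0 * fb3 G s0)) => //; exact: continuous_const.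
    have [zb1 zb2 _ _ _ _ _ _ _] := tF; have [yb1 yb2 _ _ _ _ _ _ _] := tG; rewrite /= in yb1 yb2.
    rewrite /fam_prod /= zb1 zb2 zc yc.
    have := Rsqr_pos_lt _ zb3; have := Rsqr_pos_lt _ nG; rewrite /Rsqr; nra.
  have [r1 [hr1 H1]] := proj1 (locally_near _ _) NF; have [r2 [hr2 H2]] := proj1 (locally_near _ _) NG.
  case: NP => r3 H3.
  pose e := Rmin (Rmin r r1) (Rmin r2 r3).
  have m1 : e <= r by apply: Rle_trans (Rmin_l _ _) (Rmin_l _ _).
  have m2 : e <= r1 by apply: Rle_trans (Rmin_l _ _) (Rmin_r _ _).
  have m3 : e <= r2 by apply: Rle_trans (Rmin_r _ _) (Rmin_l _ _).
  have m4 : e <= r3 by apply: Rle_trans (Rmin_r _ _) (Rmin_r _ _).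
  have he : 0 < e.
    by apply: Rmin_glb_lt; apply: Rmin_glb_lt => //; exact: cond_pos.
  exists e; split=> // t s ht hs.
  have p1 := H1 t ltac:(lra); have p2 := H2 s ltac:(lra).
  have p3 : 0 < fam_prod F G t s * (fb3 F t0 * fb3 G s0).
    by apply: (H3 (t, s)); split; [change (Rabs (t - t0) < r3)|change (Rabs (s - s0) < r3)]; lra.
  have [q1 q2] : fb2 G s = 0 /\ fam_disc G s = (fb3 G s - fc G s / 2) ^ 2.
    apply: (tangent_to_touching I F t0 G s) => //.
      apply/locally_near; exists r; split=> // t' ht'; apply: H => //; lra.
    by move=> E; rewrite E in p2; lra.
  have [q3 q4] : fb1 F t = 0 /\ fam_disc F t = (fb3 F t + fc F t / 2) ^ 2.
    (* The same argument with the roles exchanged, in mirror image: [swap_fam G] is the family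
       touching along the [x]-axis, and the sign change of [fb3] turns the difference into
       [fb3 F t + fc F t / 2]. *)
    have L : locally s0 (fun s' => fam_prod (swap_fam G) (swap_fam F) s' t ^ 2 =
        fam_disc (swap_fam G) s' * fam_disc (swap_fam F) t).
      apply/locally_near; exists r; split=> // s' hs'.
      have [-> [_ _]] := fam_swapE F F t t; have [-> [_ _]] := fam_swapE G G s' s'.
      have [_ [-> _]] := fam_swapE G F s' t; have [_ [_ ->]] := fam_swapE F G t s'.
      rewrite H //; first ring; lra.
    have ng : fb3 (swap_fam F) t - fc (swap_fam F) t / 2 <> 0.
      rewrite /= => E; have E' : fb3 F t + fc F t / 2 = 0 by lra.
      by rewrite E' in p1; lra.
    have [k1 k2] := tangent_to_touching I' (swap_fam G) s0 (swap_fam F) t (smooth_fam_swap _ _ sG) Is0 tG L ng.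
    rewrite (proj1 (fam_swapE F F t t)) in k2; rewrite /= in k1 k2; split=> //; rewrite k2; field.
  have sq := H t s ltac:(lra) ltac:(lra).
  rewrite q2 q4 in sq.
  (* Extraction of the square root. All three quantities keep near the base parameters the signs
     they have there, where the product is [fb3 F t0 * fb3 G s0]; this excludes the opposite
     root. *)
  have pr : fam_prod F G t s = (fb3 F t + fc F t / 2) * (fb3 G s - fc G s / 2).
    set P := fam_prod F G t s in sq p3 *; set x := fb3 F t + _ in sq p1 *; set y := fb3 G s - _ in sq p2 *.
    have E : (P - x * y) * (P + x * y) = 0 by lra.
    case: (Rmult_integral _ _ E); first lra.
    move=> E'; have : P = - (x * y) by lra.
    move=> E''; rewrite E'' in p3; have := Rmult_lt_0_compat _ _ p1 p2; lra.
  split=> //; split=> //; split=> //; split=> //.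
  rewrite /fam_prod q1 q3 in pr; lra.
Qed.

(** Freezing one sphere of [G] with [fc G s1 <> 0] turns the separated relation into a linear
    relation between the coefficients of [F]. With [fb1 F = 0] and the discriminant identity it
    places [F] on a conic of spheres, that of [cyc_sphere1 A], whose envelope is computed by
    elimination. *)
Lemma enveloped_cyc : exists A, locally ((0, 0) : R2) (fun w => cyc A (fst w) (snd w) (h w) = 0).
Proof.
  have [r [hr H]] := separated.
  have tF := txF; have tG := txG.
  set t0 := u (0, 0) in H tF *; set s0 := v (0, 0) in H tG *.
  have sF := en_fam _ _ _ _ _ en; have sG := en_fam _ _ _ _ _ en'.
  have It0 : I t0 := en_I _ _ _ _ _ en _ U0; have Is0 : I' s0 := en_I _ _ _ _ _ en' _ U0.
  have [zb1 zb2 zc za zb3 zdb1 zdb2 zdc zda] := tF; have [yb1 yb2 yc ya yb3 ydb1 ydb2 ydc yda] := tG.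
  rewrite /= in yb1 yb2 yc ya yb3 ydb2.
  have r0 : Rabs (t0 - t0) < r by rewrite Rminus_diag Rabs_R0.
  (* If [fc G] vanished near [s0], the discriminant identity would reduce to [fb1 G s ^ 2 = 0],
     against the nonzero derivative of [fb1 G] at [s0]. *)
  have [s1 [hs1 cs1]] : exists s, Rabs (s - s0) < r /\ fc G s <> 0.
    case: (excluded_middle_informative (exists s, Rabs (s - s0) < r /\ fc G s <> 0)) => // hno; exfalso.
    apply: ydb2; rewrite (Derive_ext_loc _ (fun _ => 0)) ?Derive_const //.
    apply/locally_near; exists r; split=> // s hs.
    have c0 : fc G s = 0.
      case: (Req_dec (fc G s) 0) => // hc; case: hno; by exists s.
    have [_ [_ [g2 [g3 _]]]] := H t0 s r0 hs.
    rewrite /fam_disc c0 g2 in g3.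
    have : fb1 G s * fb1 G s = 0 by lra.
    by move/Rmult_integral => -[].
  pose lam := (fa G s1 + fb3 G s1) / fc G s1.
  pose A := (1 / 4 - lam) / 4.
  have rel : forall t, Rabs (t - t0) < r -> fb1 F t = 0 /\ fa F t = fb3 F t + (1 / 4 + 4 * A) * fc F t /\
     fb2 F t ^ 2 = (2 * fb3 F t + (1 / 2 + 4 * A) * fc F t) * fc F t.
    move=> t ht; have [f1 [f2 [_ [_ E]]]] := H t s1 ht hs1.
    have Ea : fa F t = fb3 F t + (1 / 4 + 4 * A) * fc F t.
      have : fb3 F t - fa F t + fc F t / 2 = fc F t * lam.
        apply: (Rmult_eq_reg_l (fc G s1)) => //; rewrite E /lam; field; exact: cs1.
      rewrite /A; lra.
    split=> //; split=> //.
    rewrite /fam_disc f1 Ea in f2; lra.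
  pose m t := 2 * fb3 F t + (1 / 2 + 4 * A) * fc F t.
  have [sm1 [sm2 [sm3 smc]]] : smooth_on I (fun t => m t) /\ smooth_on I (fb2 F) /\ smooth_on I (fb3 F) /\ smooth_on I (fc F).
    case: sF => o sa s1' s2 s3 sc; split=> //.
    apply: smooth_on_plus => //; apply: smooth_on_mult => //; exact: smooth_on_const.
  have oI := sm_open _ _ sF.
  have smW : smooth_on I (fun t => Derive (fb2 F) t * m t - fb2 F t * Derive m t).
    have S1 := smooth_on_Derive _ _ oI sm2; have S2 := smooth_on_Derive _ _ oI sm1.
    by apply: smooth_on_minus => //; exact: smooth_on_mult.
  have N1 : locally t0 (fun t => m t <> 0).
    apply: locally_neq0; first exact: smooth_on_continuous sm1 It0.
    by rewrite /m zc; move: zb3; lra.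
  (* This Wronskian is [m ^ 2] times the derivative of [fb2 F / m]; its nonvanishing makes that
     ratio a local parameter on the conic. *)
  have N2 : locally t0 (fun t => Derive (fb2 F) t * m t - fb2 F t * Derive m t <> 0).
    apply: locally_neq0; first exact: smooth_on_continuous smW It0.
    rewrite /m zb2 zc Rmult_0_l Rmult_0_r Rminus_0_r Rplus_0_r.
    by apply: Rmult_integral_contrapositive_currified => //; move: zb3; lra.
  have N3 : locally t0 (fun t => Rabs (t - t0) < r) by apply/locally_near; exists r.
  have cu : continuous u (0, 0) by exact: smooth_on_continuous (en_u _ _ _ _ _ en) U0.
  have N := cu _ (filter_and _ _ N1 (filter_and _ _ N2 N3)); rewrite /filtermap in N.
  exists A.
  have LN : locally ((0, 0) : R2) (fun w => U w /\ m (u w) <> 0 /\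
      Derive (fb2 F) (u w) * m (u w) - fb2 F (u w) * Derive m (u w) <> 0 /\ Rabs (u w - t0) < r).
    by apply: filter_and; [exact: HU|exact: N].
  apply: filter_imp LN => w [hw [n1 [n2 n3]]].
  have It := en_I _ _ _ _ _ en w hw.
  have Q := en_eq _ _ _ _ _ en w hw; have Q' := en_deq _ _ _ _ _ en w hw.
  set t := u w in n1 n2 n3 It Q Q'.
  have [f1 [f2 f3]] := rel t n3.
  have near : locally t (fun t' => Rabs (t' - t0) < r).
    apply/locally_near; exists (r - Rabs (t - t0)); split; first lra.
    move=> t' ht'; have -> : t' - t0 = (t' - t) + (t - t0) by ring.
    have := Rabs_triang (t' - t) (t - t0); lra.
  have e2' := smooth_on_ex_derive _ _ _ sm2 It; have e3' := smooth_on_ex_derive _ _ _ sm3 It.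
  have ec' := smooth_on_ex_derive _ _ _ smc It; have em' := smooth_on_ex_derive _ _ _ sm1 It.
  have Db1 : Derive (fb1 F) t = 0.
    rewrite (Derive_ext_loc _ (fun _ => 0)) ?Derive_const //.
    by apply: filter_imp near => t' ht'; have [] := rel t' ht'.
  have Da : Derive (fa F) t = Derive (fb3 F) t + (1 / 4 + 4 * A) * Derive (fc F) t.
    rewrite (Derive_ext_loc _ (fun t => fb3 F t + (1 / 4 + 4 * A) * fc F t)).
      by apply: is_derive_unique; auto_derive; [|eta_Derive; ring].
    by apply: filter_imp near => t' ht'; have [_ []] := rel t' ht'.
  have Dm : Derive m t = 2 * Derive (fb3 F) t + (1 / 2 + 4 * A) * Derive (fc F) t.
    by apply: is_derive_unique; rewrite /m; auto_derive; [|eta_Derive; ring].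
  have Db2 : 2 * fb2 F t * Derive (fb2 F) t = Derive m t * fc F t + m t * Derive (fc F) t.
    transitivity (Derive (fun t => fb2 F t ^ 2) t).
      by symmetry; apply: is_derive_unique; auto_derive; [|eta_Derive; ring].
    rewrite (Derive_ext_loc _ (fun t => m t * fc F t)); last first.
      by apply: filter_imp near => t' ht'; have [_ []] := rel t' ht'.
    by apply: is_derive_unique; auto_derive; [|eta_Derive; ring].
  rewrite /fam_eq f1 f2 in Q; rewrite /fam_deq Db1 Da in Q'.
  have m3 : fb3 F t = (m t - (1 / 2 + 4 * A) * fc F t) / 2 by rewrite /m; field.
  have dm3 : Derive (fb3 F) t = (Derive m t - (1 / 2 + 4 * A) * Derive (fc F) t) / 2 by rewrite Dm; field.
  rewrite m3 in Q; rewrite dm3 in Q'.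
  have f3' : fb2 F t ^ 2 = m t * fc F t by exact: f3.
  clear f3 f1 f2 Db1 Da Dm m3 dm3 near e2' e3' ec' em' rel.
  move: n1 n2 Q Q' Db2 f3'; move: (m t) (fb2 F t) (fc F t) (Derive m t) (Derive (fb2 F) t) (Derive (fc F) t).
  move: (fst w) (snd w) (h w) => x y z mm b c m' b' c' n1 n2 Q Q' Db2 b2.
  set M0 := (x ^ 2 + y ^ 2 + z ^ 2) / 2 - z.
  set M1 := 1 + 2 * A * (x ^ 2 + y ^ 2 + z ^ 2) + (1 / 2 + 4 * A) * z.
  have E0 : mm * M0 + c * M1 - 2 * b * y = 0 by rewrite -[RHS]Q /M0 /M1; field.
  have E1 : m' * M0 + c' * M1 - 2 * b' * y = 0 by rewrite -[RHS]Q' /M0 /M1; field.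
  have E2 : cyc A x y z = M0 * M1 - y ^ 2 by rewrite /cyc /M0 /M1; field.
  rewrite E2; clearbody M0 M1; clear E2 Q Q'.
  (* With [r = b / mm] the envelope equations read [M0 - 2 r y + r^2 M1 = 0] and
     [r' (r M1 - y) = 0]. As [r' <> 0], the quadratic has a double root and its discriminant
     [y^2 - M0 M1] vanishes. *)
  have E3 : (b' * mm - b * m') * (b * M1 - mm * y) = 0.
    have : mm * (mm * (m' * M0 + c' * M1 - 2 * b' * y) - m' * (mm * M0 + c * M1 - 2 * b * y)) = 0 by rewrite E0 E1; ring.
    have Db2' := f_equal (fun q => mm * q * M1) Db2; have b2' := f_equal (fun q => m' * q * M1) b2; rewrite /= in Db2' b2'.
    lra.
  case: (Rmult_integral _ _ E3) => // E4.
  have E5 : mm ^ 2 * (M0 * M1 - y ^ 2) = 0.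
    have E6 : mm * y = b * M1 by lra.
    have -> : mm ^ 2 * (M0 * M1 - y ^ 2) = mm * M1 * (mm * M0 + c * M1 - 2 * b * y) - mm * c * M1 ^ 2 + 2 * b * M1 * (mm * y) - (mm * y) ^ 2 by ring.
    rewrite E0 -b2 E6; ring.
  by case: (Rmult_integral _ _ E5) => // E6; case: (pow_nonzero _ 2 n1).
Qed.

End Core.

(** * Classification of the cyclides in standard position *)

Definition fam_of (s : R -> sphere) : fam :=
  Fam (fun t => sph_a (s t)) (fun t => cx (sph_b (s t))) (fun t => cy (sph_b (s t)))
      (fun t => cz (sph_b (s t))) (fun t => sph_c (s t)).

Lemma fam_of_eq (s : R -> sphere) t x y z : fam_eq (fam_of s) t x y z = sphere_eq (s t) (x, y, z).
Proof. rewrite /fam_eq /sphere_eq /dot /=; case: (sph_b (s t)) => [[? ?] ?]; rewrite /cx /cy /cz /=; ring. Qed.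

Lemma smooth_fam_of (I : R -> Prop) (s : R -> sphere) : open I -> smooth_spheres I s -> smooth_fam I (fam_of s).
Proof. by move=> o [h1 [[h2 [h3 h4]] h5]]. Qed.

Lemma fam_of_deq (I : R -> Prop) (s : R -> sphere) t x y z : open I -> smooth_spheres I s -> I t ->
  fam_deq (fam_of s) t x y z = Derive (fun t' => sphere_eq (s t') (x, y, z)) t.
Proof.
  move=> o /(smooth_fam_of I s o) [_ sa s1 s2 s3 sc] It; symmetry.
  rewrite (Derive_ext _ (fun t' => fam_eq (fam_of s) t' x y z)); last by move=> t'; rewrite fam_of_eq.
  have ea := smooth_on_ex_derive _ _ _ sa It; have ec := smooth_on_ex_derive _ _ _ sc It.
  have E1 := smooth_on_ex_derive _ _ _ s1 It; have E2 := smooth_on_ex_derive _ _ _ s2 It.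
  have E3 := smooth_on_ex_derive _ _ _ s3 It.
  apply: is_derive_unique; rewrite /fam_eq /fam_deq.
  move: (fam_of s) ea ec E1 E2 E3 => Fm ea ec E1 E2 E3.
  auto_derive; first by repeat split.
  eta_Derive; ring.
Qed.

Lemma locally_open_sub {T : UniformSpace} (x : T) (P : T -> Prop) : locally x P ->
  exists W : T -> Prop, open W /\ W x /\ forall y, W y -> P y.
Proof.
  move=> H; exists (fun y => locally y P); split; [|split] => //.
  - by move=> y hy; exact: locally_locally.
  - by move=> y hy; exact: locally_singleton.
Qed.

Section Classification.
Variables (g gi : R3 -> R3) (D D' : R3 -> Prop) (p : R3).
Hypothesis hpair : moebius_pair g gi D D'.
Hypotheses (Dp : D p) (gp : g p = (0, 0, 0)).

(** The error estimate at the origin itself forces [f (0, 0) = 0], so the graph, and with it the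
    surface, passes through the base point. *)
Lemma standard_position_mem S X1 X2 th1 th2 : standard_position g S p X1 X2 th1 th2 -> S p.
Proof.
  move=> [_ [_ [_ [f [[_ hf] [K hK]]]]]].
  have := locally_singleton _ _ hK.
  have -> : K * (0 ^ 2 + 0 ^ 2) ^ 2 = 0 by ring.
  have -> : f (0, 0) - ((0 ^ 2 - 0 ^ 2) / 2 + (th1 * 0 ^ 3 + th2 * 0 ^ 3) / 6) = f (0, 0) by field.
  move=> h; have f0 : f (0, 0) = 0.
    by case: (Req_dec (f (0, 0)) 0) => // /Rabs_pos_lt; lra.
  by apply: (proj2 (locally_singleton _ _ hf)); rewrite gp /cx /cy /cz /=.
Qed.

(** Both families are pulled back by [gi], so that they envelop the graph of [f] in standard
    position; one of them must osculate along each axis, and [enveloped_cyc] applies. *)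
Lemma cyclide_classification C X1 X2 f : cyclide_at g p X1 X2 C -> graph_at g p C f ->
  exists A, locally ((0, 0) : R2) (fun w => f w = cycF (A, w)).
Proof.
  move=> [[_ [a1 [b1 [s1 [a2 [b2 [s2 [fam1 [fam2 Henv]]]]]]]]] hstd] hf.
  have Cp := standard_position_mem _ _ _ _ _ hstd.
  have [U [u1 [u2 [oU [Up [su1 [su2 HU]]]]]]] := Henv p Cp.
  have [f1 [hf1 [K hK]]] := proj2 (proj2 (proj2 hstd)).
  have feq := graph_at_unique _ _ _ _ _ hpair Dp gp C f f1 hf hf1 Cp.
  have f0 := graph_at_0 _ _ gp C f hf Cp.
  have L := graph_lift_locally _ _ _ _ _ hpair Dp gp C f U hf Cp (oU _ Up).
  have [Uf [oUf [Uf0 sf]]] := proj1 hf.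
  have [W [oW [W0 HW]]] := locally_open_sub _ _ (filter_and _ _ (oUf _ Uf0) L).
  have sfW : smooth_on W f by apply: smooth_on_sub sf => w /HW [].
  have h4 : small4 (fun w => f w - saddle w).
    exists K; apply: filter_imp (filter_and _ _ feq hK) => -[x y] [-> h].
    have -> : saddle (x, y) = (x ^ 2 - y ^ 2) / 2 + (0 * x ^ 3 + 0 * y ^ 3) / 6 by rewrite /saddle /=; field.
    exact: h.
  have sl : smooth_map W (fun w : R2 => (fst w, snd w, f w) : R3).
    split; [|split]; rewrite /cx /cy /cz /=.
    - apply: smooth_on_linear => //; exact: is_linear_fst.
    - apply: smooth_on_linear => //; exact: is_linear_snd.
    - exact: sfW.
  have sx : smooth_map W (fun w : R2 => gi (fst w, snd w, f w)).
    apply: (smooth_map_comp W D') => //; last exact: (pb_smooth' _ _ _ _ hpair).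
    by move=> w /HW [_ []].
  have [_ [_ [_ [_ [m [T [mn [mT [trT [smT prT]]]]]]]]]] := hpair.
  have gi0 : gi (0, 0, f (0, 0)) = p by rewrite f0; exact: gi_0 hpair Dp gp.
  have build : forall a b s u, sphere_family a b s -> smooth_on U u ->
    (forall x, U x -> C x -> in_interval a b (u x) /\ envelope_eqs s (u x) x) ->
    let F := fam_of (fun t => T (s t)) in
    enveloped W f (in_interval a b) F (fun w => u (gi (fst w, snd w, f w))) /\ fb3 F (u p) <> 0 .
    move=> a b s u [h1 [h2 [h3 [h5 _]]]] su HE F.
    have oI : open (in_interval a b) by apply: open_and; [exact: open_Rbar_gt|exact: open_Rbar_lt].
    have sT := smT _ _ oI (conj h1 (conj h2 h3)).
    have en : enveloped W f (in_interval a b) F (fun w => u (gi (fst w, snd w, f w))).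
      split.
      - exact: smooth_fam_of.
      - by apply: (smooth_on_comp_map W U) => // w /HW [_ [_ [_ [_ []]]]].
      - by move=> w /HW [_ [_ [_ [_ [k1 k2]]]]]; have [] := HE _ k2 k1.
      - move=> w /HW [_ [hD' [_ [_ [k1 k2]]]]]; have [_ [k3 _]] := HE _ k2 k1.
        rewrite mT // in k3; rewrite fam_of_eq.
        by case: (Rmult_integral _ _ k3) => // /(mn _ hD').
      - move=> w /HW [_ [hD' [_ [_ [k1 k2]]]]]; have [k0 [_ k3]] := HE _ k2 k1.
        rewrite (fam_of_deq _ _ _ _ _ _ oI sT) //.
        rewrite (Derive_ext _ (fun t' => m (fst w, snd w, f w) * sphere_eq (T (s t')) (fst w, snd w, f w))) in k3; last by move=> t'; exact: mT.
        rewrite Derive_scal in k3.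
        by case: (Rmult_integral _ _ k3) => // /(mn _ hD').
    split=> //.
    (* At the base parameter [fb1], [fb2] and [fc] vanish, so positivity of the discriminant leaves
       [fb3 <> 0]. *)
    have J := saddle_jet_of_small4 W f oW W0 sfW h4.
    have [z1 [z2 [zc _]]] := contact_at_0 W f oW sfW _ F _ en W0 J.
    rewrite gi0 in z1 z2 zc.
    have It : in_interval a b (u p) by have [] := HE p Up Cp.
    have tr := trT _ (h5 _ It).
    move: z1 z2 zc tr; rewrite /F /fam_of /true_sphere /dot /= => -> -> -> tr E.
    rewrite E in tr; lra.
  have [en1 n1] := build _ _ _ u1 fam1 su1 (fun x hx hc => conj (proj1 (HU x hx hc)) (proj1 (proj2 (HU x hx hc)))).
  have [en2 n2] := build _ _ _ u2 fam2 su2 (fun x hx hc => conj (proj1 (proj2 (proj2 (HU x hx hc)))) (proj1 (proj2 (proj2 (proj2 (HU x hx hc)))))).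
  have dif := proj2 (proj2 (proj2 (proj2 (HU p Up Cp)))).
  set F1 := fam_of (fun t => T (s1 t)) in en1 n1; set F2 := fam_of (fun t => T (s2 t)) in en2 n2.
  have notprop : forall k, k <> 0 -> ~ (fa F1 (u1 p) = k * fa F2 (u2 p) /\ fb1 F1 (u1 p) = k * fb1 F2 (u2 p) /\
     fb2 F1 (u1 p) = k * fb2 F2 (u2 p) /\ fb3 F1 (u1 p) = k * fb3 F2 (u2 p) /\ fc F1 (u1 p) = k * fc F2 (u2 p)).
    move=> k hk /scale_sphere_inj /prT E; apply: dif => x; rewrite E.
    have -> : sphere_eq (scale_sphere k (s2 (u2 p))) x = k * sphere_eq (s2 (u2 p)) x.
      by rewrite /sphere_eq /scale_sphere /dot /= !coordE; ring.
    by split=> [/Rmult_integral []|->] //; ring.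
  set v1 := fun w : R2 => u1 (gi (fst w, snd w, f w)) in en1.
  set v2 := fun w : R2 => u2 (gi (fst w, snd w, f w)) in en2.
  have E1 : v1 (0, 0) = u1 p by rewrite /v1 gi0.
  have E2 : v2 (0, 0) = u2 p by rewrite /v2 gi0.
  rewrite -E1 in n1; rewrite -E2 in n2; rewrite -E1 -E2 in notprop.
  have [A HA] : exists A, locally ((0, 0) : R2) (fun w => cyc A (fst w) (snd w) (f w) = 0).
    (* Two families osculating along the same axis would have proportional base spheres, whereas the
       two spheres touching [C] at [p] differ. Only the mixed cases survive. *)
    case: (touches_dichotomy W f _ F1 v1 oW W0 sfW h4 en1 n1) => -[d1 [d1' t1]];
    case: (touches_dichotomy W f _ F2 v2 oW W0 sfW h4 en2 n2) => -[d2 [d2' t2]].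
    - exfalso; case: t1 => p1 p2 pc pa _ _ _ _ _; case: t2 => q1 q2 qc qa _ _ _ _ _.
      apply: (notprop (fb3 F1 (v1 (0, 0)) / fb3 F2 (v2 (0, 0)))).
        by apply: Rmult_integral_contrapositive_currified => //; exact: Rinv_neq_0_compat.
      by rewrite p1 p2 pc pa q1 q2 qc qa; repeat split; field.
    - exact: (enveloped_cyc W f oW W0 sfW _ _ F1 F2 v1 v2 en1 en2 d1 d1' t1 d2 d2' t2).
    - exact: (enveloped_cyc W f oW W0 sfW _ _ F2 F1 v2 v1 en2 en1 d2 d2' t2 d1 d1' t1).
    - exfalso.
      have sw : forall F t, touches_x (swap_fam F) t ->
          fb1 F t = 0 /\ fb2 F t = 0 /\ fc F t = 0 /\ fa F t = - fb3 F t.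
        by move=> F t [].
      have [p1 [p2 [pc pa]]] := sw _ _ t1; have [q1 [q2 [qc qa]]] := sw _ _ t2.
      apply: (notprop (fb3 F1 (v1 (0, 0)) / fb3 F2 (v2 (0, 0)))).
        by apply: Rmult_integral_contrapositive_currified => //; exact: Rinv_neq_0_compat.
      by rewrite p1 p2 pc pa q1 q2 qc qa; repeat split; field.
  exists A.
  (* The equation [cyc A = 0] characterizes [cycF] only inside the box, where continuity and
     [f (0, 0) = 0] keep the graph near the origin. *)
  have cf := smooth_near_continuous _ _ (proj1 hf).
  have Lf : locally ((0, 0) : R2) (fun w => Rabs (f w) < box_size A).
    apply: (locally_lt (fun w => Rabs (f w)) (fun _ => box_size A)).
    - by apply: (continuous_comp f Rabs) => //; exact: continuous_Rabs.
    - exact: continuous_const.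
    - by rewrite f0 Rabs_R0; have [] := box_size_bounds A; lra.
  apply: filter_imp (filter_and _ _ HA (filter_and _ _ Lf (cycF_slice_open A _ (cyc_dom_0 A)))) => -[x y] [k1 [k2 k3]].
  exact: cycF_unique.
Qed.

End Classification.

(** * Order 3 for the whole pencil, order 4 for a single member *)

Theorem theorem1
  (S : R3 -> Prop) (N : R3 -> R3) (k1 k2 : R3 -> R) (p X1 X2 : R3)
  (theta1 theta2 alpha : R) (g : R3 -> R3) (D : R3 -> Prop)
  (hS : oriented_surface S N)
  (hk : principal_curvatures S N k1 k2)
  (hp : S p)
  (hX1 : principal_vector S N p (k1 p) X1)
  (hX2 : principal_vector S N p (k2 p) X2)
  (htheta1 : conformal_curvature S k1 k2 k1 X1 p theta1)
  (htheta2 : conformal_curvature S k1 k2 k2 X2 p theta2)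
  (hg : moebius g D) (hD : D p)
  (hstd : standard_position g S p X1 X2 theta1 theta2)
  (non_dupin : ~ (theta1 = 0 /\ theta2 = 0))
  (halpha : osculation_angle theta1 theta2 alpha) :
  (exists C : R -> R3 -> Prop,
     one_parameter_family g p C /\
     forall t : R, cyclide_at g p X1 X2 (C t) /\
                   tangent_of_order 3 g p (- alpha) S (C t)) /\
  (~ (theta1 = 0 \/ theta2 = 0) ->
   exists C : R3 -> Prop,
     (cyclide_at g p X1 X2 C /\ tangent_of_order 4 g p (- alpha) S C) /\
     forall C' : R3 -> Prop,
       cyclide_at g p X1 X2 C' -> tangent_of_order 4 g p (- alpha) S C' ->
       same_germ p C' C).
Proof.
  have [gi [D' hpair]] := moebius_inverse g D hg.
  have [gp [d1 [d2 [f [hf [K hK]]]]]] := hstd.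
  set c := cos (- alpha); set s := sin (- alpha).
  have hcs : c ^ 2 + s ^ 2 = 1.
    by have := sin2_cos2 (- alpha); rewrite /Rsqr -/c -/s => h; lra.
  have cub : theta1 * c ^ 3 + theta2 * s ^ 3 = 0 by exact: osculation_cubic.
  have std := fun A => cyclide_standard g gi D D' p hpair hD gp X1 X2 A d1 d2.
  have gr := fun A => cyclide_graph_at g gi D D' p hpair hD gp A.
  (* In this direction the cubic term of [S] vanishes, and up to order 3 the members of the pencil
     do not depend on [A]. *)
  have jet3 : forall A i, (i <= 3)%nat -> Derive_n (fun t => f (t * c, t * s)) i 0 =
      Derive_n (fun t => cycF (A, (t * c, t * s))) i 0.
    move=> A i hi; rewrite (line_jet3 f theta1 theta2 c s K i (proj1 hf) hK hcs hi) cycF_line //; last lia.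
    rewrite cub; case: i hi => [|[|[|[|i]]]] hi //; [field|lia].
  split.
    exists (cyclide g D); split; first exact: cyclide_family hpair hD gp.
    move=> t; split; first exact: std.
    exists f, (fun w => cycF (t, w)); split=> //; split; first exact: gr.
    by move=> i hi; exact: jet3.
  move=> non_canal.
  have th1 : theta1 <> 0 by tauto.
  have th2 : theta2 <> 0 by tauto.
  (* The non-canal hypothesis keeps the direction off both axes: [cos alpha <> 0] comes from
     [theta2 <> 0], and [sin alpha = 0] would give [theta1 = 0]. *)
  have csn : c * s <> 0.
    have [hc ht] := proj1 halpha th2.
    rewrite /c /s cos_neg sin_neg => h; case: (Rmult_integral _ _ h) => // hs0.
    have hs : sin alpha = 0 by lra.
    have ht0 : tan alpha ^ 3 = 0 by rewrite /tan hs; field.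
    apply: th1; have -> : theta1 = theta1 / theta2 * theta2 by field.
    by rewrite -ht ht0; ring.
  have csn2 : (c * s) ^ 2 <> 0 by apply: pow_nonzero.
  pose q := Derive_n (fun t => f (t * c, t * s)) 4 0.
  (* Solution of [4 A (c s)^2 + (c^2 - s^2) / 8 = q / 4!], the equality of the quartic coefficients
     on this line. *)
  pose A := (q / INR (fact 4) - (c ^ 2 - s ^ 2) / 8) / (4 * (c * s) ^ 2).
  have jet4 : q = Derive_n (fun t => cycF (A, (t * c, t * s))) 4 0.
    rewrite cycF_line //; have hfact := INR_fact_neq_0 4.
    have -> : 4 * A * (c * s) ^ 2 + (c ^ 2 - s ^ 2) / 8 = q / INR (fact 4).
      rewrite /A; move: (c * s) csn csn2 => cs csn _; field; split=> //.
    by field.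
  exists (cyclide g D A); split.
    split; first exact: std.
    exists f, (fun w => cycF (A, w)); split=> //; split; first exact: gr.
    move=> i hi; have [hi3|hi3] : (i <= 3)%nat \/ (3 < i)%nat by lia.
      exact: jet3.
    have -> : i = 4%nat by lia.
    exact: jet4.
  move=> C' hC' [f' [h' [hf' [hh' H4]]]].
  have [A' hA'] := cyclide_classification g gi D D' p hpair hD gp C' X1 X2 h' hC' hh'.
  (* The tangency of [C'] may be witnessed by another graph function [f'] of [S]; its germ is that
     of [f], so the fourth derivatives can be compared. *)
  have ff := graph_at_unique g gi D D' p hpair hD gp S f f' hf hf' hp.
  have EA : A' = A.
    apply: (cycF_germ_inj A' A c s hcs csn).
    rewrite -jet4 /q.
    rewrite -(Derive_n_ext_loc _ _ 4 0 (locally_line c s _ hA')) -(H4 4%nat ltac:(lia)).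
    symmetry; exact: (Derive_n_ext_loc _ _ 4 0 (locally_line c s _ ff)).
  rewrite EA in hA'.
  exact: (graph_at_same_germ g gi D D' p hpair hD gp C' _ _ _ hh' (gr A) hA').
Qed.
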